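(* Let $\alpha,\beta>0$, $\gamma,\delta\ge0$, $0\le q<1$ be fixed, with associated $A,B,C,D$, and for each $n\ge1$ let $(\tau_1,\dots,\tau_n)$ be distributed according to the stationary measure $\mu_n$ of the $n$-site open ASEP with parameters $(q,\alpha,\beta,\gamma,\delta)$. Let $h_n(x)=\sum_{i=1}^{\lfloor nx\rfloor}\tau_i$ for $x\in[0,1]$. Assume $A=C>1$ and $ABCD\notin\{q^{-l}:l\in\mathbb N_0\}$. Then as $n\to\infty$, in the sense of convergence of finite-dimensional distributions, $$\frac1n\{h_n(x)\}_{x\in[0,1]}\Longrightarrow\{\eta^A(x)\}_{x\in[0,1]},\qquad \eta^A(x):=\frac{Ax+(1-A)(x\wedge U)}{1+A},\quad x\in[0,1],$$ where $U$ is a random variable uniformly distributed on $[0,1]$ and $x\wedge y$ denotes the minimum of $x$ and $y$.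
   Context: $\mathbb N_0=\{0,1,2,\dots\}$; when $q=0$ the set $\{q^{-l}:l\in\mathbb N_0\}$ is read as $\{1\}$. Open ASEP. Parameters $\alpha,\beta>0$, $\gamma,\delta\ge 0$, $0\le q<1$. It is the continuous-time irreducible Markov process on $\{0,1\}^n$ (with $\tau_i\in\{0,1\}$ the occupation variable of site $i\in\{1,\dots,n\}$) in which each particle jumps to its right neighbour at rate $1$ and to its left neighbour at rate $q$, jumps to occupied sites being forbidden; at site $1$ a particle is created at rate $\alpha$ if the site is empty and removed at rate $\gamma$ if it is occupied; at site $n$ a particle is created at rate $\delta$ if the site is empty and removed at rate $\beta$ if it is occupied. $\mu_n$ is its unique stationary probability measure. With $$\kappa_\pm(x,y)=\frac1{2x}\Big(1-q-x+y\pm\sqrt{(1-q-x+y)^2+4xy}\Big)$$ put $A=\kappa_+(\beta,\delta)$, $B=\kappa_-(\beta,\delta)$, $C=\kappa_+(\alpha,\gamma)$, $D=\kappa_-(\alpha,\gamma)$; then $A,C\ge0$ and $-1<B,D\le0$. *)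

(* Defs.v *)
From HB Require Import structures.
From mathcomp Require Import all_boot all_order all_algebra.
From mathcomp Require Import perm.
From mathcomp Require Import all_classical all_reals all_analysis.

Set Implicit Arguments.
Unset Strict Implicit.
Unset Printing Implicit Defensive.

Import Order.TTheory GRing.Theory Num.Theory.
Import numFieldNormedType.Exports.

Local Open Scope classical_set_scope.
Local Open Scope ring_scope.

(* Sites are numbered from 0: the site called i in {1, ..., n} is the ordinal
   of value i - 1. *)
Definition asep_config (n : nat) := {ffun 'I_n -> bool}.

Section OpenASEP.
Variables (R : realType) (q alpha beta gamma delta : R) (n : nat).

Definition exchange_sites (i j : 'I_n) (s : asep_config n) : asep_config n :=
  [ffun k => s (tperm i j k)].

Definition flip_site (i : 'I_n) (s : asep_config n) : asep_config n :=
  [ffun k => if k == i then ~~ s k else s k].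

(* Written as sums of elementary moves, so that the rates of the two boundary
   mechanisms add up when n = 1. *)
Definition asep_generator (f : asep_config n -> R) (s : asep_config n) : R :=
    \sum_(i < n) \sum_(j < n | (j : nat) == i.+1)
       (if s i && ~~ s j then 1 else if ~~ s i && s j then q else 0)
         * (f (exchange_sites i j s) - f s)
  + \sum_(i < n | (i : nat) == 0%N)
       (if s i then gamma else alpha) * (f (flip_site i s) - f s)
  + \sum_(i < n | i.+1 == n)
       (if s i then beta else delta) * (f (flip_site i s) - f s).

(* The semigroup exp (t L); the exponential series converges because L is a
   linear operator on a finite-dimensional space. *)
Definition asep_semigroup (t : R) (f : asep_config n -> R) (s : asep_config n) : R :=
  limn (series (fun k => t ^+ k / k`!%:R * iter k asep_generator f s)).

Definition asep_stationary (mu : asep_config n -> R) : Prop :=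
  [/\ forall s, 0 <= mu s,
      \sum_s mu s = 1 &
      forall (t : R) (f : asep_config n -> R), 0 <= t ->
        \sum_s mu s * asep_semigroup t f s = \sum_s mu s * f s].

End OpenASEP.

Section Constants.
Variable R : realType.

Definition kappa_plus (q x y : R) : R :=
  (2 * x)^-1 * (1 - q - x + y + Num.sqrt ((1 - q - x + y) ^+ 2 + 4 * x * y)).

Definition kappa_minus (q x y : R) : R :=
  (2 * x)^-1 * (1 - q - x + y - Num.sqrt ((1 - q - x + y) ^+ 2 + 4 * x * y)).

(* In the library 0 ^- l = 0 for l > 0, hence the separate case q = 0. *)
Definition inv_powers (q : R) : set R :=
  if q == 0 then [set 1] else [set q ^- l | l in [set: nat]].

End Constants.

(* Convergence of finite-dimensional distributions of real-valued processes
   indexed by D, each on its own probability space: the laws of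
   (X_ n t_1, ..., X_ n t_k) converge weakly to that of (X t_1, ..., X t_k). *)
Definition fdd_convergence (R : realType) (T : Type) (D : set T)
    (d_ : nat -> measure_display) (Om_ : forall n, measurableType (d_ n))
    (P_ : forall n, probability (Om_ n) R) (X_ : forall n, T -> Om_ n -> R)
    (d : measure_display) (Om : measurableType d) (P : probability Om R)
    (X : T -> Om -> R) : Prop :=
  forall (k : nat) (t : 'I_k -> T), (forall j, D (t j)) ->
  forall f : 'rV[R]_k -> R, continuous f ->
    (exists M : R, forall v, `|f v| <= M) ->
    ('E_(P_ n)[fun w => f (\row_j X_ n (t j) w)])%E @[n --> \oo]
      --> ('E_P[fun w => f (\row_j X (t j) w)])%E.

Definition asep_height (R : realType) (n : nat) (s : 'I_n -> bool) (x : R) : R :=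
  \sum_(i < n | i.+1%:Z <= Num.floor (n%:R * x)) (s i)%:R.

Definition shock_profile (R : realType) (A u x : R) : R :=
  (A * x + (1 - A) * Num.min x u) / (1 + A).

(* Main.v *)
Require Import Defs.
From HB Require Import structures.
From mathcomp Require Import all_boot all_order all_algebra.
From mathcomp Require Import perm ring lra.
From mathcomp Require Import all_classical all_reals all_analysis.

(* The unnormalised stationary weight of a word is <W| X_1 ... X_n |V>, where a
   particle contributes the matrix 1 + d and a hole 1 + e, with
   d e - q e d = 1 - q.  If <W| carries the left boundary parameters (C, D) then
   <W'| = <W| (1 - C d) carries (q C, D), and <W| (1 + d), <W| (1 + e) are the
   Bernoulli weights of density 1 / (1 + C) times <W| plus a multiple of <W'|;
   the right boundary vector behaves in the same way with density A / (1 + A).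
   Peeling letters off both ends writes the weight as a sum, over the position
   of a defect, of Bernoulli weights of density 1 / (1 + A) on its left and
   A / (1 + A) on its right, both growing at the rate
   lam = (1 + A) (1 + 1 / A) per site because A = C.  The defect itself
   grows at a strictly smaller rate, hence is microscopic, and every position has
   the same asymptotic weight: this is the uniform variable U.  That this common
   weight does not vanish follows from a Perron argument, after shifting C and D
   until the transfer operator and the boundary vector are nonnegative. *)

Set Implicit Arguments.
Unset Strict Implicit.
Unset Printing Implicit Defensive.

Import Order.TTheory GRing.Theory Num.Theory.
Import numFieldNormedType.Exports.

Local Open Scope classical_set_scope.
Local Open Scope ring_scope.

(** * Sums over words *)

(** The weights, and still more those of shifted boundary vectors, have no sign known in advance.
    Sums over words are therefore bounded in absolute value, and the weights are identified with
    [mu n] by uniqueness among signed invariant measures. A vector [y] is represented by its moments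
    [<W| d^k y>]. In these coordinates [<W|] is evaluation at 0, and the right boundary vector
    solves a three-term recurrence with denominators [1 - A B C D q^k], nonzero by the assumption on
    [A B C D]. Each of the [n] positions of the defect contributes a multiple of [lam^n], so the
    normalisation is of order [n lam^n], and the term without defect, of order [lam^n], disappears
    in the limit. Errors are summed over all positions, which leaves no room for a rate above [lam].
    For vectors shifted on both sides any rate strictly between the true one and [lam] is good
    enough. The vector shifted only on the left needs the sharp rate, which comes from treating the
    doubly shifted one as a perturbation of smaller exponential order. *)

Section WordSums.
Variable R : realFieldType.

Fixpoint wsum (n : nat) (F : seq bool -> R) : R :=
  if n is n'.+1 then wsum n' (F \o cons true) + wsum n' (F \o cons false)
  else F [::].

Lemma eq_wsum n F G : F =1 G -> wsum n F = wsum n G.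
Proof. by move=> eFG; have -> : F = G by apply: funext. Qed.

Lemma eq_wsum_size n F G :
  (forall w, size w = n -> F w = G w) -> wsum n F = wsum n G.
Proof.
elim: n F G => [|n IH] F G eFG /=; first exact: eFG.
by congr (_ + _); apply: IH => w sw; apply: eFG; rewrite /= sw.
Qed.

Lemma wsumD n F G : wsum n (fun w => F w + G w) = wsum n F + wsum n G.
Proof. by elim: n F G => [//|n IH] F G /=; rewrite !IH addrACA. Qed.

Lemma wsumZ n a F : wsum n (fun w => a * F w) = a * wsum n F.
Proof. by elim: n F => [//|n IH] F /=; rewrite !IH mulrDr. Qed.

Lemma wsum_split n F : wsum n.+1 F =
  wsum n (fun w => F (true :: w) + F (false :: w)).
Proof. by rewrite wsumD. Qed.

Lemma ler_wsum n F G :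
  (forall w, size w = n -> F w <= G w) -> wsum n F <= wsum n G.
Proof.
elim: n F G => [|n IH] F G leFG /=; first exact: leFG.
by apply: lerD; apply: IH => w sw; apply: leFG; rewrite /= sw.
Qed.

Lemma wsum_ge0 n F : (forall w, 0 <= F w) -> 0 <= wsum n F.
Proof.
by elim: n F => [|n IH] F F0 /=; [exact: F0|rewrite addr_ge0 ?IH //= => w; exact: F0].
Qed.

Lemma ler_norm_wsum n F : `|wsum n F| <= wsum n (fun w => `|F w|).
Proof.
by elim: n F => [//|n IH] F /=; rewrite (le_trans (ler_normD _ _)) ?lerD ?IH.
Qed.

Lemma wsum_rcons n F :
  wsum n.+1 F = wsum n (fun w => F (rcons w true) + F (rcons w false)).
Proof.
elim: n F => [//|n IH] F.
rewrite -[LHS]/(wsum n.+1 (F \o cons true) + wsum n.+1 (F \o cons false)).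
by rewrite (IH (F \o cons true)) (IH (F \o cons false)).
Qed.

Lemma wsum_cat m n F :
  wsum (m + n) F = wsum m (fun u => wsum n (fun v => F (u ++ v))).
Proof. by elim: m F => [//|m IH] F /=; rewrite !IH. Qed.

End WordSums.

(** * The oscillator algebra and its boundary vectors *)

Fact osc_key : unit. Proof. exact: tt. Qed.

Section Oscillator.
Variables (R : realFieldType) (q c d : R).
Implicit Types (a A B C D : R) (u v y f : nat -> R^o) (W : (nat -> R^o) -> R).

(* [lower] and [raise] are d and e in the coordinates <W| d^k y of a vector y,
   for a left boundary vector <W| with parameters (c, d). They are locked so that
   rewriting with linearity does not unfold them into sums of sequences. *)
Definition lower := locked_with osc_key (fun f : nat -> R^o =>
  (fun k => f k.+1) : nat -> R^o).

Definition raise := locked_with osc_key (fun f : nat -> R^o => (fun k =>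
  q ^+ k * (c + d) * f k - q ^+ k * (c * d) * f k.+1 + (1 - q ^+ k) * f k.-1)
  : nat -> R^o).

Lemma lowerE f k : lower f k = f k.+1.
Proof. by rewrite /lower unlock. Qed.

Lemma raiseE f k : raise f k =
  q ^+ k * (c + d) * f k - q ^+ k * (c * d) * f k.+1 + (1 - q ^+ k) * f k.-1.
Proof. by rewrite /raise unlock. Qed.

Lemma addfE u v k : (u + v) k = u k + v k. Proof. by []. Qed.
Lemma oppfE u k : (- u) k = - u k. Proof. by []. Qed.
Lemma scalefE a u k : (a *: u) k = a * u k. Proof. by []. Qed.

Definition seqE := (addfE, oppfE, scalefE, lowerE, raiseE).

Lemma lowerP a u v : lower (a *: u + v) = a *: lower u + lower v.
Proof. by apply/funext => k; rewrite !seqE. Qed.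

Lemma raiseP a u v : raise (a *: u + v) = a *: raise u + raise v.
Proof. by apply/funext => k; rewrite !seqE; ring. Qed.

(** The formula of [raise] comes from moving [e] to the left through [d^k] by this relation and
    absorbing it into [<W|]. At [k = 0] the term in [f k.-1] carries the factor [1 - q ^+ 0 = 0]. *)
Lemma oscillatorP u : lower (raise u) = q *: raise (lower u) + (1 - q) *: u.
Proof. by apply/funext => -[|k]; rewrite !seqE /= ?exprS; ring. Qed.

Definition lin W := forall a u v, W (a *: u + v) = a * W u + W v.

Lemma linD W u v : lin W -> W (u + v) = W u + W v.
Proof. by move=> WL; rewrite -[u]scale1r WL mul1r scale1r. Qed.

Lemma lin0 W : lin W -> W 0 = 0.
Proof.
by move=> WL; apply: (addIr (W 0)); rewrite -linD // addr0 add0r.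
Qed.

Lemma linZ W a u : lin W -> W (a *: u) = a * W u.
Proof. by move=> WL; rewrite -[a *: u]addr0 WL lin0 // addr0. Qed.

Lemma linN W u : lin W -> W (- u) = - W u.
Proof. by move=> WL; rewrite -scaleN1r linZ // mulN1r. Qed.

Definition linE := (linD, linN, linZ).

Lemma lin_lower W : lin W -> lin (W \o lower).
Proof. by move=> WL a u v /=; rewrite lowerP. Qed.

Lemma lin_raise W : lin W -> lin (W \o raise).
Proof. by move=> WL a u v /=; rewrite raiseP WL. Qed.

Lemma lin_iter_lower W k : lin W -> lin (fun y => W (iter k lower y)).
Proof.
elim: k W => [//|k IH] W WL a u v.
by have := IH _ (lin_lower WL) a u v.
Qed.

Lemma lin_iter_raise W k : lin W -> lin (fun y => W (iter k raise y)).
Proof.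
elim: k W => [//|k IH] W WL a u v.
by have := IH _ (lin_raise WL) a u v.
Qed.

Definition site := locked_with osc_key
  (fun (b : bool) y => if b then y + lower y else y + raise y).

Lemma site1 y : site true y = y + lower y.
Proof. by rewrite /site unlock. Qed.

Lemma site0 y : site false y = y + raise y.
Proof. by rewrite /site unlock. Qed.

Lemma siteP b a u v : site b (a *: u + v) = a *: site b u + site b v.
Proof.
by case: b; rewrite ?site1 ?site0 ?lowerP ?raiseP scalerDr addrACA.
Qed.

Definition act (w : seq bool) y := foldr site y w.

Lemma actP w a u v : act w (a *: u + v) = a *: act w u + act w v.
Proof. by elim: w => [//|b w IH]; rewrite /= IH siteP. Qed.

Lemma lin_act W w : lin W -> lin (fun y => W (act w y)).
Proof. by move=> WL a u v; rewrite actP WL. Qed.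

Lemma act_cat w1 w2 y : act (w1 ++ w2) y = act w1 (act w2 y).
Proof. exact: foldr_cat. Qed.

Lemma act_rcons w b y : act (rcons w b) y = act w (site b y).
Proof. by rewrite -cats1 act_cat. Qed.

Definition total := locked_with osc_key
  (fun y => site true y + site false y).

Lemma total_site y : total y = site true y + site false y.
Proof. by rewrite /total unlock. Qed.

Lemma totalP a u v : total (a *: u + v) = a *: total u + total v.
Proof. by rewrite !total_site !siteP scalerDr addrACA. Qed.

Lemma totalE y : total y = 2 *: y + lower y + raise y.
Proof.
by rewrite total_site site1 site0 scaler_nat mulr2n addrACA addrA.
Qed.

Lemma lin_total W : lin W -> lin (W \o total).
Proof. by move=> WL a u v; rewrite /= totalP WL. Qed.

Lemma wsum_act n W y : lin W -> wsum n (fun w => W (act w y)) = W (iter n total y).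
Proof.
elim: n W => [//|n IH] W WL.
rewrite wsum_split -[RHS]/((W \o total) (iter n total y)).
rewrite -(IH _ (lin_total WL)); apply: eq_wsum => w.
by rewrite /= -linD // total_site.
Qed.

Lemma lin_iter_total W n : lin W -> lin (fun y => W (iter n total y)).
Proof.
move=> WL a u v; rewrite -!wsum_act // -wsumZ -wsumD.
by apply: eq_wsum => w; apply: (lin_act w WL).
Qed.

(* In terms of D = (1 + d) / (1 - q) and E = (1 + e) / (1 - q), these are the
   boundary relations <W| (alpha E - gamma D) = <W| and
   (beta D - delta E) |V> = |V> of the matrix product ansatz. *)
Definition lbound C D W := lin W /\
  forall y, W (raise y) = (C + D) * W y - C * D * W (lower y).

Definition rbound A B y :=
  lower y = (A + B) *: y - (A * B) *: raise y.

(* 1 - C d vanishes in the one-dimensional representation d = 1 / C, e = C. *)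
Definition lshift C W y := W (y - C *: lower y).
Definition rshift A y := y - A *: raise y.

Lemma lin_lshift C W : lin W -> lin (lshift C W).
Proof.
move=> WL a u v; rewrite /lshift lowerP.
rewrite !linE // ?WL; ring.
Qed.

(** Moving [raise] to the left past [lower] costs a factor [q], and this factor turns [C] into
    [q C]. *)
Lemma lshift_lbound C D W : lbound C D W -> lbound (q * C) D (lshift C W).
Proof.
move=> [WL WE]; split; first exact: lin_lshift.
move=> y; rewrite /lshift !(linE, WE, oscillatorP) //; ring.
Qed.

Lemma lboundC C D W : lbound C D W -> lbound D C W.
Proof. by move=> [WL WE]; split=> // y; rewrite WE; ring. Qed.

Lemma lshift_lboundr C D W : lbound C D W -> lbound C (q * D) (lshift D W).
Proof. by move=> /lboundC/lshift_lbound/lboundC. Qed.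

Lemma raiseB u v : raise (u - v) = raise u - raise v.
Proof. by rewrite addrC -scaleN1r raiseP scaleN1r addrC. Qed.
Lemma raiseZ a u : raise (a *: u) = a *: raise u.
Proof. by apply/funext => k; rewrite !seqE; ring. Qed.

Lemma rshift_rbound A B y : rbound A B y -> rbound (q * A) B (rshift A y).
Proof.
rewrite /rbound /rshift => yE.
have -> : lower (y - A *: raise y) = lower y - A *: lower (raise y).
  by rewrite addrC -scaleNr lowerP scaleNr addrC.
rewrite oscillatorP {}yE !(raiseB, raiseZ).
by apply/funext => k; rewrite !seqE; ring.
Qed.

(** The two boundary relations together determine [W (lower y)] from [W y]. Since the right-hand
    side factors, nonvanishing of [W y] passes to the shifted functional whenever [A C] and [B C]
    differ from 1. *)
Lemma lshift_gap A B C D W y : lbound C D W -> rbound A B y ->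
  lshift C W y * (1 - A * B * C * D) = (1 - A * C) * (1 - B * C) * W y.
Proof.
move=> [WL WE] yE; rewrite /lshift !linE //.
have := congr1 W yE; rewrite !linE // WE => E.
have E2 : W (lower y) * (1 - A * B * C * D) = (A + B - A * B * (C + D)) * W y.
  by rewrite mulrBr mulr1 {1}E; ring.
transitivity (W y * (1 - A * B * C * D)
  - C * (W (lower y) * (1 - A * B * C * D))); first by ring.
by rewrite E2; ring.
Qed.

(** [lwt] and [rwt] are the letters evaluated in the one-dimensional representations
    [d = 1 / C, e = C] and [d = A, e = 1 / A]; [ldef] and [rdef] are the coefficients of the shifted
    vector left over. The two values of [lwt C] add up to [ev C], as do those of [rwt C]. *)
Definition lwt C (b : bool) : R := if b then 1 + C^-1 else 1 + C.
Definition ldef C D (b : bool) : R := if b then - C^-1 else D.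
Definition rwt A (b : bool) : R := if b then 1 + A else 1 + A^-1.
Definition rdef A B (b : bool) : R := if b then B else - A^-1.

Lemma lpeel C D W b y : C != 0 -> lbound C D W ->
  W (site b y) = lwt C b * W y + ldef C D b * lshift C W y.
Proof.
move=> C0 [WL WE]; rewrite /lwt /ldef /lshift; case: b.
  by rewrite site1 !linE //; field.
by rewrite site0 !(linE, WE) //; ring.
Qed.

Lemma rpeel A B y b : A != 0 -> rbound A B y ->
  site b y = rwt A b *: y + rdef A B b *: rshift A y.
Proof.
move=> A0 yE; rewrite /rwt /rdef /rshift; case: b; apply/funext => k.
  by rewrite site1 yE !(addfE, oppfE, scalefE); ring.
by rewrite site0 !(addfE, oppfE, scalefE); field.
Qed.

Definition ev C : R := 2 + C + C^-1.

Lemma ltotal C D W y : C != 0 -> lbound C D W ->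
  W (total y) = ev C * W y + (D - C^-1) * lshift C W y.
Proof.
move=> C0 Wb; have WL := Wb.1.
rewrite total_site linD // !(lpeel _ _ C0 Wb) /lwt /ldef /ev; ring.
Qed.

Lemma rtotal A B y : A != 0 -> rbound A B y ->
  total y = ev A *: y + (B - A^-1) *: rshift A y.
Proof.
move=> A0 yb; rewrite total_site !(rpeel _ A0 yb) /rwt /rdef /ev.
by apply/funext => k; rewrite !(addfE, oppfE, scalefE); ring.
Qed.

End Oscillator.

(** * Growth of the weights of shifted boundary vectors *)

Section Bounds.
Variables (R : realType) (q c d : R).
Hypotheses (q_ge0 : 0 <= q) (q_lt1 : q < 1).
Implicit Types (a r A B C D : R) (u v y f : nat -> R^o) (W : (nat -> R^o) -> R).

Local Notation lower := (@lower R).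
Local Notation raise := (raise q c d).
Local Notation site := (site q c d).
Local Notation act := (act q c d).
Local Notation lbound := (lbound q c d).
Local Notation rbound := (rbound q c d).
Local Notation rshift := (rshift q c d).

Let qk_ge0 k : 0 <= q ^+ k. Proof. exact: exprn_ge0. Qed.
Let qk_le1 k : q ^+ k <= 1. Proof. by rewrite exprn_ile1 // ltW. Qed.

Lemma iter_lower_raise k y : iter k lower (raise y) =
  q ^+ k *: raise (iter k lower y) + (1 - q ^+ k) *: iter k.-1 lower y.
Proof.
have lZ a u : lower (a *: u) = a *: lower u.
  by apply/funext => j; rewrite !seqE.
elim: k => [|k IH]; first by rewrite expr0 subrr scale0r addr0 scale1r.
rewrite !iterS IH lowerP lZ oscillatorP.
case: k {IH} => [|k].
  by apply/funext => j; rewrite !(addfE, oppfE, scalefE) ?exprS /=; ring.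
by apply/funext => j; rewrite !(addfE, oppfE, scalefE) ?exprS /=; ring.
Qed.

Lemma lower_iter_raise k y : lower (iter k raise y) =
  q ^+ k *: iter k raise (lower y) + (1 - q ^+ k) *: iter k.-1 raise y.
Proof.
elim: k => [|k IH]; first by rewrite expr0 subrr scale0r addr0 scale1r.
rewrite !iterS oscillatorP IH raiseP raiseZ.
case: k {IH} => [|k].
  by apply/funext => j; rewrite !(addfE, oppfE, scalefE) ?exprS /=; ring.
by apply/funext => j; rewrite !(addfE, oppfE, scalefE) ?exprS /=; ring.
Qed.

Lemma lbound_iter_raise C D W k y : lbound C D W ->
  W (iter k lower (raise y)) =
  q ^+ k * ((C + D) * W (iter k lower y) - C * D * W (iter k.+1 lower y))
  + (1 - q ^+ k) * W (iter k.-1 lower y).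
Proof. by move=> [WL WE]; rewrite iter_lower_raise !linE // WE. Qed.

(** The recurrence for the moments of a right boundary vector. Besides giving bounds, it dictates
    the construction of [bvec]. *)
Lemma lbound_iter_rbound A B C D W k y : lbound C D W -> rbound A B y ->
  W (iter k.+1 lower y) * (1 - A * B * C * D * q ^+ k) =
  (A + B - A * B * (C + D) * q ^+ k) * W (iter k lower y)
  - A * B * (1 - q ^+ k) * W (iter k.-1 lower y).
Proof.
move=> Wb yb; have [WL _] := Wb.
have E : W (iter k.+1 lower y) = (A + B) * W (iter k lower y)
    - A * B * W (iter k lower (raise y)).
  rewrite iterSr yb addrC -scaleNr.
  by rewrite (lin_iter_lower k WL) (linZ _ _ (lin_iter_lower k WL)); ring.
rewrite (lbound_iter_raise k y Wb) in E.
by rewrite mulrBr mulr1 {1}E; ring.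
Qed.

(** In the moment recurrence the absolute values of the coefficients add up to at most the
    denominator: the differences split into nonnegative products such as [(1 + A) (1 + B)] and
    [(1 - A) (1 - B)]. So no moment exceeds the first; two consecutive ones are carried through the
    induction. *)
Lemma lower_bound0 A B C D W y k : 0 <= C -> C <= 1 -> -1 <= D -> D <= 0 -> lbound C D W ->
  0 <= A -> A <= 1 -> -1 < B -> B <= 0 -> rbound A B y ->
  `|W (iter k lower y)| <= `|W y|.
Proof.
move=> C_ge0 C_le1 D_geN1 D_le0 Wb A_ge0 A_le1 B_gtN1 B_le0 yb.
suff : `|W (iter k lower y)| <= `|W y| /\ `|W (iter k.+1 lower y)| <= `|W y|.
  by case.
have p_ge0 : 0 <= - (A * B) by rewrite -mulrN mulr_ge0 // oppr_ge0.
have step j (x z : R) : `|x| <= `|W y| -> `|z| <= `|W y| ->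
    W (iter j.+1 lower y) * (1 - A * B * C * D * q ^+ j) =
    (A + B - A * B * (C + D) * q ^+ j) * x - A * B * (1 - q ^+ j) * z ->
    `|W (iter j.+1 lower y)| <= `|W y|.
  set M := `|W y| => xM zM E.
  have t0 := qk_ge0 j; have t1 := qk_le1 j.
  set t := q ^+ j in E t0 t1 *.
  have den : 0 < 1 - A * B * C * D * t.
    have : A * B * C * D * t <= - B.
      have -> : A * B * C * D * t = (- B) * (A * (C * (- D) * t)) by ring.
      rewrite ler_piMr ?oppr_ge0 //.
      rewrite mulr_ile1 ?mulr_ge0 ?oppr_ge0 //.
      by rewrite !mulr_ile1 ?mulr_ge0 ?oppr_ge0 // lerNl.
    lra.
  have c1 : `|A + B - A * B * (C + D) * t| + - (A * B) * (1 - t)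
      <= 1 - A * B * C * D * t.
    rewrite -lerBrDr ler_norml; apply/andP; split.
      rewrite -subr_ge0.
      have -> : A + B - A * B * (C + D) * t -
        - (1 - A * B * C * D * t - - (A * B) * (1 - t)) =
        (1 + A) * (1 + B) + - (A * B) * t * ((1 + C) * (1 + D)) by ring.
      by rewrite addr_ge0 // !mulr_ge0 //; lra.
    rewrite -subr_ge0.
    have -> : 1 - A * B * C * D * t - - (A * B) * (1 - t) -
      (A + B - A * B * (C + D) * t) =
      (1 - A) * (1 - B) + - (A * B) * t * ((1 - C) * (1 - D)) by ring.
    by rewrite addr_ge0 // !mulr_ge0 //; lra.
  rewrite -(ler_pM2r den) -{1}(gtr0_norm den) -normrM E.
  apply: le_trans (ler_wpM2l (normr_ge0 _) c1).
  rewrite (le_trans (ler_normB _ _)) // [leRHS]mulrDr lerD //.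
    by rewrite normrM mulrC ler_wpM2r.
  have -> : A * B * (1 - t) * z = - (- (A * B) * (1 - t) * z) by ring.
  rewrite normrN normrM [X in X * _]ger0_norm; last first.
    by rewrite mulr_ge0 // subr_ge0.
  by rewrite [leRHS]mulrC ler_wpM2l // mulr_ge0 // subr_ge0.
elim: k => [|k [IH1 IH2]].
  split => //; apply: (step 0%N (W y) (W y)) => //.
  by rewrite (lbound_iter_rbound 0 Wb yb).
split => //; apply: (step k.+1 (W (iter k.+1 lower y)) (W (iter k lower y))) => //.
by rewrite (lbound_iter_rbound k.+1 Wb yb).
Qed.

(** In moment coordinates both [lower] and [raise] are contractions for the supremum norm, the
    latter because [(1 + C) (1 + D)] and [(1 - C) (1 - D)] are nonnegative. *)
Lemma site_bound0 C D W b y M : 0 <= C -> C <= 1 -> -1 <= D -> D <= 0 -> lbound C D W ->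
  (forall k, `|W (iter k lower y)| <= M) ->
  forall k, `|W (iter k lower (site b y))| <= 2 * M.
Proof.
move=> C_ge0 C_le1 D_geN1 D_le0 Wb yM k; have [WL _] := Wb.
have WkL := lin_iter_lower k WL.
case: b; rewrite ?site1 ?site0 (linD _ _ WkL) (le_trans (ler_normD _ _)) //
  mulrDl mul1r lerD //.
  by rewrite -(iterSr k lower).
rewrite (lbound_iter_raise k y Wb).
have M0 : 0 <= M by apply: le_trans (yM 0%N).
have t0 := qk_ge0 k; have t1 := qk_le1 k.
have cd : `|C + D| - C * D <= 1.
  rewrite -lerBrDr ler_norml opprB; apply/andP; split.
    rewrite -subr_ge0; have -> : C + D - (- (C * D) - 1) = (1 + C) * (1 + D) by ring.
    by rewrite mulr_ge0 //; lra.
  rewrite -subr_ge0; have -> : 1 - - (C * D) - (C + D) = (1 - C) * (1 - D) by ring.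
  by rewrite mulr_ge0 //; lra.
have Mx : `|(C + D) * W (iter k lower y) - C * D * W (iter k.+1 lower y)| <= M.
  rewrite (le_trans (ler_normB _ _)) //.
  have -> : C * D * W (iter k.+1 lower y) = - (- (C * D) * W (iter k.+1 lower y)).
    by ring.
  rewrite normrN !normrM [`| - _|]ger0_norm; last first.
    by rewrite -mulrN mulr_ge0 // oppr_ge0.
  apply: (@le_trans _ _ ((`|C + D| - C * D) * M)).
    rewrite mulrDl lerD // ler_wpM2l //.
    by rewrite -mulrN mulr_ge0 // oppr_ge0.
  by rewrite ler_piMl.
rewrite (le_trans (ler_normD _ _)) // !normrM (ger0_norm t0).
rewrite (@ger0_norm _ (1 - _)) ?subr_ge0 //.
apply: (@le_trans _ _ (q ^+ k * M + (1 - q ^+ k) * M)); last by lra.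
by rewrite lerD // ler_wpM2l // subr_ge0.
Qed.

Lemma act_bound0 A B C D W y w : 0 <= C -> C <= 1 -> -1 <= D -> D <= 0 -> lbound C D W ->
  0 <= A -> A <= 1 -> -1 < B -> B <= 0 -> rbound A B y ->
  forall k, `|W (iter k lower (act w y))| <= 2 ^+ size w * `|W y|.
Proof.
move=> C_ge0 C_le1 D_geN1 D_le0 Wb A0 A1 B1 B0 yb; elim: w => [|b w IH] k.
  by rewrite mul1r; apply: lower_bound0 Wb _ _ _ _ yb.
by rewrite /= exprS -mulrA; apply: site_bound0 Wb _ _.
Qed.

(** There are [2 ^ n] words, each of weight at most [2 ^ n] times the initial one. The rate
    [4 = ev 1] is the least value of [ev] on the positive axis, so this crude count is good
    enough. *)
Lemma wsum_bound0 A B C D W y n : 0 <= C -> C <= 1 -> -1 <= D -> D <= 0 -> lbound C D W ->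
  0 <= A -> A <= 1 -> -1 < B -> B <= 0 -> rbound A B y ->
  wsum n (fun w => `|W (act w y)|) <= 4 ^+ n * `|W y|.
Proof.
move=> C_ge0 C_le1 D_geN1 D_le0 Wb A0 A1 B1 B0 yb.
apply: (@le_trans _ _ (wsum n (fun=> 2 ^+ n * `|W y|))).
  by apply: ler_wsum => w <-; apply: (act_bound0 w C_ge0 C_le1 D_geN1 D_le0 Wb A0 A1 B1 B0 yb 0).
have cst x : wsum n (fun=> x) = 2 ^+ n * x :> R.
  by elim: n => [|n IH]; rewrite ?mul1r //= IH exprS; ring.
by rewrite cst mulrA -exprMn -natrM.
Qed.

(** The source grows strictly faster than the homogeneous solution and imposes its rate [r]. *)
Lemma geometric_recursion (T : nat -> R) rho r K : 0 <= rho -> rho < r -> 0 <= K ->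
  0 <= T 0%N -> (forall n, T n.+1 <= rho * T n + K * r ^+ n) ->
  exists2 K', 0 <= K' & forall n, T n <= K' * r ^+ n.
Proof.
move=> rho0 rr K0 T0 TS.
have r0 : 0 < r - rho by rewrite subr_gt0.
exists (T 0%N + K / (r - rho)); first by rewrite addr_ge0 // divr_ge0 // ltW.
elim=> [|n IH]; first by rewrite mulr1 lerDl divr_ge0 // ltW.
apply: le_trans (TS n) _.
apply: (@le_trans _ _ (rho * ((T 0%N + K / (r - rho)) * r ^+ n) + K * r ^+ n)).
  by rewrite lerD2r ler_wpM2l.
rewrite exprS -subr_ge0.
have -> : (T 0 + K / (r - rho)) * (r * r ^+ n) -
   (rho * ((T 0 + K / (r - rho)) * r ^+ n) + K * r ^+ n) =
   T 0%N * (r - rho) * r ^+ n by field; rewrite lt0r_neq0.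
by rewrite !mulr_ge0 // ?exprn_ge0 ?ltW // (le_lt_trans rho0).
Qed.

Lemma ev_le A a : 1 <= A -> A <= a -> ev A <= ev a.
Proof.
move=> A1 Aa; have A0 : 0 < A by lra.
have a0 : 0 < a by lra.
rewrite /ev -subr_ge0.
have -> : 2 + a + a^-1 - (2 + A + A^-1) = (a - A) * (1 - A^-1 * a^-1).
  by field; rewrite !lt0r_neq0.
rewrite mulr_ge0 ?subr_ge0 //.
have ia1 : a^-1 <= 1 by rewrite invf_le1 //; lra.
have iA1 : A^-1 <= 1 by rewrite invf_le1.
by rewrite mulr_ile1 ?invr_ge0 ?(ltW A0) ?(ltW a0).
Qed.

Lemma ev_lt A a : 1 <= A -> A < a -> ev A < ev a.
Proof.
move=> A1 Aa; have A0 : 0 < A by lra.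
have a0 : 0 < a by lra.
rewrite /ev -subr_gt0.
have -> : 2 + a + a^-1 - (2 + A + A^-1) = (a - A) * (1 - A^-1 * a^-1).
  by field; rewrite !lt0r_neq0.
rewrite mulr_gt0 ?subr_gt0 //.
have ia1 : a^-1 < 1 by rewrite invf_lt1 //; lra.
have iA1 : A^-1 <= 1 by rewrite invf_le1.
by rewrite mulrC (le_lt_trans _ ia1) // ler_piMr // invr_ge0 ltW.
Qed.

Lemma ev_ge4 a : 0 < a -> 4 <= ev a.
Proof.
move=> a0; rewrite /ev -subr_ge0.
have -> : 2 + a + a^-1 - 4 = (a - 1) ^+ 2 / a by field; rewrite lt0r_neq0.
by rewrite divr_ge0 ?sqr_ge0 // ltW.
Qed.

Lemma bernoulli_ineq (x : R) n : 0 <= x -> 1 + n%:R * x <= (1 + x) ^+ n.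
Proof.
move=> x0; elim: n => [|n IH]; first by rewrite mul0r addr0.
rewrite exprS; apply: (@le_trans _ _ ((1 + x) * (1 + n%:R * x))); last first.
  by rewrite ler_wpM2l // addr_ge0.
rewrite -subr_ge0 -natr1.
have -> : (1 + x) * (1 + n%:R * x) - (1 + (n%:R + 1) * x) = n%:R * x ^+ 2 by ring.
by rewrite mulr_ge0 // sqr_ge0.
Qed.

Lemma expr_small (x : R) : 0 < x -> exists m, q ^+ m <= x.
Proof.
move=> x0; have [->|qN0] := eqVneq q 0; first by exists 1%N; rewrite expr1 ltW.
have q0 : 0 < q by rewrite lt_neqAle eq_sym qN0 q_ge0.
have y0 : 0 < q^-1 - 1 by rewrite subr_gt0 invf_gt1 // q_lt1.
have z0 : 0 <= x^-1 / (q^-1 - 1) by rewrite divr_ge0 ?invr_ge0 ?(ltW x0) ?(ltW y0).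
exists (Num.bound (x^-1 / (q^-1 - 1))); set m := Num.bound _.
have mP : x^-1 / (q^-1 - 1) < m%:R by apply: archi_boundP.
rewrite -[q]invrK exprVn -[x]invrK lef_pV2 ?posrE ?exprn_gt0 ?invr_gt0 //.
rewrite ltr_pdivrMr // in mP.
have := bernoulli_ineq m (ltW y0); rewrite addrCA subrr addr0; apply: le_trans.
by apply: le_trans (ltW mP) _; rewrite lerDr.
Qed.

Definition geometric_tv r W y := exists2 K, 0 <= K &
  forall n, wsum n (fun w => `|W (act w y)|) <= K * r ^+ n.

(** Peeling the last letter gives a recursion of rate [ev A], because both [rwt A] are positive,
    with the shifted vector as source. *)
Lemma geometric_tv_right r A B C D W y : lbound C D W -> rbound A B y ->
  1 <= A -> ev A < r -> geometric_tv r W (rshift A y) -> geometric_tv r W y.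
Proof.
move=> [WL _] yb A1 Ar [K K0 KP].
have A0 : 0 < A by lra.
pose s := `|rdef A B true| + `|rdef A B false|.
apply: (@geometric_recursion _ (ev A) _ (s * K)) => //.
- by have := ev_ge4 A0; lra.
- by rewrite mulr_ge0 // addr_ge0.
- by apply: wsum_ge0.
move=> n; rewrite wsum_rcons -wsumZ -mulrA.
apply: (@le_trans _ _ (wsum n (fun w => ev A * `|W (act w y)|) +
   s * wsum n (fun w => `|W (act w (rshift A y))|))); last first.
  by rewrite lerD2l ler_wpM2l // addr_ge0.
rewrite -wsumZ -wsumD; apply: ler_wsum => w _.
rewrite !act_rcons.
have E b : W (act w (site b y)) =
   rwt A b * W (act w y) + rdef A B b * W (act w (rshift A y)).
  rewrite (rpeel _ (lt0r_neq0 A0) yb) actP WL.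
  by rewrite (linZ _ _ (lin_act q c d w WL)).
rewrite !E (le_trans (lerD (ler_normD _ _) (ler_normD _ _))) // !normrM.
rewrite ![`|rwt _ _|]ger0_norm /rwt /=; first last.
- by rewrite addr_ge0 // ltW.
- by rewrite addr_ge0 // invr_ge0 ltW.
rewrite /s /ev /rdef /=; lra.
Qed.

Lemma geometric_tv_left r A B C D W y : lbound C D W -> rbound A B y ->
  1 <= C -> ev C < r -> geometric_tv r (lshift C W) y -> geometric_tv r W y.
Proof.
move=> Wb yb C1 Cr [K K0 KP].
have C0 : 0 < C by lra.
pose s := `|ldef C D true| + `|ldef C D false|.
apply: (@geometric_recursion _ (ev C) _ (s * K)) => //.
- by have := ev_ge4 C0; lra.
- by rewrite mulr_ge0 // addr_ge0.
- by apply: wsum_ge0.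
move=> n; rewrite wsum_split -wsumZ -mulrA.
apply: (@le_trans _ _ (wsum n (fun w => ev C * `|W (act w y)|) +
   s * wsum n (fun w => `|lshift C W (act w y)|))); last first.
  by rewrite lerD2l ler_wpM2l // addr_ge0.
rewrite -wsumZ -wsumD; apply: ler_wsum => w _.
rewrite /= !(lpeel _ _ (lt0r_neq0 C0) Wb).
rewrite (le_trans (lerD (ler_normD _ _) (ler_normD _ _))) // !normrM.
rewrite ![`|lwt _ _|]ger0_norm /lwt /=; first last.
- by rewrite addr_ge0 // invr_ge0 ltW.
- by rewrite addr_ge0 // ltW.
rewrite /s /ev /ldef /=; lra.
Qed.

(** Finitely many shifts bring both large parameters below 1, where the rate is at most 4. Undoing
    them one at a time costs rates [ev A] and [ev C], all bounded by [ev a < r]. *)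
Lemma geometric_tv_bound a r A B C D W y : 1 <= a -> ev a < r ->
  0 <= A -> A <= a -> 0 <= C -> C <= a -> -1 < B -> B <= 0 -> -1 < D -> D <= 0 ->
  lbound C D W -> rbound A B y -> geometric_tv r W y.
Proof.
move=> a1 ar A0 Aa C0 Ca B1 B0 D1 D0 Wb yb.
have a0 : 0 < a by lra.
have [m qm] : exists m, q ^+ m <= a^-1 by apply: expr_small; rewrite invr_gt0.
have small x : 0 <= x -> x <= a -> q ^+ m * x <= 1.
  move=> x0 xa; rewrite (le_trans (ler_wpM2r x0 qm)) // mulrC ler_pdivrMr //.
  by rewrite mul1r.
have qle x : 0 <= x -> x <= a -> 0 <= q * x <= a.
  by move=> x0 xa; rewrite mulr_ge0 //= (le_trans _ xa) // ler_piMl // ltW.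
have Am := small _ A0 Aa; have Cm := small _ C0 Ca.
(* [n] bounds the number of right shifts still required to bring [A] below 1; [C] is already at most
   1 here, and the left shifts are treated afterwards by the same induction. *)
have rP : forall n A y, 0 <= A -> A <= a -> q ^+ n * A <= 1 ->
    rbound A B y -> forall C W, 0 <= C -> C <= 1 -> lbound C D W ->
    geometric_tv r W y.
  elim=> [|n IH] A' y' A'0 A'a qA' yb' C' W' C'0 C'1 Wb'.
    rewrite mul1r in qA'; exists `|W' y'| => // n.
    rewrite mulrC (le_trans (wsum_bound0 n C'0 C'1 (ltW D1) D0 Wb' A'0 qA' B1 B0 yb')) //.
    by rewrite ler_wpM2r // lerXn2r ?nnegrE //; have := ev_ge4 a0; lra.
  have [A'1|A'1] := lerP 1 A'; last first.
    apply: (IH A' y' _ _ _ _ C') => //.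
    by rewrite mulr_ile1 // ltW.
  apply: (geometric_tv_right Wb' yb' A'1).
    by rewrite (le_lt_trans (ev_le A'1 A'a)).
  have /andP[qA0 qAa] := qle _ A'0 A'a.
  apply: (IH (q * A') _ _ _ _ _ C') => //; last exact: rshift_rbound.
  by rewrite mulrA -exprSr.
suff lP : forall n C W, 0 <= C -> C <= a -> q ^+ n * C <= 1 -> lbound C D W ->
    geometric_tv r W y by apply: (lP m C).
elim=> [|n IH] C' W' C'0 C'a qC' Wb'.
  by rewrite mul1r in qC'; apply: (rP m A y A0 Aa Am yb C').
have [C'1|C'1] := lerP 1 C'; last first.
  by apply: (rP m A y A0 Aa Am yb C') => //; apply: ltW.
apply: (geometric_tv_left Wb' yb C'1).
  by rewrite (le_lt_trans (ev_le C'1 C'a)).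
have /andP[qC0 qCa] := qle _ C'0 C'a.
apply: (IH (q * C')) => //; last exact: lshift_lbound.
by rewrite mulrA -exprSr.
Qed.

End Bounds.

(** * Lower bound on the growth *)

Section Perron.
Variables (R : realType) (q c d : R).
Hypotheses (q_ge0 : 0 <= q) (q_lt1 : q < 1).
Implicit Types (a r A B C D : R) (u v y f : nat -> R^o) (W : (nat -> R^o) -> R).

Local Notation lower := (@lower R).
Local Notation raise := (raise q c d).
Local Notation total := (total q c d).
Local Notation lbound := (lbound q c d).
Local Notation rbound := (rbound q c d).

Let qk_ge0 k : 0 <= q ^+ k. Proof. exact: exprn_ge0. Qed.
Let qk_le1 k : q ^+ k <= 1. Proof. by rewrite exprn_ile1 // ltW. Qed.

Lemma lower_iter_rbound A B W k y : lin W -> rbound A B y ->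
  W (lower (iter k raise y)) =
  q ^+ k * ((A + B) * W (iter k raise y) - A * B * W (iter k.+1 raise y))
  + (1 - q ^+ k) * W (iter k.-1 raise y).
Proof.
move=> WL yb; rewrite lower_iter_raise !linE // yb addrC -scaleNr.
rewrite (lin_iter_raise q c d k WL) (linZ _ _ (lin_iter_raise q c d k WL)).
by rewrite -iterSr; ring.
Qed.

(** On the vectors [raise^k y] the transfer operator is tridiagonal, and the coefficient of the
    missing neighbour at [k = 0] is zero. *)
Lemma total_iter_raise A B W k y : lin W -> rbound A B y ->
  W (total (iter k raise y)) =
  (2 + q ^+ k * (A + B)) * W (iter k raise y)
  + (1 - q ^+ k * (A * B)) * W (iter k.+1 raise y)
  + (1 - q ^+ k) * W (iter k.-1 raise y).
Proof.
move=> WL yb; rewrite totalE !linE // (lower_iter_rbound k WL yb); ring.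
Qed.

Lemma raise_iter_rbound A B C D W k y : lbound C D W -> rbound A B y ->
  W (iter k.+1 raise y) * (1 - A * B * C * D * q ^+ k) =
  (C + D - C * D * (A + B) * q ^+ k) * W (iter k raise y)
  - C * D * (1 - q ^+ k) * W (iter k.-1 raise y).
Proof.
move=> [WL WE] yb; have := WE (iter k raise y).
rewrite (lower_iter_rbound k WL yb) -iterS => E.
by rewrite mulrBr mulr1 {1}E; ring.
Qed.

Lemma finite_scaling (f g : nat -> R) K : (forall k, (k < K)%N -> 0 < f k) ->
  exists2 eps, 0 < eps & forall k, (k < K)%N -> eps * g k <= f k.
Proof.
elim: K => [|K IH] f0; first by exists 1.
have [k kK|eps e0 eP] := IH; first by apply: f0; apply: ltnW.
have [g0|g0] := lerP (g K) 0.
  exists eps => // k; rewrite ltnS leq_eqVlt => /predU1P[->|/eP //].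
  by rewrite (le_trans _ (ltW (f0 K _))) // pmulr_rle0.
exists (Num.min eps (f K / g K)).
  by rewrite lt_min e0 divr_gt0 // f0.
move=> k; rewrite ltnS leq_eqVlt => /predU1P[->|kK].
  by rewrite -ler_pdivlMr // ge_min lexx orbT.
have [gk|gk] := lerP (g k) 0.
  apply: le_trans (ltW (f0 k (ltnW kK))).
  by rewrite pmulr_rle0 // lt_min e0 divr_gt0 // f0.
by rewrite (le_trans _ (eP k kK)) // ler_wpM2r ?(ltW gk) // ge_min lexx.
Qed.

(** Under these sign conditions the tridiagonal operator has nonnegative coefficients and the
    initial data [W (raise^k y)] are nonnegative. Comparison with a finitely supported subsolution
    then yields growth at every rate below [ev A]. *)
Lemma perron_growth r A B C D W y : lbound C D W -> rbound A B y ->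
  1 < A -> -1 < B -> B <= 0 -> 0 <= C -> A * C <= 1 -> - C <= D -> D <= 0 ->
  0 < r -> r < ev A -> 0 < W y ->
  exists N, exists2 eps, 0 < eps &
    forall n, eps * r ^+ n <= W (iter (n + N) total y).
Proof.
move=> Wb yb A1 B1 B0 C0 AC CD D0 r0 rA Wy.
have A0 : 0 < A by lra.
have p0 : 0 <= - (A * B) by rewrite -mulrN mulr_ge0 ?oppr_ge0 // ltW.
have CD0 : 0 <= - (C * D) by rewrite -mulrN mulr_ge0 ?oppr_ge0.
have WL := Wb.1.
(* [A C <= 1] keeps the denominator of the recurrence positive, and [- C <= D] makes its leading
   coefficient nonnegative. *)
have phi0 k : 0 <= W (iter k raise y).
  suff : 0 <= W (iter k raise y) /\ 0 <= W (iter k.+1 raise y) by case.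
  have step j : 0 <= W (iter j raise y) -> 0 <= W (iter j.-1 raise y) ->
      0 <= W (iter j.+1 raise y).
    have t0 := qk_ge0 j; have t1 := qk_le1 j => x0 z0.
    have E := raise_iter_rbound j Wb yb.
    have den : 0 < 1 - A * B * C * D * q ^+ j.
      have C1 : C <= 1 by rewrite (le_trans _ AC) // ler_peMl // ltW.
      have -> : A * B * C * D * q ^+ j = - B * ((A * C) * (- D * q ^+ j)) by ring.
      rewrite subr_gt0 (@le_lt_trans _ _ (- B)) //; last by lra.
      rewrite ler_piMr ?oppr_ge0 // mulr_ile1 ?mulr_ge0 ?oppr_ge0 ?(ltW A0) //.
      by rewrite mulr_ile1 ?oppr_ge0 //; lra.
    rewrite -(pmulr_lge0 _ den) E addr_ge0 //; last first.
      rewrite -[C * D * _ * _]mulrA -mulNr mulr_ge0 // mulr_ge0 //.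
      by rewrite subr_ge0.
    rewrite mulr_ge0 //.
    have -> : C + D - C * D * (A + B) * q ^+ j =
       (C + D) + - (C * D) * ((A + B) * q ^+ j) by ring.
    by rewrite addr_ge0 ?mulr_ge0 //; lra.
  elim: k => [|k [IH1 IH2]].
    by split; [exact: ltW|apply: step; exact: ltW].
  by split=> //; apply: step.
pose phi n k := W (iter n total (iter k raise y)).
have phiS n k : phi n.+1 k = (2 + q ^+ k * (A + B)) * phi n k
  + (1 - q ^+ k * (A * B)) * phi n k.+1 + (1 - q ^+ k) * phi n k.-1.
  rewrite /phi iterSr.
  exact: (total_iter_raise k (lin_iter_total q c d n WL) yb).
have c1 k : 2 <= 2 + q ^+ k * (A + B) by rewrite lerDl mulr_ge0 //; lra.
have c2 k : 1 <= 1 - q ^+ k * (A * B) by rewrite lerDl -mulrN mulr_ge0.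
have c3 k : 0 <= 1 - q ^+ k by rewrite subr_ge0.
have phi_ge0 n k : 0 <= phi n k.
  elim: n k => [|n IH] k; first exact: phi0.
  rewrite phiS !addr_ge0 ?mulr_ge0 //.
    by have := c1 k; lra.
  by have := c2 k; lra.
have phi_gt0 n k : (k <= n)%N -> 0 < phi n k.
  elim: n k => [|n IH] k; first by rewrite leqn0 => /eqP->.
  rewrite phiS leq_eqVlt => /predU1P[->|kn]; last first.
    rewrite -addrA ltr_wpDr ?addr_ge0 ?mulr_ge0 //; first by have := c2 k; lra.
    by rewrite mulr_gt0 ?IH //; have := c1 k; lra.
  rewrite ltr_wpDl ?addr_ge0 ?mulr_ge0 //; first by have := c1 n.+1; lra.
    by have := c2 n.+1; lra.
  by rewrite mulr_gt0 ?IH //= subr_gt0 exprn_ilt1.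
have AV : A^-1 < A by rewrite (@lt_trans _ _ 1) // invf_lt1.
have [k0 k0P] : exists k0, q ^+ k0 <= (A - A^-1) / (A + 1).
  by apply: expr_small => //; rewrite divr_gt0 ?subr_gt0 //; lra.
have g0 : 0 < ev A - r by rewrite subr_gt0.
(* From [k0] on, the terms in [q ^+ k] are beaten by the gain [A - A^-1] due to the slope of the
   cutoff. Below [k0] their deficit is at most 2, and there the cutoff is at least
   [2 / (ev A - r)]. *)
pose K := (k0 + Num.bound (2 / (ev A - r)))%N.
(* A^-k is an exact eigenvector of eigenvalue [ev A]; cut off linearly, it is
   a subsolution for every smaller eigenvalue. *)
pose theta k : R := A ^- k * (K - k)%N%:R.
have thetaS k : r * theta k <= (2 + q ^+ k * (A + B)) * theta k
    + (1 - q ^+ k * (A * B)) * theta k.+1 + (1 - q ^+ k) * theta k.-1.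
  have th0 j : 0 <= theta j by rewrite mulr_ge0 // invr_ge0 exprn_ge0 // ltW.
  have [kK|kK] := ltnP k K; last first.
    rewrite {1}/theta; have -> : (K - k = 0)%N by apply/eqP; rewrite subn_eq0.
    have c1k := c1 k; have c2k := c2 k.
    rewrite !mulr0; apply: addr_ge0; last exact: mulr_ge0 (c3 k) (th0 _).
    by apply: addr_ge0; apply: mulr_ge0 => //; lra.
  set T : R := (K - k)%N%:R.
  have T1 : 1 <= T by rewrite ler1n subn_gt0.
  have E1 : theta k = A ^- k * T by [].
  have E2 : theta k.+1 = A ^- k * (A^-1 * (T - 1)).
    rewrite /theta exprS invfM subnS -subn1 natrB ?subn_gt0 // -/T; ring.
  have E3 : (1 - q ^+ k) * theta k.-1 = A ^- k * ((1 - q ^+ k) * A * (T + 1)).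
    case: (k) @T T1 E1 E2 kK => [|j] T _ _ _ kK.
      by rewrite expr0 subrr !mul0r mulr0.
    rewrite /theta /= [A ^+ j.+1]exprS invfM.
    have -> : ((K - j)%N%:R = T + 1 :> R).
      by rewrite /T natr1 subnS prednK // subn_gt0 ltnW.
    by field; rewrite expf_neq0 ?lt0r_neq0.
  rewrite E1 E2 E3 -subr_ge0.
  have -> : (2 + q ^+ k * (A + B)) * (A ^- k * T) +
     (1 - q ^+ k * (A * B)) * (A ^- k * (A^-1 * (T - 1))) +
     A ^- k * ((1 - q ^+ k) * A * (T + 1)) - r * (A ^- k * T) =
     A ^- k * (T * (ev A - r) + (A - A^-1 - q ^+ k * (A - B))).
    by rewrite /ev; field; rewrite expf_neq0 lt0r_neq0.
  rewrite mulr_ge0 ?invr_ge0 ?exprn_ge0 ?(ltW A0) //.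
  have [kk0|kk0] := leqP k0 k.
    rewrite addr_ge0 // ?(mulr_ge0 (le_trans ler01 T1) (ltW g0)) //.
    rewrite subr_ge0 (@le_trans _ _ (q ^+ k0 * (A + 1))) //; last first.
      by rewrite -ler_pdivlMr //; lra.
    rewrite ler_pM //; first by lra.
      by rewrite ler_wiXn2l // ltW.
    by lra.
  have T2 : 2 <= T * (ev A - r).
    rewrite -ler_pdivrMr // (@le_trans _ _ (Num.bound (2 / (ev A - r)))%:R) //.
      by rewrite ltW // archi_boundP // divr_ge0 // ltW.
    rewrite ler_nat /K -(leq_add2r k) subnK ?(ltnW kK) // addnC leq_add2r.
    exact: ltnW.
  have := qk_le1 k; have := qk_ge0 k; set t := q ^+ k => t0 t1.
  have iA : A^-1 < 1 by rewrite invf_lt1.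
  have tA : t * (A - B) <= A - B by rewrite ler_piMl //; lra.
  lra.
(* After [K] steps [phi K] is strictly positive on the whole support of [theta], which starts the
   comparison. *)
have [eps e0 eP] := @finite_scaling (phi K) theta K (fun k kK => phi_gt0 K k (ltnW kK)).
have dom n k : eps * (r ^+ n * theta k) <= phi (n + K)%N k.
  elim: n k => [|n IH] k.
    have [kK|kK] := ltnP k K; first by rewrite mul1r; apply: eP.
    rewrite /theta; have -> : (K - k = 0)%N by apply/eqP; rewrite subn_eq0.
    by rewrite !mulr0 phi_ge0.
  rewrite addSn phiS exprS.
  apply: (@le_trans _ _ (eps * (r ^+ n * (r * theta k)))).
    by rewrite le_eqVlt -[r * r ^+ n * _]mulrA [r * (r ^+ n * _)]mulrCA eqxx.
  apply: (@le_trans _ _ (eps * (r ^+ n * ((2 + q ^+ k * (A + B)) * theta k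
    + (1 - q ^+ k * (A * B)) * theta k.+1 + (1 - q ^+ k) * theta k.-1)))).
    by rewrite ler_wpM2l ?(ltW e0) // ler_wpM2l ?exprn_ge0 ?(ltW r0).
  have -> : eps * (r ^+ n * ((2 + q ^+ k * (A + B)) * theta k
    + (1 - q ^+ k * (A * B)) * theta k.+1 + (1 - q ^+ k) * theta k.-1)) =
    (2 + q ^+ k * (A + B)) * (eps * (r ^+ n * theta k))
    + (1 - q ^+ k * (A * B)) * (eps * (r ^+ n * theta k.+1))
    + (1 - q ^+ k) * (eps * (r ^+ n * theta k.-1)) by ring.
  rewrite !lerD // ler_wpM2l //.
    by have := c1 k; lra.
  by have := c2 k; lra.
exists K, (eps * theta 0%N).
  rewrite mulr_gt0 // /theta expr0 invr1 mul1r subn0 ltr0n /K addn_gt0.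
  have b0 : 0 <= 2 / (ev A - r) by rewrite divr_ge0 // ltW.
  by rewrite orbC -(ltr0n R) (le_lt_trans b0) // archi_boundP.
by move=> n; rewrite mulrAC -mulrA; apply: dom.
Qed.

(* Shifting preserves the assumed bound, so it may be applied until A C <= 1 and
   |D| <= C, where [perron_growth] contradicts it. *)
Lemma no_subdominant_growth r A B C D W y K :
  lbound C D W -> rbound A B y ->
  1 < A -> -1 < B -> B <= 0 -> 0 <= C -> (C = 0 -> q = 0) -> -1 < D -> D <= 0 ->
  (forall k, 1 - A * B * C * D * q ^+ k != 0) ->
  W y != 0 -> 0 < r -> r < ev A ->
  (forall n, `|W (iter n total y)| <= K * r ^+ n) -> False.
Proof.
move=> Wb yb A1 B1 B0 C0 Cq D1 D0 gen Wy r0 rA.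
have A0 : 0 < A by lra.
(* A rate strictly between: growth of order [r' ^ n] cannot be bounded by a multiple of [r ^ n]. *)
have [r' r'r r'A] : exists2 r', r < r' & r' < ev A.
  by exists ((r + ev A) / 2); rewrite ?midf_lt.
have final C' D' W' K' : lbound C' D' W' -> 0 <= C' -> A * C' <= 1 ->
    - C' <= D' -> D' <= 0 -> W' y != 0 ->
    (forall n, `|W' (iter n total y)| <= K' * r ^+ n) -> False.
  move=> Wb' C'0 AC' CD' D'0 Wy' Wr.
  (* The boundary relation is linear in the functional, so its sign may be chosen to make the value
     at [y] positive. *)
  pose W2 u := Num.sg (W' y) * W' u.
  have W2b : lbound C' D' W2.
    case: Wb' => WL WE; split=> [a u v|u]; rewrite /W2 ?WL ?WE; ring.
  have W20 : 0 < W2 y by rewrite /W2 -normrEsg normr_gt0.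
  have [|N [eps e0 eP]] := perron_growth W2b yb A1 B1 B0 C'0 AC' CD' D'0 _ r'A W20.
    exact: lt_trans r'r.
  have W2r n : eps * r' ^+ n <= K' * r ^+ N * r ^+ n.
    apply: le_trans (eP n) _; rewrite -mulrA -exprD addnC.
    apply: le_trans (Wr _); apply: le_trans (ler_norm _) _.
    by rewrite /W2 normrM normr_sg Wy' mul1r.
  move: (K' * r ^+ N) W2r => KN W2r.
  have K0 : 0 < KN.
    by have := W2r 0%N; rewrite !mulr1; apply: lt_le_trans.
  have r'0 : 0 < r' by apply: lt_trans r'r.
  have qr : 0 <= r / r' by rewrite divr_ge0 // ltW.
  have qr1 : r / r' < 1 by rewrite ltr_pdivrMr // mul1r.
  have x0 : 0 < eps / KN / 2 by rewrite !divr_gt0.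
  have [m mP] := expr_small qr qr1 x0.
  move: mP; rewrite expr_div_n ler_pdivrMr ?exprn_gt0 // => mP.
  have := ler_wpM2l (ltW K0) mP; have := W2r m.
  have -> : KN * (eps / KN / 2 * r' ^+ m) =
    eps * r' ^+ m / 2 by field; rewrite lt0r_neq0.
  by have := mulr_gt0 e0 (exprn_gt0 m r'0); lra.
have Cstep : forall m C W K, q ^+ m * C <= A^-1 -> lbound C D W -> 0 <= C ->
    (C = 0 -> q = 0) -> (forall k, 1 - A * B * C * D * q ^+ k != 0) ->
    W y != 0 -> (forall n, `|W (iter n total y)| <= K * r ^+ n) -> False.
  have AC1 C' : C' <= A^-1 -> A * C' <= 1.
    by move=> CA; rewrite mulrC -ler_pdivlMr // mul1r.
  have Dstep C' m : 0 <= C' -> C' <= A^-1 -> forall D W K, - C' <= q ^+ m * D ->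
      lbound C' D W -> -1 < D -> D <= 0 -> (forall k, 1 - A * B * C' * D * q ^+ k != 0) ->
      W y != 0 -> (forall n, `|W (iter n total y)| <= K * r ^+ n) -> False.
    move=> C'0 CA; elim: m => [|m IH] D' W' K' qD Wb' D1' D0' gen' Wy' Wr.
      by rewrite mul1r in qD; apply: (final C' D' W' K') => //; apply: AC1.
    have [CD|CD] := lerP (- C') D'; first by apply: (final C' D' W' K') => //; apply: AC1.
    have D'0 : D' != 0 by rewrite lt_eqF //; lra.
    (* By [ltotal], [c0] times the shifted functional is [W' (total y) - ev D' * W' y], so a bound
       of rate [r] passes to the shift with constant [(r + |ev D'|) K' / c0]. The shift in [C']
       below follows the same scheme. *)
    pose c0 := C' - D'^-1.
    have c00 : 0 < c0 by rewrite /c0 subr_gt0 (@lt_le_trans _ _ 0) // invr_lt0 lt_neqAle D'0.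
    have Wbr := lboundC Wb'.
    apply: (IH (q * D') (lshift D' W') ((r + `|ev D'|) * K' / c0)).
    - by rewrite mulrA -exprSr.
    - exact: lshift_lboundr.
    - by rewrite (lt_le_trans D1') // ler_niMl // ltW.
    - by rewrite mulr_ge0_le0.
    - move=> k; have := gen' k.+1; apply: contra => /eqP E; apply/eqP.
      by rewrite -E exprS; ring.
    - have := lshift_gap Wbr yb; have -> : 1 - A * B * D' * C' = 1 - A * B * C' * D' * q ^+ 0.
        by rewrite expr0; ring.
      move=> E; have : lshift D' W' y * (1 - A * B * C' * D' * q ^+ 0) != 0.
        rewrite E !mulf_neq0 // subr_eq0 eq_sym lt_eqF //.
          by rewrite (@le_lt_trans _ _ 0) // mulr_ge0_le0 // ltW.
        have -> : B * D' = (- B) * (- D') by ring.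
        by rewrite mulr_ilt1 ?oppr_ge0 //; lra.
      by rewrite mulf_eq0 negb_or => /andP[].
    move=> n; have E := ltotal (iter n total y) D'0 Wbr.
    rewrite mulrAC ler_pdivlMr // mulrC -{1}(gtr0_norm c00) -normrM.
    have -> : c0 * lshift D' W' (iter n total y) =
      W' (iter n.+1 total y) - ev D' * W' (iter n total y).
      by rewrite iterS E /c0; ring.
    rewrite (le_trans (ler_normB _ _)) // -mulrA [leRHS]mulrDl lerD //.
      by rewrite mulrCA -exprS.
    by rewrite normrM ler_wpM2l.
  elim=> [|m IH] C' W' K' qC Wb' C'0 Cq' gen' Wy' Wr.
    rewrite mul1r in qC.
    have [m qD] : exists m, - C' <= q ^+ m * D.
      (* When [C'] vanishes so does [q], and a single shift sends [D] to 0. Otherwise enough shifts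
         bring its absolute value below [C']. *)
      have [/Cq' q0|CN0] := eqVneq C' 0.
        by exists 1%N; rewrite q0 expr1 mul0r oppr_le0.
      have [|m mP] := @expr_small _ _ q_ge0 q_lt1 C'; first by rewrite lt_neqAle eq_sym CN0.
      exists m; rewrite lerNl -mulrN (le_trans _ mP) // ler_piMr //; lra.
    exact: (Dstep C' m _ qC D W' K').
  have [CA|CA] := lerP C' A^-1; first by apply: (IH C' W' K') => //; rewrite (le_trans _ CA) // ler_piMl.
  have C'p : 0 < C' by rewrite (lt_trans _ CA) // invr_gt0.
  have C'N0 := lt0r_neq0 C'p.
  pose c0 := C'^-1 - D.
  have c00 : 0 < c0 by rewrite /c0 subr_gt0 (@le_lt_trans _ _ 0) // invr_gt0.
  apply: (IH (q * C') (lshift C' W') ((r + `|ev C'|) * K' / c0)).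
  - by rewrite mulrA -exprSr.
  - exact: lshift_lbound.
  - by rewrite mulr_ge0.
  - by move/eqP; rewrite mulf_eq0 (negbTE C'N0) orbF => /eqP.
  - move=> k; have := gen' k.+1; apply: contra => /eqP E; apply/eqP.
    by rewrite -E exprS; ring.
  - have E := lshift_gap Wb' yb; have := gen' 0%N; rewrite expr0 mulr1 => g.
    have : lshift C' W' y * (1 - A * B * C' * D) != 0.
      rewrite E !mulf_neq0 // subr_eq0 eq_sym.
        by rewrite gt_eqF // mulrC -ltr_pdivrMr // mul1r.
      by rewrite lt_eqF // (@le_lt_trans _ _ 0) // mulr_le0_ge0.
    by rewrite mulf_eq0 negb_or => /andP[].
  move=> n; have E := ltotal (iter n total y) C'N0 Wb'.
  rewrite mulrAC ler_pdivlMr // mulrC -{1}(gtr0_norm c00) -normrM.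
  have -> : c0 * lshift C' W' (iter n total y) =
    ev C' * W' (iter n total y) - W' (iter n.+1 total y).
    by rewrite iterS E /c0; ring.
  rewrite (le_trans (ler_normB _ _)) // -mulrA [leRHS]mulrDl [leLHS]addrC lerD //.
    by rewrite mulrCA -exprS.
  by rewrite normrM ler_wpM2l.
have [|m mP] := @expr_small _ _ q_ge0 q_lt1 (A^-1 / (C + 1)).
  by rewrite divr_gt0 ?invr_gt0 //; lra.
apply: (Cstep m C W K) => //.
rewrite (@le_trans _ _ (q ^+ m * (C + 1))) ?ler_wpM2l //; first by lra.
by rewrite -ler_pdivlMr //; lra.
Qed.

End Perron.

(** * Expansion over the position of the shock *)

Section Fluctuations.
Variable R : realType.
Implicit Types (K rho x z : R) (w u v : seq bool).

(** The intervals of radius [K / (1 - rho) * rho ^+ n] around [y n] are nested; the limit is the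
    supremum of their left endpoints. *)
Lemma geometric_limit (y : nat -> R) K rho : 0 <= K -> 0 <= rho -> rho < 1 ->
  (forall n, `|y n.+1 - y n| <= K * rho ^+ n) ->
  exists kappa, forall n, `|y n - kappa| <= K / (1 - rho) * rho ^+ n.
Proof.
move=> K0 r0 r1 yK; pose e n := K / (1 - rho) * rho ^+ n.
have r1' : 0 < 1 - rho by rewrite subr_gt0.
have e0 n : 0 <= e n by rewrite !mulr_ge0 ?exprn_ge0 // invr_ge0 ltW.
have eS n : e n - e n.+1 = K * rho ^+ n.
  by rewrite /e exprS; field; rewrite lt0r_neq0.
have lo m n : (m <= n)%N -> y m - e m <= y n - e n /\ y n + e n <= y m + e m.
  move=> /subnK <-; elim: (n - m)%N => [//|j [IH1 IH2]].
  have := yK (j + m)%N; rewrite addSn -eS ler_norml => /andP[h1 h2].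
  by split; lra.
have lohi m n : y m - e m <= y n + e n.
  have em := e0 m; have en := e0 n.
  by have [/lo[]|/ltnW/lo[]] := leqP m n; lra.
pose S := [set y n - e n | n in [set: nat]]%classic.
have Shi n : ubound S (y n + e n) by move=> _ [m _ <-]; apply: lohi.
have Ssup : has_sup S.
  by split; [exists (y 0%N - e 0%N), 0%N|exists (y 0%N + e 0%N)].
exists (sup S) => n; rewrite ler_norml -/(e n); apply/andP; split.
  suff : sup S <= y n + e n by lra.
  by apply: ge_sup => //; case: Ssup.
suff : y n - e n <= sup S by lra.
by apply: ub_le_sup; [case: Ssup|exists n].
Qed.

(** With [s] the square root of [rho], the quantity is the square of [n.+1 * s ^+ n], which the
    geometric series bounds by [1 / (1 - s)]. *)
Lemma square_geometric_bounded rho : 0 <= rho -> rho < 1 ->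
  exists2 K, 0 <= K & forall n, n.+1%:R ^+ 2 * rho ^+ n <= K.
Proof.
move=> r0 r1; pose s := Num.sqrt rho.
have s0 : 0 <= s by apply: sqrtr_ge0.
have s1 : s < 1 by rewrite -sqrtr1 ltr_sqrt.
have sE : rho = s ^+ 2 by rewrite sqr_sqrtr.
have d0 : 0 < 1 - s by rewrite subr_gt0.
suff b n : n.+1%:R * s ^+ n <= (1 - s)^-1.
  exists ((1 - s)^-1 ^+ 2); first exact: sqr_ge0.
  move=> n; rewrite sE exprAC -exprMn lerXn2r ?nnegrE ?invr_ge0 ?(ltW d0) //.
  by rewrite mulr_ge0 ?exprn_ge0.
rewrite -[leRHS]mul1r ler_pdivlMr //.
have -> : n.+1%:R * s ^+ n * (1 - s) = n.+1%:R * (s ^+ n * (1 - s)) by ring.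
suff : n.+1%:R * (s ^+ n * (1 - s)) <= 1 - s ^+ n.+1.
  by move/le_trans; apply; rewrite gerBl exprn_ge0.
elim: n => [|n IH]; first by rewrite expr0 expr1 !mul1r.
apply: (@le_trans _ _ (s * (1 - s ^+ n.+1) + s ^+ n.+1 * (1 - s))).
  rewrite -natr1 mulrDl mul1r lerD2r.
  have -> : n.+1%:R * (s ^+ n.+1 * (1 - s)) = s * (n.+1%:R * (s ^+ n * (1 - s))).
    by rewrite exprS; ring.
  by rewrite ler_wpM2l.
rewrite [s ^+ n.+2]exprS; have t1 : s ^+ n.+1 <= 1 by rewrite exprn_ile1 // ltW.
have := mulr_ge0 (ltW d0) (_ : 0 <= 1 - s ^+ n.+1); rewrite subr_ge0 => /(_ t1).
by lra.
Qed.

(** The centred number of particles in the window of the first [N] letters; the increment [dev1] is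
    0 once the window is exhausted. *)
Definition dev rho N w : R :=
  (count id (take N w))%:R - rho * (size (take N w))%:R.

Definition dev1 rho N (b : bool) : R := if (0 < N)%N then b%:R - rho else 0.

Lemma dev_cons rho N b w : dev rho N (b :: w) = dev1 rho N b + dev rho N.-1 w.
Proof.
case: N => [|N]; rewrite /dev /dev1 /= ?take0 /= ?mulr0 ?subrr ?addr0 //.
by rewrite natrD -add1n natrD; ring.
Qed.

Lemma dev_rcons rho N b w : dev rho N (rcons w b) =
  dev rho N w + dev1 rho (N - size w) b.
Proof.
rewrite /dev /dev1 subn_gt0 -cats1 take_cat; have [Nw|wN] := ltnP N (size w).
  by rewrite (ltnNge (size w)) (ltnW Nw) addr0.
rewrite (@take_oversize _ N w) //; move: wN; rewrite leq_eqVlt => /predU1P[<-|wN].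
  by rewrite subnn take0 cats0 ltnn addr0.
have -> : take (N - size w) [:: b] = [:: b].
  by rewrite take_oversize //= subn_gt0.
by rewrite wN size_cat count_cat /= addn0 !natrD; ring.
Qed.

Lemma dev1_le1 rho N b : 0 <= rho -> rho <= 1 -> `|dev1 rho N b| <= 1.
Proof.
move=> r0 r1; rewrite /dev1; case: ifP => _; last by rewrite normr0.
by rewrite ler_norml; case: b => /=; lra.
Qed.

Lemma dev_le_size rho N w : 0 <= rho -> rho <= 1 -> `|dev rho N w| <= (size w)%:R.
Proof.
move=> r0 r1; elim: w N => [|b w IH] N.
  by case: N => [|N]; rewrite /dev /= mulr0 subrr normr0.
rewrite dev_cons (le_trans (ler_normD _ _)) //= -add1n natrD lerD //.
exact: dev1_le1.
Qed.

(** The defect letter [b] at position [k] is counted with the right block, so the density changes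
    after exactly [k] letters. *)
Lemma height_centered (k : nat) (N : nat) b (rl rh : R) u v : size u = k ->
  (N <= k + (size v).+1)%N ->
  (count id (take N (u ++ b :: v)))%:R - (rl * (minn k N)%:R + rh * (N - k)%:R) =
  dev rl N u + dev rh (N - k) (b :: v).
Proof.
move=> <- Nk; have -> : count id (take N (u ++ b :: v)) =
    (count id (take N u) + count id (take (N - size u) (b :: v)))%N.
  rewrite take_cat; have [Nu|uN] := ltnP.
    have /eqP-> : (N - size u == 0)%N by rewrite subn_eq0 ltnW.
    by rewrite take0 addn0.
  by rewrite count_cat (@take_oversize _ N u).
rewrite /dev !size_take_min natrD minnC.
have -> : minn (N - size u) (size (b :: v)) = (N - size u)%N.
  by apply/minn_idPl; rewrite leq_subLR.
by ring.
Qed.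

(* The weights [p true = lam * rho] and [p false = lam * (1 - rho)] make the
   letters of a word independent of mean [rho], up to the factor [lam]. *)
Lemma dev1_variance (lam rho : R) N (p : bool -> R) z : 0 <= lam ->
  0 <= rho -> rho <= 1 -> p true = lam * rho -> p false = lam * (1 - rho) ->
  p true * (z + dev1 rho N true) ^+ 2 + p false * (z + dev1 rho N false) ^+ 2
  <= lam * (z ^+ 2 + 1).
Proof.
move=> l0 r0 r1 -> ->; rewrite /dev1; case: ifP => _ /=; last first.
  by rewrite !addr0 -mulrDl -mulrDr [rho + _]addrC subrK mulr1 ler_wpM2l // lerDl.
have -> : lam * rho * (z + (1 - rho)) ^+ 2 + lam * (1 - rho) * (z + (0 - rho)) ^+ 2
  = lam * (z ^+ 2 + rho * (1 - rho)) by ring.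
by rewrite ler_wpM2l // lerD2l mulr_ile1 //; lra.
Qed.

End Fluctuations.

(** * Construction of the boundary vectors *)

Section Existence.
Variables (R : realType) (q A B C D : R).
Hypothesis generic : forall k, 1 - A * B * C * D * q ^+ k != 0.

(** Two consecutive moments, solved from [lbound_iter_rbound] and normalised so that the moment of
    order 0 is 1. The initial second component 0 is met only with the factor [1 - q ^+ 0]. *)
Fixpoint bvec2 (k : nat) : R * R :=
  if k is k'.+1 then
    let: (x, z) := bvec2 k' in
    (((A + B - A * B * (C + D) * q ^+ k') * x - A * B * (1 - q ^+ k') * z)
       / (1 - A * B * C * D * q ^+ k'), x)
  else (1, 0).

Definition bvec (k : nat) : R^o := (bvec2 k).1.

Lemma bvec_rbound : rbound q C D A B bvec.
Proof.
apply/funext => k; rewrite !seqE /bvec /=.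
have := generic k.
case E : (bvec2 k) => [x z] g /=.
have -> : (1 - q ^+ k) * (bvec2 k.-1).1 = (1 - q ^+ k) * z.
  by case: (k) E => [|j] /=; [rewrite !subrr !mul0r|case: (bvec2 j) => ? ? [_ ->]].
by field.
Qed.

Lemma ev0_lbound : lbound q C D C D (fun f : nat -> R^o => f 0%N).
Proof. by split=> [a u v|y]; rewrite ?seqE /=; [|ring]. Qed.

End Existence.

(** Opposite to [geometric_recursion]: the source is strictly slower than [lam], so its total effect
    is a constant and the rate [lam] is kept exactly. *)
Lemma sharp_recursion (R : realType) (T : nat -> R) lam r K :
  0 <= r -> r < lam -> 0 <= K ->
  (forall n, T n.+1 <= lam * T n + K * r ^+ n) ->
  forall n, T n <= (T 0%N + K / (lam - r)) * lam ^+ n.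
Proof.
move=> r0 rl K0 TS n.
have lr : 0 < lam - r by rewrite subr_gt0.
suff : T n <= (T 0%N + K / (lam - r)) * lam ^+ n - K / (lam - r) * r ^+ n.
  by move/le_trans; apply; rewrite gerBl !mulr_ge0 ?exprn_ge0 // invr_ge0 ltW.
elim: n => [|n IH]; first by rewrite !mulr1 addrK.
apply: le_trans (TS n) _.
apply: (@le_trans _ _ (lam * ((T 0%N + K / (lam - r)) * lam ^+ n -
   K / (lam - r) * r ^+ n) + K * r ^+ n)).
  by rewrite lerD2r ler_wpM2l // ltW // (le_lt_trans r0).
rewrite le_eqVlt; apply/orP; left; apply/eqP.
by rewrite !exprS; field; rewrite lt0r_neq0.
Qed.

(** * Bernoulli prefixes and the segment to the right of the defect *)

Section Asymptotics.
Variables (R : realType) (q c d A B D : R).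
Variables (W : (nat -> R^o) -> R) (V : nat -> R^o).

Local Notation act := (act q c d).
Local Notation total := (total q c d).
Local Notation lbound := (lbound q c d).
Local Notation rbound := (rbound q c d).
Local Notation rshift := (rshift q c d).
Local Notation lam := (ev A).
Local Notation rl := ((1 + A)^-1).
Local Notation rh := (A / (1 + A)).
Local Notation W1 := (lshift A W).
Local Notation V1 := (rshift A V).

Definition lprod (w : seq bool) : R := \prod_(b <- w) lwt A b.

Lemma lprod_cons b w : lprod (b :: w) = lwt A b * lprod w.
Proof. by rewrite /lprod big_cons. Qed.

Section Positivity.
Hypothesis A_gt0 : 0 < A.

Lemma lwt_ge0 b : 0 <= lwt A b.
Proof. by case: b; rewrite /lwt addr_ge0 ?invr_ge0 // ltW. Qed.

Lemma rwt_ge0 b : 0 <= rwt A b.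
Proof. by case: b; rewrite /rwt addr_ge0 ?invr_ge0 // ltW. Qed.

Lemma ev_gt0 : 0 < lam.
Proof. by apply: lt_le_trans (ev_ge4 A_gt0). Qed.

Lemma A1N0 : 1 + A != 0.
Proof. by rewrite lt0r_neq0 // addr_gt0. Qed.

Lemma lwtE : (lwt A true = lam * rl) * (lwt A false = lam * (1 - rl)).
Proof.
by split; rewrite /lwt /ev; field; rewrite A1N0 lt0r_neq0.
Qed.

Lemma rwtE : (rwt A true = lam * rh) * (rwt A false = lam * (1 - rh)).
Proof.
by split; rewrite /rwt /ev; field; rewrite A1N0 lt0r_neq0.
Qed.

Lemma rl_bounds : 0 <= rl /\ rl <= 1.
Proof.
have A1 : 0 < 1 + A by rewrite addr_gt0.
by rewrite invr_ge0 ltW // invf_le1 // lerDl ltW.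
Qed.

Lemma rh_bounds : 0 <= rh /\ rh <= 1.
Proof.
have A1 : 0 < 1 + A by rewrite addr_gt0.
by rewrite divr_ge0 ?(ltW A_gt0) ?(ltW A1) // ler_pdivrMr // mul1r lerDr.
Qed.

Lemma lprod_ge0 w : 0 <= lprod w.
Proof. by rewrite /lprod; elim/big_ind: _ => // [x y|b _]; [exact: mulr_ge0|exact: lwt_ge0]. Qed.

Lemma wsum_lprod n : wsum n lprod = lam ^+ n.
Proof.
elim: n => [|n IH]; first by rewrite /= /lprod big_nil.
rewrite wsum_split; under eq_wsum do rewrite !lprod_cons -mulrDl.
by rewrite wsumZ IH exprS /lwt /ev; congr (_ * _); ring.
Qed.

(** [z] is the deviation accumulated before the word; it makes the induction on the first letter
    possible, each letter adding variance at most 1. *)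
Lemma lprod_variance n N z :
  wsum n (fun w => lprod w * (z + dev rl N w) ^+ 2) <= lam ^+ n * (z ^+ 2 + n%:R).
Proof.
have [rl0 rl1] := rl_bounds; have l0 := ltW ev_gt0.
elim: n N z => [|n IH] N z.
  by rewrite /= /lprod big_nil /dev; case: N => [|N] /=; rewrite mulr0 subrr !addr0.
rewrite wsum_split.
rewrite (@eq_wsum _ n _ (fun w =>
    lwt A true * (lprod w * (z + dev1 rl N true + dev rl N.-1 w) ^+ 2) +
    lwt A false * (lprod w * (z + dev1 rl N false + dev rl N.-1 w) ^+ 2))); last first.
  by move=> w; rewrite !lprod_cons !dev_cons; ring.
rewrite wsumD !wsumZ.
apply: (@le_trans _ _ (lwt A true * (lam ^+ n * ((z + dev1 rl N true) ^+ 2 + n%:R))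
   + lwt A false * (lam ^+ n * ((z + dev1 rl N false) ^+ 2 + n%:R)))).
  by apply: lerD; (apply: ler_wpM2l; [exact: lwt_ge0|exact: IH]).
have := dev1_variance N z l0 rl0 rl1 lwtE.1 lwtE.2.
have -> : lwt A true * (lam ^+ n * ((z + dev1 rl N true) ^+ 2 + n%:R)) +
  lwt A false * (lam ^+ n * ((z + dev1 rl N false) ^+ 2 + n%:R)) =
  lam ^+ n * (lwt A true * (z + dev1 rl N true) ^+ 2 +
    lwt A false * (z + dev1 rl N false) ^+ 2 + lam * n%:R).
  by rewrite !lwtE; ring.
move=> h; rewrite [lam ^+ n.+1]exprSr -mulrA ler_wpM2l ?exprn_ge0 // -natr1.
by rewrite [n%:R + 1]addrC addrA mulrDr lerD2r.
Qed.

(** A letter peeled from the left is either a Bernoulli factor or the defect. In the second case the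
    peeling stops, and [W1] faces the rest of the word. *)
Lemma lpeel_all w y : lbound A D W -> W (act w y) =
  lprod w * W y + \sum_(k < size w) lprod (take k w) *
    (ldef A D (nth false w k) * W1 (act (drop k.+1 w) y)).
Proof.
move=> Wb; elim: w => [|b w IH].
  by rewrite big_ord0 /lprod big_nil mul1r addr0.
rewrite /= (lpeel _ _ (lt0r_neq0 A_gt0) Wb) IH big_ord_recl /= ?take0 drop0.
rewrite [lprod [::]]/lprod big_nil mul1r lprod_cons mulrDr mulrA -addrA; congr (_ + _).
rewrite addrC; congr (_ + _); rewrite mulr_sumr; apply: eq_bigr => i _.
by rewrite lprod_cons !mulrA.
Qed.

End Positivity.

(** The first two properties control errors in absolute value; the third gives the signed asymptotic
    weight of what follows a defect. *)
Definition suffix_bounds K := [/\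
  forall n, wsum n (fun w => `|W1 (act w V)|) <= K * lam ^+ n,
  forall n N z, wsum n (fun w => `|W1 (act w V)| * (z + dev rh N w) ^+ 2)
     <= K * lam ^+ n * (z ^+ 2 + n%:R + 1) &
  exists2 kappa, kappa != 0 & exists2 rho, 0 <= rho < 1 &
    forall n, `|W1 (iter n total V) / lam ^+ n - kappa| <= K * rho ^+ n].

Hypotheses (q_ge0 : 0 <= q) (q_lt1 : q < 1) (A_gt1 : 1 < A)
  (B_gtN1 : -1 < B) (B_le0 : B <= 0) (D_gtN1 : -1 < D) (D_le0 : D <= 0)
  (generic : forall k, 1 - A * B * A * D * q ^+ k != 0)
  (Wb : lbound A D W) (Vb : rbound A B V) (WV : W V != 0).

(** Peeling from the right multiplies by exactly [lam], up to the weights of the pair [W1], [V1],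
    both of whose large parameters are [q A]. These grow strictly slower, so all three properties
    follow from recursions with a subdominant source. *)
Lemma suffix_boundsP : exists2 K, 0 <= K & suffix_bounds K.
Proof.
have A0 : 0 < A by apply: lt_trans A_gt1.
have A0N := lt0r_neq0 A0.
have W1b := lshift_lbound Wb; have V1b := rshift_rbound Vb.
have [W1L _] := W1b.
(* [ev] is increasing only from 1 on, hence the maximum, which is still below [A]. *)
pose a := Num.max 1 (q * A).
have a1 : 1 <= a by rewrite le_max lexx.
have aA : a < A.
  by rewrite gt_max A_gt1 gtr_pMl.
have qAa : q * A <= a by rewrite le_max lexx orbT.
have qA0 : 0 <= q * A by rewrite mulr_ge0 // ltW.
have evaA : ev a < lam by apply: ev_lt.
(* [r] bounds the doubly shifted weights; the margin up to [r'] absorbs a factor [n.+1 ^ 2], the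
   worst square of a deviation. *)
pose r := (ev a + lam) / 2; have [ar rlam] : ev a < r /\ r < lam by rewrite !midf_lt.
pose r' := (r + lam) / 2; have [rr' r'lam] : r < r' /\ r' < lam by rewrite !midf_lt.
have r0 : 0 < r by apply: lt_trans ar; apply: (lt_le_trans _ (ev_ge4 (lt_le_trans ltr01 a1))).
have r'0 : 0 < r' by apply: lt_trans rr'.
have lam0 : 0 < lam by apply: lt_trans rlam.
have [rh0 rh1] := rh_bounds A0.
have [K2 K20 T2] := geometric_tv_bound q_ge0 q_lt1 a1 ar qA0 qAa qA0 qAa
  B_gtN1 B_le0 D_gtN1 D_le0 W1b V1b.
pose s := `|rdef A B true| + `|rdef A B false|.
have s0 : 0 <= s by rewrite addr_ge0.
have rc w b : `|W1 (act (rcons w b) V)| <=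
    rwt A b * `|W1 (act w V)| + `|rdef A B b| * `|W1 (act w V1)|.
  rewrite act_rcons (rpeel _ A0N Vb) actP W1L (linZ _ _ (lin_act q c d w W1L)).
  rewrite (le_trans (ler_normD _ _)) // !normrM.
  by rewrite (ger0_norm (rwt_ge0 A0 b)).
pose T n := wsum n (fun w => `|W1 (act w V)|).
have T1 n : T n <= (T 0%N + s * K2 / (lam - r)) * lam ^+ n.
  apply: sharp_recursion => //; [exact: ltW|exact: mulr_ge0|].
  move=> {}n; rewrite /T wsum_rcons -wsumZ.
  apply: (@le_trans _ _ (wsum n (fun w => lam * `|W1 (act w V)|) +
     s * wsum n (fun w => `|W1 (act w V1)|))); last first.
    by rewrite lerD2l -mulrA ler_wpM2l.
  rewrite -wsumZ -wsumD; apply: ler_wsum => w _.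
  apply: le_trans (lerD (rc w true) (rc w false)) _.
  by rewrite /rwt /s /ev; lra.
set K1 := T 0%N + s * K2 / (lam - r) in T1.
have T_ge0 n : 0 <= T n by apply: wsum_ge0.
have K10 : 0 <= K1.
  by rewrite addr_ge0 // divr_ge0 ?mulr_ge0 // subr_ge0 ltW.
have [K3 K30 K3P] : exists2 K3, 0 <= K3 & forall n, n.+1%:R ^+ 2 * (r / r') ^+ n <= K3.
  apply: square_geometric_bounded; first by rewrite divr_ge0 // ltW.
  by rewrite ltr_pdivrMr // mul1r.
have K3r n : n.+1%:R ^+ 2 * r ^+ n <= K3 * r' ^+ n.
  have := K3P n; rewrite expr_div_n mulrA ler_pdivrMr //.
  exact: exprn_gt0.
pose Q N z n := wsum n (fun w => `|W1 (act w V)| * (z + dev rh N w) ^+ 2).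
pose K4 := 2 * s * K2 * (K3 + 1).
have K40 : 0 <= K4 by rewrite !mulr_ge0 // addr_ge0.
have Q1 N z n : Q N z n <= (K1 * n%:R + (T 0%N * z ^+ 2 +
    K4 * (z ^+ 2 + 1) / (lam - r'))) * lam ^+ n.
  (* The unit variance of each letter adds [lam * T n], a source of the critical rate. Subtracting
     [K1 * n * lam ^+ n] cancels it and leaves a source of rate [r' < lam]. *)
  have := @sharp_recursion _ (fun n => Q N z n - K1 * n%:R * lam ^+ n)
     lam r' (K4 * (z ^+ 2 + 1)) (ltW r'0) r'lam.
  have z0 := sqr_ge0 z.
  rewrite mulr_ge0 ?addr_ge0 // mulr0 mul0r subr0 => /(_ isT) H.
  suff /H/(_ n) : forall n, Q N z n.+1 - K1 * n.+1%:R * lam ^+ n.+1 <=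
      lam * (Q N z n - K1 * n%:R * lam ^+ n) + K4 * (z ^+ 2 + 1) * r' ^+ n.
    have -> : Q N z 0%N = T 0%N * z ^+ 2.
      by rewrite /Q /T /= /dev; case: (N) => [|?] /=; rewrite mulr0 subrr addr0.
    by rewrite mulrDl; lra.
  move=> {H}{}n.
  have QS : Q N z n.+1 <= lam * (Q N z n + T n) +
      s * (2 * (z ^+ 2 + n.+1%:R ^+ 2) * wsum n (fun w => `|W1 (act w V1)|)).
    rewrite /Q /T wsum_rcons -wsumD -!wsumZ -wsumD; apply: ler_wsum => w sw.
    set y := z + dev rh N w; pose N' := (N - size w)%N.
    have dr b : z + dev rh N (rcons w b) = y + dev1 rh N' b.
      by rewrite dev_rcons addrA.
    rewrite !dr.
    have yb b : (y + dev1 rh N' b) ^+ 2 <= 2 * (z ^+ 2 + n.+1%:R ^+ 2).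
      rewrite /y -addrA; set t := dev _ _ _ + _.
      have t2 : t ^+ 2 <= n.+1%:R ^+ 2.
        rewrite -real_normK ?num_real // lerXn2r ?nnegrE // (le_trans (ler_normD _ _)) //.
        by rewrite -natr1 lerD // ?dev1_le1 // -sw dev_le_size.
      rewrite -subr_ge0.
      have -> : 2 * (z ^+ 2 + n.+1%:R ^+ 2) - (z + t) ^+ 2 =
        (z - t) ^+ 2 + 2 * (n.+1%:R ^+ 2 - t ^+ 2) by ring.
      by rewrite addr_ge0 ?sqr_ge0 // mulr_ge0 // subr_ge0.
    have x1 := normr_ge0 (W1 (act w V)); have x2 := normr_ge0 (W1 (act w V1)).
    have bb b : `|W1 (act (rcons w b) V)| * (y + dev1 rh N' b) ^+ 2 <=
       `|W1 (act w V)| * (rwt A b * (y + dev1 rh N' b) ^+ 2) +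
       `|rdef A B b| * (2 * (z ^+ 2 + n.+1%:R ^+ 2) * `|W1 (act w V1)|).
      apply: le_trans (ler_wpM2r (sqr_ge0 _) (rc w b)) _.
      have -> : (rwt A b * `|W1 (act w V)| + `|rdef A B b| * `|W1 (act w V1)|) *
          (y + dev1 rh N' b) ^+ 2 =
        `|W1 (act w V)| * (rwt A b * (y + dev1 rh N' b) ^+ 2) +
        `|rdef A B b| * ((y + dev1 rh N' b) ^+ 2 * `|W1 (act w V1)|) by ring.
      by apply: lerD => //; apply: ler_wpM2l => //; apply: ler_wpM2r.
    apply: le_trans (lerD (bb true) (bb false)) _.
    have dv := dev1_variance N' y (ltW lam0) rh0 rh1 (rwtE A0).1 (rwtE A0).2.
    rewrite addrACA -mulrDr -mulrDl.
    have -> : lam * (`|W1 (act w V)| * y ^+ 2 + `|W1 (act w V)|) =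
       `|W1 (act w V)| * (lam * (y ^+ 2 + 1)) by ring.
    apply: lerD; first exact: ler_wpM2l.
    by rewrite /s; lra.
  apply: le_trans (lerD QS (lexx _)) _.
  have h1 := ler_wpM2l (ltW lam0) (T1 n).
  have h2 : s * (2 * (z ^+ 2 + n.+1%:R ^+ 2) * wsum n (fun w => `|W1 (act w V1)|)) <=
     K4 * (z ^+ 2 + 1) * r' ^+ n.
    apply: (@le_trans _ _ (s * (2 * (z ^+ 2 + n.+1%:R ^+ 2) * (K2 * r ^+ n)))).
      by rewrite ler_wpM2l // ler_wpM2l // mulr_ge0 // addr_ge0 // sqr_ge0.
    have -> : s * (2 * (z ^+ 2 + n.+1%:R ^+ 2) * (K2 * r ^+ n)) =
      2 * s * K2 * (z ^+ 2 * r ^+ n + n.+1%:R ^+ 2 * r ^+ n) by ring.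
    rewrite /K4 -[leRHS]mulrA -[leRHS]mulrA ler_wpM2l ?mulr_ge0 //.
    have p : r ^+ n <= r' ^+ n by rewrite lerXn2r ?nnegrE ?ltW.
    have := ler_wpM2l z0 p; have := K3r n; have := exprn_ge0 n (ltW r'0).
    set u := r' ^+ n; set v := z ^+ 2 * r ^+ n => u0 k3 vu.
    have := mulr_ge0 (mulr_ge0 K30 z0) u0.
    by move: k3 vu; set w := n.+1%:R ^+ 2 * r ^+ n; lra.
  have -> : K1 * n.+1%:R * lam ^+ n.+1 = lam * (K1 * n%:R * lam ^+ n) + lam * (K1 * lam ^+ n).
    by rewrite -natr1 exprS; ring.
  move: h1 h2; set x1 := s * _; set x2 := K4 * _ * _.
  by rewrite mulrDr mulrBr; lra.
have Q2 N z n : Q N z n <= (K1 + T 0%N + K4 / (lam - r')) * lam ^+ n * (z ^+ 2 + n%:R + 1).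
  apply: le_trans (Q1 N z n) _.
  rewrite [leRHS]mulrAC ler_wpM2r ?exprn_ge0 ?(ltW lam0) //.
  have z0 := sqr_ge0 z; have n0 : 0 <= n%:R :> R by [].
  have k4 : 0 <= K4 / (lam - r') by rewrite divr_ge0 // subr_ge0 ltW.
  have -> : K4 * (z ^+ 2 + 1) / (lam - r') = K4 / (lam - r') * (z ^+ 2 + 1) by ring.
  have t0 := T_ge0 0%N.
  rewrite -subr_ge0.
  have -> : (K1 + T 0 + K4 / (lam - r')) * (z ^+ 2 + n%:R + 1) -
    (K1 * n%:R + (T 0 * z ^+ 2 + K4 / (lam - r') * (z ^+ 2 + 1))) =
    K1 * (z ^+ 2 + 1) + T 0%N * (n%:R + 1) + K4 / (lam - r') * n%:R by ring.
  by rewrite !addr_ge0 // mulr_ge0 // addr_ge0.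
pose y n := W1 (iter n total V) / lam ^+ n.
pose rho := r / lam.
have rho0 : 0 <= rho by rewrite divr_ge0 // ltW.
have rho1 : rho < 1 by rewrite ltr_pdivrMr // mul1r.
pose K5 := `|B - A^-1| * K2 / lam.
(* The increment of the normalised weight is a multiple of the weight of [V1], whose rate relative
   to [lam] is [rho < 1]. *)
have yS n : `|y n.+1 - y n| <= K5 * rho ^+ n.
  rewrite /y iterSr (rtotal A0N Vb).
  rewrite (lin_iter_total q c d n W1L) (linZ _ _ (lin_iter_total q c d n W1L)).
  have -> : (lam * W1 (iter n total V) + (B - A^-1) * W1 (iter n total V1)) / lam ^+ n.+1
      - W1 (iter n total V) / lam ^+ n =
     (B - A^-1) * W1 (iter n total V1) / lam / lam ^+ n.
    by rewrite exprS; field; rewrite ?expf_neq0 lt0r_neq0.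
  have ln := exprn_gt0 n lam0.
  rewrite /K5 /rho expr_div_n mulrA normrM (@gtr0_norm _ (lam ^- n)) ?invr_gt0 //.
  rewrite ler_wpM2r ?invr_ge0 ?(ltW ln) // normrM (@gtr0_norm _ (lam^-1)) ?invr_gt0 //.
  rewrite mulrAC ler_wpM2r ?invr_ge0 ?(ltW lam0) // normrM -mulrA ler_wpM2l //.
  by apply: le_trans (T2 n); rewrite -wsum_act // ler_norm_wsum.
have K50 : 0 <= K5 by rewrite !mulr_ge0 // invr_ge0 ltW.
have [kappa kP] := geometric_limit K50 rho0 rho1 yS.
pose K6 := K5 / (1 - rho).
have K60 : 0 <= K6 by rewrite divr_ge0 // subr_ge0 ltW.
pose K := K1 + T 0%N + K4 / (lam - r') + K6.
have k4 : 0 <= K4 / (lam - r') by rewrite divr_ge0 // subr_ge0 ltW.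
have t0 := T_ge0 0%N.
exists K; first by rewrite /K; lra.
split.
- move=> n; apply: le_trans (T1 n) _.
  by rewrite ler_wpM2r ?exprn_ge0 ?(ltW lam0) // /K; lra.
- move=> n N z; apply: le_trans (Q2 N z n) _.
  rewrite -![_ * lam ^+ n * _]mulrA ler_wpM2r //; last by rewrite /K; lra.
  by rewrite mulr_ge0 ?exprn_ge0 ?(ltW lam0) // !addr_ge0 // sqr_ge0.
- exists kappa; last first.
    exists rho; first by rewrite rho0 rho1.
    move=> n; apply: le_trans (kP n) _.
    by rewrite ler_wpM2r ?exprn_ge0 // /K -/K6; lra.
  (* A zero limit would leave a bound of rate [r < ev A] for [W1], whose left parameter is [q A],
     and [no_subdominant_growth] excludes it. *)
  apply/negP => /eqP k0.
  apply: (@no_subdominant_growth _ q c d q_ge0 q_lt1 r A B (q * A) D W1 V K6) => //.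
  + by move/eqP; rewrite mulf_eq0 (negbTE A0N) orbF => /eqP.
  + move=> k; have := generic k.+1; apply: contra => /eqP E; apply/eqP.
    by rewrite -E exprS; ring.
  + have := lshift_gap Wb Vb => E.
    have : W1 V * (1 - A * B * A * D) != 0.
      rewrite E !mulf_neq0 // subr_eq0 eq_sym.
        by rewrite gt_eqF // mulr_egt1.
      by rewrite lt_eqF // (@le_lt_trans _ _ 0) // mulr_le0_ge0 // ltW.
    by rewrite mulf_eq0 negb_or => /andP[].
  move=> n; have := kP n; rewrite k0 subr0 /y /rho expr_div_n mulrA.
  have ln := exprn_gt0 n lam0.
  rewrite normrM (@gtr0_norm _ (lam ^- n)) ?invr_gt0 // ler_pM2r ?invr_gt0 //.
Qed.

End Asymptotics.

Lemma wsum_sum (R : realFieldType) n m (F : 'I_m -> seq bool -> R) :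
  wsum n (fun w => \sum_(k < m) F k w) = \sum_(k < m) wsum n (F k).
Proof.
elim: n F => [//|n IH] F /=; rewrite big_split /=.
by congr (_ + _); apply: IH.
Qed.

(** * Averages of test functions under the weights *)

Section Shock.
Variables (R : realType) (q c d A B D : R).
Variables (W : (nat -> R^o) -> R) (V : nat -> R^o) (K : R).

Local Notation act := (act q c d).
Local Notation total := (total q c d).
Local Notation lam := (ev A).
Local Notation rl := ((1 + A)^-1).
Local Notation rh := (A / (1 + A)).
Local Notation W1 := (lshift A W).
Local Notation lprod := (lprod A).
Local Notation ldef := (ldef A D).

(** The contribution of a defect at position [k]. [H] receives the defect letter and the letters
    after it, so that the same definition serves the signed weight, its absolute value and the
    normalisation [Phi = 1]. *)
Definition term (H : bool -> seq bool -> R) (Phi : seq bool -> R) n k :=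
  wsum n (fun w => lprod (take k w) * H (nth false w k) (drop k.+1 w) * Phi w).

Lemma termE H Phi k m : term H Phi (k + m.+1) k =
  wsum k (fun u => lprod u *
    (wsum m (fun v => H true v * Phi (u ++ true :: v)) +
     wsum m (fun v => H false v * Phi (u ++ false :: v)))).
Proof.
rewrite /term wsum_cat; apply: eq_wsum_size => u su.
rewrite wsum_split -wsumD -wsumZ; apply: eq_wsum => v.
rewrite !take_cat -su ltnn subnn take0 cats0 !nth_cat ltnn subnn /=.
by rewrite !drop_cat ltnNge leqnSn /= subSn // subnn /= drop0; ring.
Qed.

Let H b v := ldef b * W1 (act v V).
Let Habs b v := `|ldef b| * `|W1 (act v V)|.
Let s := `|ldef true| + `|ldef false|.

Hypotheses (A_gt1 : 1 < A) (D_le0 : D <= 0) (Wb : lbound q c d A D W) (K_ge0 : 0 <= K)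
  (KP : suffix_bounds q c d A W V K).

Let A_gt0 : 0 < A. Proof. exact: lt_trans A_gt1. Qed.
Let lam_ge1 : 1 <= lam.
Proof. by apply: le_trans (ev_ge4 A_gt0); rewrite ler1n. Qed.
Let lam_gt0 : 0 < lam. Proof. exact: lt_le_trans lam_ge1. Qed.
Let s_ge0 : 0 <= s. Proof. exact: addr_ge0. Qed.

(** For a constant test function the prefix and the suffix sum separately, and the two defect
    letters contribute [- A^-1 + D]. *)
Lemma term_one k m : term H (fun=> 1) (k + m.+1) k =
  lam ^+ k * ((D - A^-1) * W1 (iter m total V)).
Proof.
have W1L := (lshift_lbound Wb).1.
rewrite termE -wsum_lprod [RHS]mulrC -wsumZ; apply: eq_wsum => u.
rewrite mulrC; congr (_ * _); rewrite -wsum_act // -wsumZ -wsumD.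
by apply: eq_wsum => v; rewrite /H /ldef; ring.
Qed.

Lemma term_abs k m : term Habs (fun=> 1) (k + m.+1) k <= s * K * lam ^+ (k + m.+1).
Proof.
have [h _ _] := KP; have l0 := lam_gt0.
rewrite termE.
apply: (@le_trans _ _ (wsum k (fun u => s * K * lam ^+ m * lprod u))).
  apply: ler_wsum => u _; rewrite mulrC; apply: ler_wpM2r; first exact: lprod_ge0.
  rewrite -wsumD -mulrA.
  apply: (@le_trans _ _ (s * wsum m (fun w => `|W1 (act w V)|))).
    by rewrite -wsumZ; apply: ler_wsum => v _; rewrite /Habs /s; lra.
  by apply: ler_wpM2l.
rewrite wsumZ wsum_lprod.
have -> : s * K * lam ^+ m * lam ^+ k = s * K * lam ^+ (k + m).
  by rewrite exprD; ring.
apply: ler_wpM2l; first exact: mulr_ge0.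
by apply: ler_weXn2l => //; rewrite addnS.
Qed.

(** The defect letter deviates by at most 1, so the square is at most [2 y ^ 2 + 2] before the
    suffix adds its [m + 1]. With variance [k] for the prefix, [2 k + m + 3 <= 3 (k + m + 1)]. *)
Lemma term_quadratic k m N :
  term Habs (fun w => (dev rl N (take k w) + dev rh (N - k) (drop k w)) ^+ 2)
    (k + m.+1) k <= 3 * s * K * lam ^+ (k + m.+1) * (k + m.+1)%:R.
Proof.
have [_ h _] := KP; have l0 := lam_gt0; have s0 := s_ge0; have K0 := K_ge0.
have [rh0 rh1] := rh_bounds A_gt0.
rewrite termE.
apply: (@le_trans _ _ (wsum k (fun u => s * K * lam ^+ m *
    (2 * (lprod u * (0 + dev rl N u) ^+ 2) + (m%:R + 3) * lprod u)))).
  apply: ler_wsum => u su; set y := dev rl N u.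
  have hb b : wsum m (fun v => Habs b v * (dev rl N (take k (u ++ b :: v)) +
      dev rh (N - k) (drop k (u ++ b :: v))) ^+ 2) <=
      `|ldef b| * (K * lam ^+ m * (2 * y ^+ 2 + m%:R + 3)).
    apply: (@le_trans _ _ (`|ldef b| * wsum m (fun v => `|W1 (act v V)| *
      (y + dev1 rh (N - k) b + dev rh (N - k).-1 v) ^+ 2))).
      rewrite -wsumZ; apply: ler_wsum => v _; rewrite /Habs -mulrA.
      rewrite take_cat drop_cat -su ltnn subnn take0 cats0 drop0 -/y.
      by rewrite dev_cons addrA.
    apply: ler_wpM2l => //; apply: le_trans (h m _ _) _.
    apply: ler_wpM2l; first by rewrite mulr_ge0 // exprn_ge0 // ltW.
    set t := dev1 _ _ _.
    have t2 : t ^+ 2 <= 1.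
      by rewrite -real_normK ?num_real // expr_le1 // dev1_le1.
    rewrite -subr_ge0.
    have -> : 2 * y ^+ 2 + m%:R + 3 - ((y + t) ^+ 2 + m%:R + 1) =
      (y - t) ^+ 2 + 2 * (1 - t ^+ 2) by ring.
    by rewrite addr_ge0 ?sqr_ge0 // mulr_ge0 // subr_ge0.
  apply: (@le_trans _ _ (lprod u * (s * (K * lam ^+ m * (2 * y ^+ 2 + m%:R + 3))))).
    apply: ler_wpM2l; first exact: lprod_ge0.
    by rewrite /s mulrDl; apply: lerD.
  by rewrite add0r -/y; lra.
rewrite wsumZ wsumD !wsumZ wsum_lprod.
have hv := lprod_variance A_gt0 k N 0; rewrite expr0n add0r in hv.
rewrite exprD [lam ^+ m.+1]exprS.
have lk := exprn_ge0 k (ltW l0); have lm := exprn_ge0 m (ltW l0).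
apply: (@le_trans _ _ (s * K * lam ^+ m * (2 * (lam ^+ k * k%:R) + (m%:R + 3) * lam ^+ k))).
  by rewrite ler_wpM2l ?mulr_ge0 // lerD2r ler_wpM2l.
have -> : s * K * lam ^+ m * (2 * (lam ^+ k * k%:R) + (m%:R + 3) * lam ^+ k) =
  s * K * (lam ^+ k * lam ^+ m) * (2 * k%:R + m%:R + 3) by ring.
have -> : 3 * s * K * (lam ^+ k * (lam * lam ^+ m)) * (k + m.+1)%:R =
  s * K * (lam ^+ k * lam ^+ m) * (lam * (3 * (k + m.+1)%:R)) by ring.
rewrite ler_wpM2l ?mulr_ge0 //.
have k0 : 0 <= k%:R :> R by []. have m0 : 0 <= m%:R :> R by [].
apply: (@le_trans _ _ (3 * (k + m.+1)%:R)).
  by rewrite natrD -natr1; lra.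
by rewrite ler_peMl // mulr_ge0.
Qed.

(** [g] stands for the test function at the ideal profile with a shock at [k]. A quadratic modulus
    of continuity reduces the error to second moments. *)
Lemma term_error n k Phi (g eps kap : R) J (N : 'I_J -> nat) :
  (k < n)%N -> 0 <= eps -> 0 <= kap -> (forall j, (N j <= n)%N) ->
  (forall w, size w = n -> `|Phi w - g| <= eps + kap * \sum_j
    ((count id (take (N j) w))%:R - (rl * (minn k (N j))%:R + rh * (N j - k)%:R)) ^+ 2) ->
  `|term H Phi n k - g * term H (fun=> 1) n k| <=
    3 * s * K * lam ^+ n * (eps + kap * J%:R * n%:R).
Proof.
move=> kn e0 kap0 Nn PhiP.
have s0 := s_ge0; have K0 := K_ge0.
have nE : n = (k + (n - k.+1).+1)%N by rewrite -subSn // subSS subnKC // ltnW.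
pose Q j w := (dev rl (N j) (take k w) + dev rh (N j - k) (drop k w)) ^+ 2.
apply: (@le_trans _ _ (eps * term Habs (fun=> 1) n k +
    \sum_j kap * term Habs (Q j) n k)).
  rewrite /term -wsumZ -mulN1r -wsumZ -wsumD.
  apply: le_trans (ler_norm_wsum _ _) _.
  rewrite -wsumZ; under eq_bigr do rewrite -wsumZ.
  rewrite -wsum_sum -wsumD; apply: ler_wsum => w sw.
  set h := H _ _; set l := lprod _.
  have l0 : 0 <= l by apply: lprod_ge0.
  have -> : l * h * Phi w + -1 * (g * (l * h * 1)) = l * h * (Phi w - g) by ring.
  rewrite normrM normrM (ger0_norm l0) [`|h|]normrM -/(Habs _ _).
  set ha := Habs _ _.
  have ha0 : 0 <= ha by rewrite mulr_ge0.
  have -> : eps * (l * ha * 1) + \sum_(j < J) kap * (l * ha * Q j w) =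
      l * ha * (eps + kap * \sum_(j < J) Q j w).
    by rewrite -mulr_sumr -mulr_sumr; ring.
  apply: ler_wpM2l; first exact: mulr_ge0.
  apply: le_trans (PhiP w sw) _; rewrite lerD2l ler_wpM2l // ler_sum // => j _.
  rewrite /Q -{1}(cat_take_drop k w) (drop_nth false) ?sw //.
  rewrite (@height_centered _ k) //; first by rewrite size_takel // sw ltnW.
  by rewrite size_drop sw -nE Nn.
have h1 : term Habs (fun=> 1) n k <= s * K * lam ^+ n.
  by have := term_abs k (n - k.+1); rewrite -nE.
have h2 j : term Habs (Q j) n k <= 3 * s * K * lam ^+ n * n%:R.
  by have := term_quadratic k (n - k.+1) (N j); rewrite -nE.
have ln : 0 <= lam ^+ n by rewrite exprn_ge0 // ltW.
apply: (@le_trans _ _ (eps * (3 * s * K * lam ^+ n) +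
    \sum_(j < J) kap * (3 * s * K * lam ^+ n * n%:R))); last first.
  by rewrite sumr_const card_ord -mulr_natr; lra.
apply: lerD.
  apply: ler_wpM2l => //; apply: le_trans h1 _.
  by have := mulr_ge0 (mulr_ge0 s0 K0) ln; lra.
by apply: ler_sum => j _; apply: ler_wpM2l.
Qed.

Lemma geometric_sum_le (rho : R) n : 0 <= rho -> rho < 1 ->
  \sum_(k < n) rho ^+ (n - k.+1) <= (1 - rho)^-1.
Proof.
move=> r0 r1; rewrite (reindex_inj rev_ord_inj) /=.
under eq_bigr => i _ do rewrite subnSK // subKn ?(ltnW (ltn_ord i)) //.
rewrite -[leRHS]mul1r ler_pdivlMr ?subr_gt0 // mulrC.
rewrite -opprB mulNr -subrX1 opprB gerBl; exact: exprn_ge0.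
Qed.

(** There are three errors: the term without defect, the fluctuations around the ideal profiles, and
    the suffixes too short to have reached their asymptotic weight. The last are summable, since the
    deficit decays geometrically in the length of the suffix. *)
Lemma shock_expansion : exists2 kappa, kappa != 0 & exists2 K', 0 <= K' &
  forall n (Phi : seq bool -> R) (gam : nat -> R) M eps kap J (N : 'I_J -> nat),
  0 <= M -> 0 <= eps -> 0 <= kap -> (forall k, `|gam k| <= M) ->
  (forall w, size w = n -> `|Phi w| <= M) -> (forall j, (N j <= n)%N) ->
  (forall k w, (k < n)%N -> size w = n -> `|Phi w - gam k| <= eps + kap * \sum_j
    ((count id (take (N j) w))%:R - (rl * (minn k (N j))%:R + rh * (N j - k)%:R)) ^+ 2) ->
  `|wsum n (fun w => W (act w V) * Phi w) / lam ^+ n - kappa * \sum_(k < n) gam k|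
    <= K' * (M + n%:R * eps + kap * J%:R * n%:R ^+ 2).
Proof.
have [_ _ [kap0 kap0N [rho /andP[rho0 rho1] rhoP]]] := KP.
have l0 := lam_gt0; have s0 := s_ge0; have K0 := K_ge0.
have AV0 : 0 < A^-1 by rewrite invr_gt0.
pose ch := D - A^-1.
have rho10 : 0 < 1 - rho by rewrite subr_gt0.
have lN := lt0r_neq0 l0.
have chN : ch != 0.
  by rewrite lt_eqF // subr_lt0 (le_lt_trans D_le0).
(* [ch] is the sum of the two defect letters. The division by [lam] is there because the defect
   occupies a site: prefix and suffix have total length [n - 1]. *)
exists (ch / lam * kap0); first by rewrite !mulf_neq0 ?invr_eq0.
pose K1 := `|ch| / lam * K / (1 - rho).
have K10 : 0 <= K1 by rewrite !mulr_ge0 ?invr_ge0 // ltW.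
exists (`|W V| + 3 * s * K + K1); first by rewrite !addr_ge0 // !mulr_ge0.
move=> n Phi gam M eps kap J N M0 e0 k0 gM PhiM Nn PhiP.
have ln := exprn_gt0 n l0; have lnN := lt0r_neq0 ln.
have n0 : 0 <= n%:R :> R by [].
have J0 : 0 <= J%:R :> R by [].
have -> : wsum n (fun w => W (act w V) * Phi w) =
    W V * wsum n (fun w => lprod w * Phi w) + \sum_(k < n) term H Phi n k.
  rewrite -wsumZ -wsum_sum -wsumD; apply: eq_wsum_size => w sw.
  rewrite (lpeel_all A_gt0 w V Wb) sw mulrDl mulr_suml.
  by congr (_ + _); ring.
have t1 : `|W V * wsum n (fun w => lprod w * Phi w)| <= `|W V| * M * lam ^+ n.
  rewrite normrM -mulrA ler_wpM2l // (le_trans (ler_norm_wsum _ _)) //.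
  rewrite -wsum_lprod -wsumZ; apply: ler_wsum => w sw.
  by rewrite normrM (ger0_norm (lprod_ge0 A_gt0 w)) mulrC ler_wpM2r ?lprod_ge0 ?PhiM.
have t2 : `|\sum_(k < n) (term H Phi n k - gam k * term H (fun=> 1) n k)| <=
    n%:R * (3 * s * K * lam ^+ n * (eps + kap * J%:R * n%:R)).
  apply: le_trans (ler_norm_sum _ _ _) _.
  apply: (@le_trans _ _ (\sum_(k < n) (3 * s * K * lam ^+ n * (eps + kap * J%:R * n%:R)))).
    by apply: ler_sum => k _; apply: term_error => // w sw; apply: PhiP.
  by rewrite sumr_const card_ord -[leLHS]mulr_natl.
have t3 : `|\sum_(k < n) gam k * (term H (fun=> 1) n k - ch / lam * kap0 * lam ^+ n)| <=
    M * K1 * lam ^+ n.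
  apply: le_trans (ler_norm_sum _ _ _) _.
  apply: (@le_trans _ _ (\sum_(k < n) M * (`|ch| / lam * K * lam ^+ n) * rho ^+ (n - k.+1))).
    apply: ler_sum => k _; set m := (n - k.+1)%N.
    have nE : n = (k + m.+1)%N by rewrite -subSn // subSS subnKC // ltnW.
    have := term_one k m; rewrite -nE => ->.
    rewrite -/ch normrM -[leRHS]mulrA.
    apply: ler_pM => //.
    have -> : lam ^+ k * (ch * W1 (iter m total V)) - ch / lam * kap0 * lam ^+ n =
       ch / lam * lam ^+ n * (W1 (iter m total V) / lam ^+ m - kap0).
      have -> : lam ^+ n = lam ^+ k * (lam * lam ^+ m) by rewrite -exprS -exprD -nE.
      by field; rewrite expf_neq0.
    rewrite !normrM (gtr0_norm ln) (@gtr0_norm _ lam^-1) ?invr_gt0 //.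
    have -> : `|ch| / lam * K * lam ^+ n * rho ^+ m =
      `|ch| / lam * lam ^+ n * (K * rho ^+ m) by ring.
    by rewrite ler_wpM2l ?rhoP // !mulr_ge0 ?invr_ge0 // ltW.
  rewrite -mulr_sumr -[leLHS]mulrA -[leRHS]mulrA ler_wpM2l //.
  have -> : K1 * lam ^+ n = `|ch| / lam * K * lam ^+ n * (1 - rho)^-1.
    by rewrite /K1; ring.
  rewrite ler_wpM2l ?geometric_sum_le //.
  by rewrite !mulr_ge0 ?invr_ge0 // ltW.
rewrite -(ler_pM2r ln) -[X in _ * X <= _](gtr0_norm ln) -normrM mulrBl divfK //.
have -> : W V * wsum n (fun w => lprod w * Phi w) + \sum_(k < n) term H Phi n k
   - ch / lam * kap0 * (\sum_(k < n) gam k) * lam ^+ n =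
   W V * wsum n (fun w => lprod w * Phi w)
   + (\sum_(k < n) (term H Phi n k - gam k * term H (fun=> 1) n k)
   + \sum_(k < n) gam k * (term H (fun=> 1) n k - ch / lam * kap0 * lam ^+ n)).
  rewrite -big_split /= -addrA; congr (_ + _).
  rewrite mulr_sumr mulr_suml -sumrB; apply: eq_bigr => k _; ring.
apply: le_trans (ler_normD _ _) _.
apply: le_trans (lerD t1 (le_trans (ler_normD _ _) (lerD t2 t3))) _.
have x1 : 0 <= n%:R * eps by rewrite mulr_ge0.
have x2 : 0 <= kap * J%:R * n%:R ^+ 2 by rewrite !mulr_ge0.
have sK : 0 <= s * K by rewrite mulr_ge0.
rewrite -subr_ge0.
have -> : (`|W V| + 3 * s * K + K1) * (M + n%:R * eps + kap * J%:R * n%:R ^+ 2) * lam ^+ n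
  - (`|W V| * M * lam ^+ n + (n%:R * (3 * s * K * lam ^+ n * (eps + kap * J%:R * n%:R))
     + M * K1 * lam ^+ n)) =
  ((`|W V| + K1) * (n%:R * eps + kap * J%:R * n%:R ^+ 2) + 3 * (s * K) * M) * lam ^+ n by ring.
apply: mulr_ge0; last exact: ltW.
by apply: addr_ge0; apply: mulr_ge0 => //; [exact: addr_ge0|exact: addr_ge0|exact: mulr_ge0].
Qed.

(** The expansion is divided by its own instance at the constant test function 1, whose leading term
    is a nonzero multiple of [n]. *)
Lemma shock_averages : exists2 K', 0 <= K' &
  exists n0, forall n, (n0 <= n)%N ->
  [/\ (0 < n)%N, wsum n (fun w => W (act w V)) != 0 &
  forall (Phi : seq bool -> R) (gam : nat -> R) M eps kap J (N : 'I_J -> nat),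
  0 <= M -> 0 <= eps -> 0 <= kap -> (forall k, `|gam k| <= M) ->
  (forall w, size w = n -> `|Phi w| <= M) -> (forall j, (N j <= n)%N) ->
  (forall k w, (k < n)%N -> size w = n -> `|Phi w - gam k| <= eps + kap * \sum_j
    ((count id (take (N j) w))%:R - (rl * (minn k (N j))%:R + rh * (N j - k)%:R)) ^+ 2) ->
  `|wsum n (fun w => W (act w V) * Phi w) / wsum n (fun w => W (act w V))
     - (\sum_(k < n) gam k) / n%:R|
    <= K' * (M / n%:R + eps + kap * J%:R * n%:R)].
Proof.
have [kap0 kap0N [K1 K10 expn]] := shock_expansion.
have l0 := lam_gt0.
have ak0 : 0 < `|kap0| by rewrite normr_gt0.
exists (4 * K1 / `|kap0|); first by rewrite !mulr_ge0 ?invr_ge0.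
(* From here on [|kap0| n] is at least twice the error [K1], so the normalisation is at least half
   its leading term. *)
exists (Num.bound (2 * K1 / `|kap0|)).+1.
move=> n n0n; have n_gt0 : (0 < n)%N by apply: leq_trans n0n.
have n0 : 0 < n%:R :> R by rewrite ltr0n.
pose S := wsum n (fun w => W (act w V)).
have ln := exprn_gt0 n l0; have lnN := lt0r_neq0 ln.
have Sn : `|S / lam ^+ n - kap0 * n%:R| <= K1.
  have n1 : `|1 : R| <= 1 by rewrite normr1.
  have : `|wsum n (fun w => W (act w V) * 1) / lam ^+ n - kap0 * \sum_(k < n) 1| <=
      K1 * (1 + n%:R * 0 + 0 * 0%:R * n%:R ^+ 2).
    apply: (expn n (fun _ => 1) (fun _ => 1) 1 0 0 0%N (fun _ => 0%N)) => // k w _ _.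
    by rewrite subrr normr0 mul0r addr0.
  rewrite sumr_const card_ord !mulr0 !mul0r !addr0 mulr1.
  by rewrite (@eq_wsum _ n _ (fun w => W (act w V))) // => w; apply: mulr1.
have Kn : 2 * K1 <= `|kap0| * n%:R.
  rewrite [leRHS]mulrC -ler_pdivrMr //.
  have b : 0 <= 2 * K1 / `|kap0| by rewrite !mulr_ge0 ?invr_ge0.
  rewrite (le_trans (ltW (archi_boundP b))) // ler_nat.
  exact: leq_trans n0n.
have Sl : `|kap0| * n%:R / 2 <= `|S / lam ^+ n|.
  have : `|kap0 * n%:R| <= `|S / lam ^+ n| + `|S / lam ^+ n - kap0 * n%:R|.
    rewrite -{1}[kap0 * n%:R](subKr (S / lam ^+ n)); exact: ler_normB.
  by rewrite normrM (gtr0_norm n0); lra.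
have kn0 : 0 < `|kap0| * n%:R / 2 by rewrite divr_gt0 ?mulr_gt0.
have Sl0 : 0 < `|S / lam ^+ n| by apply: lt_le_trans Sl.
have SN : S != 0.
  by move: Sl0; rewrite normr_gt0 mulf_eq0 negb_or => /andP[].
split=> //.
move=> Phi gam M eps kap J N M0 e0 k0 gM PhiM Nn PhiP.
have E := expn n Phi gam M eps kap J N M0 e0 k0 gM PhiM Nn PhiP.
set SPhi := wsum n _ in E *.
set g := \sum_(k < n) gam k in E *.
have gn : `|g / n%:R| <= M.
  rewrite normrM (@gtr0_norm _ n%:R^-1) ?invr_gt0 // ler_pdivrMr //.
  apply: le_trans (ler_norm_sum _ _ _) _.
  apply: (@le_trans _ _ (\sum_(k < n) M)); first by apply: ler_sum.
  by rewrite sumr_const card_ord mulr_natr.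
rewrite -/S.
have -> : SPhi / S - g / n%:R = (SPhi / lam ^+ n - kap0 * g +
    - (g / n%:R) * (S / lam ^+ n - kap0 * n%:R)) / (S / lam ^+ n).
  by field; rewrite SN lnN lt0r_neq0.
rewrite normrM normfV ler_pdivrMr //.
set err := M + n%:R * eps + kap * J%:R * n%:R ^+ 2 in E.
have err0 : 0 <= n%:R * eps + kap * J%:R * n%:R ^+ 2.
  by rewrite addr_ge0 ?mulr_ge0 ?sqr_ge0 // ltW.
have eE : M / n%:R + eps + kap * J%:R * n%:R = err / n%:R.
  by rewrite /err; field; rewrite lt0r_neq0.
apply: (@le_trans _ _ (2 * K1 * err)).
  apply: le_trans (ler_normD _ _) _.
  rewrite normrM normrN.
  have : `|g / n%:R| * `|S / lam ^+ n - kap0 * n%:R| <= M * K1 by apply: ler_pM.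
  have := mulr_ge0 K10 err0.
  by move: E; rewrite /err; lra.
rewrite eE; apply: (@le_trans _ _ (4 * K1 / `|kap0| * (err / n%:R) * (`|kap0| * n%:R / 2))).
  rewrite le_eqVlt; apply/orP; left; apply/eqP; field.
  by rewrite !lt0r_neq0.
rewrite ler_wpM2l // !mulr_ge0 ?invr_ge0 //; first by rewrite /err; lra.
Qed.

End Shock.

(** * Stationary measures of the open ASEP *)

Definition word n (s : asep_config n) : seq bool := [seq s i | i <- enum 'I_n].

Lemma size_word n (s : asep_config n) : size (word s) = n.
Proof. by rewrite size_map size_enum_ord. Qed.

Lemma nth_word n (s : asep_config n) b (i : 'I_n) : nth b (word s) i = s i.
Proof. by rewrite (nth_map i) ?size_enum_ord // nth_ord_enum. Qed.

Lemma sum_tuple (R : realFieldType) n (Phi : seq bool -> R) :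
  \sum_(t : n.-tuple bool) Phi t = wsum n Phi.
Proof.
elim: n Phi => [|n IH] Phi.
  rewrite (big_pred1 [tuple]) // => t; apply/esym/eqP; exact: tuple0.
rewrite /= -!IH.
rewrite (reindex (fun p : bool * n.-tuple bool => [tuple of p.1 :: p.2])) /=; last first.
  exists (fun t : n.+1.-tuple bool => (thead t, [tuple of behead t])).
    by move=> [b t] _; congr (_, _); apply: val_inj.
  by move=> t _; rewrite [in RHS](tuple_eta t); apply: val_inj.
rewrite -(pair_bigA _ (fun b (t : n.-tuple bool) => Phi (b :: t))) /=.
by rewrite big_bool.
Qed.

Lemma sum_config (R : realFieldType) n (Phi : seq bool -> R) :
  \sum_(s : asep_config n) Phi (word s) = wsum n Phi.
Proof.
rewrite -sum_tuple.
rewrite (reindex (fun t : n.-tuple bool => [ffun i => tnth t i] : asep_config n)) /=.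
  apply: eq_bigr => t _; congr Phi.
  rewrite /word; under eq_map do rewrite ffunE.
  by rewrite map_tnth_enum.
exists (fun s : asep_config n => [tuple s i | i < n]).
  by move=> t _; apply: eq_from_tnth => i; rewrite tnth_mktuple ffunE.
by move=> s _; apply/ffunP => i; rewrite ffunE tnth_mktuple.
Qed.

Lemma word_split n (s : asep_config n) (i j : 'I_n) : (j : nat) = i.+1 ->
  word s = take i (word s) ++ s i :: s j :: drop i.+2 (word s).
Proof.
move=> ji.
rewrite -{1}(cat_take_drop i (word s)) (drop_nth false) ?size_word // nth_word.
by rewrite -ji (drop_nth false) ?size_word // nth_word ji.
Qed.

Lemma word_exchange n (s : asep_config n) (i j : 'I_n) : (j : nat) = i.+1 ->
  word (exchange_sites i j s) = take i (word s) ++ s j :: s i :: drop i.+2 (word s).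
Proof.
move=> ji; have ni : (i < n)%N := ltn_ord i.
have nj : (i.+1 < n)%N by rewrite -ji.
rewrite (word_split (exchange_sites i j s) ji) !ffunE tpermL tpermR.
congr (_ ++ _ :: _ :: _); apply: (@eq_from_nth _ false); rewrite ?size_take ?size_drop !size_word //.
- rewrite ni => k ki; rewrite !nth_take //.
  have kn := ltn_trans ki ni.
  rewrite -[k]/(val (Ordinal kn)) !nth_word ffunE tpermD //.
    by rewrite -val_eqE /= gtn_eqF.
  by rewrite -val_eqE /= ji gtn_eqF // ltnW.
- move=> k ki; rewrite !nth_drop.
  have kn : (i.+2 + k < n)%N by rewrite -ltn_subRL.
  rewrite -[(i.+2 + k)%N]/(val (Ordinal kn)) !nth_word ffunE tpermD //.
    by rewrite -val_eqE /= ltn_eqF // ltn_addr.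
  by rewrite -val_eqE /= ji ltn_eqF // ltn_addr.
Qed.

Definition erase k (w : seq bool) := take k w ++ drop k.+1 w.

(** * Invariance of matrix product weights under the generator *)

Section Generator.
Variables (R : realType) (q alpha beta gamma delta : R) (n : nat).

Local Notation config := (asep_config n).
Local Notation gen := (asep_generator q alpha beta gamma delta).

Definition bond_rate (i j : 'I_n) (s : config) : R :=
  if s i && ~~ s j then 1 else if ~~ s i && s j then q else 0.

Lemma exchange_sitesK i j : involutive (@exchange_sites n i j).
Proof. by move=> s; apply/ffunP => k; rewrite !ffunE tpermK. Qed.

Lemma flip_siteK i : involutive (@flip_site n i).
Proof. by move=> s; apply/ffunP => k; rewrite !ffunE; case: eqP => // _; rewrite negbK. Qed.

Lemma sum_move (T : finType) (F r f : T -> R) (h : T -> T) : involutive h ->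
  \sum_s F s * (r s * (f (h s) - f s)) =
  \sum_s (F (h s) * r (h s) - F s * r s) * f s.
Proof.
move=> hK; rewrite (eq_bigr (fun s => F s * r s * f (h s) - F s * r s * f s)); last first.
  by move=> s _; ring.
rewrite sumrB (reindex_inj (can_inj hK)) /= -sumrB.
by apply: eq_bigr => s _; rewrite hK; ring.
Qed.

Section MatrixProduct.
Variable G : seq bool -> R.
Hypothesis bulk : forall u v,
  G (u ++ true :: false :: v) - q * G (u ++ false :: true :: v) =
  (1 - q) * (G (u ++ true :: v) + G (u ++ false :: v)).
Hypothesis left_bdry : forall v,
  alpha * G (false :: v) - gamma * G (true :: v) = (1 - q) * G v.
Hypothesis right_bdry : forall v,
  beta * G (rcons v true) - delta * G (rcons v false) = (1 - q) * G v.

Let sgn (b : bool) : R := if b then 1 else -1.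
Let height k (s : config) := sgn (nth false (word s) k) * G (erase k (word s)).

(** The bulk relation shortens the word by one letter. With the sign of the erased letter the net
    flow across a bond is a discrete gradient, so the bonds telescope. *)
Lemma bond_flux (i j : 'I_n) (s : config) : (j : nat) = i.+1 ->
  G (word (exchange_sites i j s)) * bond_rate i j (exchange_sites i j s)
    - G (word s) * bond_rate i j s = (1 - q) * (height j s - height i s).
Proof.
move=> ji; rewrite /height !nth_word (word_exchange s ji) [in X in _ - X](word_split s ji).
have si : size (take i (word s)) = i by rewrite size_takel // size_word ltnW.
have -> : erase i (word s) = take i (word s) ++ s j :: drop i.+2 (word s).
  by rewrite /erase (drop_nth false) ?size_word -?ji // nth_word ji.
have -> : erase j (word s) = take i (word s) ++ s i :: drop i.+2 (word s).
  rewrite /erase ji (take_nth false) ?size_word //.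
  by rewrite nth_word cat_rcons.
rewrite /bond_rate !ffunE tpermL tpermR /sgn.
have := bulk (take i (word s)) (drop i.+2 (word s)).
by case: (s i); case: (s j) => /= H; lra.
Qed.

Lemma telescope_bonds (h : nat -> R) m : n = m.+1 ->
  \sum_(i < n) \sum_(j < n | (j : nat) == i.+1) (h j - h i) = h m - h 0%N.
Proof.
move=> ->; under eq_bigr => i _ do rewrite (big_ord1_eq _ (fun j => h j - h i)).
rewrite big_ord_recr /= ltnn addr0.
under eq_bigr => i _ do rewrite ltnS ltn_ord.
rewrite -(big_mkord xpredT (fun i => h i.+1 - h i)).
exact: telescope_sumr.
Qed.

(** The adjoint generator vanishes configuration by configuration: the telescoped bulk leaves
    [height] at the two end sites, and the boundary relations cancel these. *)
Lemma matrix_product_stationary (f : config -> R) : (0 < n)%N ->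
  \sum_(s : config) G (word s) * gen f s = 0.
Proof.
move=> n_gt0.
pose bdl (i : 'I_n) (s : config) : R := if s i then gamma else alpha.
pose bdr (i : 'I_n) (s : config) : R := if s i then beta else delta.
(* The adjoint of the generator applied to the weights; each elementary move is an involution, so
   changing variables in the sum transposes it. *)
pose dual (s : config) := \sum_(i < n) \sum_(j < n | (j : nat) == i.+1)
    (G (word (exchange_sites i j s)) * bond_rate i j (exchange_sites i j s)
      - G (word s) * bond_rate i j s)
  + \sum_(i < n | (i : nat) == 0%N)
    (G (word (flip_site i s)) * bdl i (flip_site i s) - G (word s) * bdl i s)
  + \sum_(i < n | i.+1 == n)
    (G (word (flip_site i s)) * bdr i (flip_site i s) - G (word s) * bdr i s).
have -> : \sum_(s : config) G (word s) * gen f s = \sum_s dual s * f s.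
  rewrite /asep_generator /dual.
  under eq_bigr do rewrite !mulrDr.
  under [in RHS]eq_bigr do rewrite !mulrDl.
  rewrite !big_split /=; congr (_ + _ + _).
  - under eq_bigr do rewrite mulr_sumr.
    under [in RHS]eq_bigr do rewrite mulr_suml.
    rewrite exchange_big [in RHS]exchange_big; apply: eq_bigr => i _.
    under eq_bigr do rewrite mulr_sumr.
    under [in RHS]eq_bigr do rewrite mulr_suml.
    rewrite exchange_big [in RHS]exchange_big; apply: eq_bigr => j _.
    exact: (sum_move _ _ _ (exchange_sitesK i j)).
  - under eq_bigr do rewrite mulr_sumr.
    under [in RHS]eq_bigr do rewrite mulr_suml.
    rewrite exchange_big [in RHS]exchange_big; apply: eq_bigr => i _.
    exact: (sum_move _ _ _ (flip_siteK i)).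
  - under eq_bigr do rewrite mulr_sumr.
    under [in RHS]eq_bigr do rewrite mulr_suml.
    rewrite exchange_big [in RHS]exchange_big; apply: eq_bigr => i _.
    exact: (sum_move _ _ _ (flip_siteK i)).
apply: big1 => s _; suff -> : dual s = 0 by rewrite mul0r.
have [m nm] : exists m, n = m.+1 by exists n.-1; rewrite prednK.
rewrite /dual.
rewrite (eq_bigr (fun i : 'I_n => \sum_(j < n | (j : nat) == i.+1)
    ((1 - q) * height j s - (1 - q) * height i s))); last first.
  by move=> i _; apply: eq_bigr => j /eqP ji; rewrite bond_flux // mulrBr.
rewrite (telescope_bonds (fun k => (1 - q) * height k s) nm).
have -> : \sum_(i < n | (i : nat) == 0%N)
    (G (word (flip_site i s)) * bdl i (flip_site i s) - G (word s) * bdl i s) =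
    (1 - q) * height 0 s.
  rewrite (big_pred1 (Ordinal n_gt0)); last by [].
  set o := Ordinal n_gt0.
  have E t : word t = t o :: behead (word t).
    by rewrite -{1}[word t]drop0 (drop_nth false) ?size_word // -[0%N]/(val o) nth_word drop1.
  have B : behead (word (flip_site o s)) = behead (word s).
    rewrite -!drop1; apply: (@eq_from_nth _ false); rewrite !size_drop !size_word // => k kn.
    rewrite !nth_drop; have kn' : (1 + k < n)%N by rewrite -ltn_subRL.
    by rewrite -[(1 + k)%N]/(val (Ordinal kn')) !nth_word ffunE.
  have -> : height 0 s = sgn (s o) * G (behead (word s)).
    by rewrite /height /erase take0 drop1 -[0%N]/(val o) nth_word.
  rewrite (E (flip_site o s)) (E s) B /bdl ffunE eqxx /sgn /=.
  by have := left_bdry (behead (word s)); case: (s o) => /= H; lra.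
have -> : \sum_(i < n | i.+1 == n)
    (G (word (flip_site i s)) * bdr i (flip_site i s) - G (word s) * bdr i s) =
    - ((1 - q) * height m s).
  have mn : (m < n)%N by rewrite nm.
  rewrite (big_pred1 (Ordinal mn)); last by move=> i; rewrite -[RHS]/(val i == m) -(eqSS i m) -nm.
  set o := Ordinal mn.
  have E t : word t = rcons (take m (word t)) (t o).
    by rewrite -(nth_word t false o) -take_nth ?size_word // take_oversize // size_word nm.
  have B : take m (word (flip_site o s)) = take m (word s).
    apply: (@eq_from_nth _ false); rewrite !size_take !size_word // mn => k km.
    rewrite !nth_take //; have kn := ltn_trans km mn.
    rewrite -[k]/(val (Ordinal kn)) !nth_word ffunE; case: eqP => // - [km'].
    by rewrite km' ltnn in km.
  have -> : height m s = sgn (s o) * G (take m (word s)).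
    rewrite /height /erase drop_oversize ?size_word ?nm // cats0.
    by rewrite -[m in nth _ _ m]/(val o) nth_word.
  have := E s; have := E (flip_site o s); rewrite B.
  set v := take m (word s) => -> ->; rewrite /bdr ffunE eqxx /sgn /=.
  by have := right_bdry v; case: (s o) => /= H; lra.
by ring.
Qed.

End MatrixProduct.

End Generator.

Lemma nonpos_sum0 (R : realType) (I : finType) (P : pred I) (F : I -> R) :
  (forall i, P i -> F i <= 0) -> \sum_(i | P i) F i = 0 ->
  forall i, P i -> F i = 0.
Proof.
move=> F0 F1 i Pi; apply: oppr_inj; rewrite oppr0.
apply: (@psumr_eq0P _ _ P (fun i => - F i)) => //; last by rewrite sumrN F1 oppr0.
by move=> j Pj; rewrite oppr_ge0 F0.
Qed.

(** * Uniqueness of the invariant measure *)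

Section Uniqueness.
Variables (R : realType) (q alpha beta gamma delta : R) (n : nat).
Hypotheses (alpha_gt0 : 0 < alpha) (beta_ge0 : 0 <= beta)
  (gamma_ge0 : 0 <= gamma) (delta_ge0 : 0 <= delta) (q_ge0 : 0 <= q).

Local Notation config := (asep_config n).
Local Notation gen := (asep_generator q alpha beta gamma delta).

Let full : config := [ffun=> true].

(** A maximum principle for signed measures: tested on the indicator of [0 < G], invariance is a sum
    of nonpositive terms, so each vanishes. The set [0 < G] is then closed under creation at the
    first site and jumps to the right, and these lead to [full]. *)
Lemma stationary_support (G : config -> R) :
  (forall f, \sum_s G s * gen f s = 0) -> forall s, 0 < G s -> 0 < G full.
Proof.
move=> Ggen s0 Gs0.
pose f (s : config) : R := (0 < G s)%R%:R.
have f0 s : 0 <= f s by rewrite ler0n.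
have f1 s : f s <= 1 by rewrite /f; case: (_ < _); rewrite ?lexx ?ler01.
have r1 i j (s : config) : 0 <= (if s i && ~~ s j then 1 else if ~~ s i && s j then q else 0 : R).
  by case: ifP => // _; case: ifP.
have r2 (i : 'I_n) (s : config) : 0 <= (if s i then gamma else alpha).
  by case: ifP => // _; apply: ltW.
have r3 (i : 'I_n) (s : config) : 0 <= (if s i then beta else delta) by case: ifP.
have parts s : 0 < G s ->
   [/\ \sum_(i < n) \sum_(j < n | (j : nat) == i.+1)
       (if s i && ~~ s j then 1 else if ~~ s i && s j then q else 0)
         * (f (exchange_sites i j s) - f s) <= 0,
      \sum_(i < n | (i : nat) == 0%N)
       (if s i then gamma else alpha) * (f (flip_site i s) - f s) <= 0 &
      \sum_(i < n | i.+1 == n)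
       (if s i then beta else delta) * (f (flip_site i s) - f s) <= 0].
  move=> Gs; have fs : f s = 1 by rewrite /f Gs.
  have le0 s' : f s' - f s <= 0 by rewrite fs subr_le0.
  by split; rewrite ?sumr_le0 // => i _; rewrite ?sumr_le0 // => *; rewrite mulr_ge0_le0.
have sgn s : G s * gen f s <= 0.
  have [Gs|Gs] := ltP 0 (G s).
    have [h1 h2 h3] := parts s Gs.
    rewrite mulr_ge0_le0 ?(ltW Gs) // /asep_generator; lra.
  have fs : f s = 0 by rewrite /f ltNge Gs.
  have ge0 s' : 0 <= f s' - f s by rewrite fs subr0.
  rewrite mulr_le0_ge0 // /asep_generator !addr_ge0 //.
  - by apply: sumr_ge0 => i _; apply: sumr_ge0 => j _; rewrite mulr_ge0.
  - by apply: sumr_ge0 => i _; rewrite mulr_ge0.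
  - by apply: sumr_ge0 => i _; rewrite mulr_ge0.
have gen0 s : 0 < G s -> gen f s = 0.
  move=> Gs; have /eqP := nonpos_sum0 (fun s _ => sgn s) (Ggen f) (i := s) isT.
  by rewrite mulf_eq0 gt_eqF //= => /eqP.
have closed_flip s (i : 'I_n) : 0 < G s -> (i : nat) = 0%N -> ~~ s i -> 0 < G (flip_site i s).
  move=> Gs i0 si; have [h1 h2 h3] := parts s Gs; have g0 := gen0 s Gs.
  have fs : f s = 1 by rewrite /f Gs.
  have : \sum_(i < n | (i : nat) == 0%N)
       (if s i then gamma else alpha) * (f (flip_site i s) - f s) = 0.
    by move: g0 h1 h2 h3; rewrite /asep_generator; lra.
  have le0 s' : f s' - f s <= 0 by rewrite fs subr_le0.
  move/nonpos_sum0 => /(_ _ i) /=; rewrite i0 eqxx => H.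
  have := H (fun k _ => mulr_ge0_le0 (r2 k s) (le0 _)) isT.
  rewrite (negbTE si) => /eqP; rewrite mulf_eq0 gt_eqF //= fs subr_eq0 /f.
  by case: (0 < G _) => //; rewrite eq_sym oner_eq0.
have closed_jump s (i j : 'I_n) : 0 < G s -> (j : nat) = i.+1 -> s i -> ~~ s j ->
    0 < G (exchange_sites i j s).
  move=> Gs ji si sj; have [h1 h2 h3] := parts s Gs; have g0 := gen0 s Gs.
  have fs : f s = 1 by rewrite /f Gs.
  have E : \sum_(i < n) \sum_(j < n | (j : nat) == i.+1)
       (if s i && ~~ s j then 1 else if ~~ s i && s j then q else 0)
         * (f (exchange_sites i j s) - f s) = 0.
    by move: g0 h1 h2 h3; rewrite /asep_generator; lra.
  have le0 s' : f s' - f s <= 0 by rewrite fs subr_le0.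
  have tle k l : (if s k && ~~ s l then 1 else if ~~ s k && s l then q else 0)
      * (f (exchange_sites k l s) - f s) <= 0 by rewrite mulr_ge0_le0.
  have Ei := nonpos_sum0 (fun k _ => sumr_le0 _ (fun l _ => tle k l)) E (i := i) isT.
  have := nonpos_sum0 (fun l _ => tle i l) Ei (i := j); rewrite ji eqxx => /(_ isT).
  rewrite si sj mul1r fs => /eqP; rewrite subr_eq0 /f.
  by case: (0 < G _) => //; rewrite eq_sym oner_eq0.
(* Both moves strictly increase this potential. The weight is [i.+1] so that a particle created at
   site 0 counts; a maximiser over [0 < G] can have no empty site. *)
pose mass (s : config) := (\sum_(i < n) s i * i.+1)%N.
case: (arg_maxnP (P := fun s => 0 < G s) mass Gs0) => s Gs smax0.
have smax t : 0 < G t -> (mass t <= mass s)%N by exact: smax0.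
suff -> : full = s by [].
apply/ffunP => i; rewrite ffunE; apply/esym.
have [k] := ubnP (i : nat); elim: k i => // k IH i ik.
apply/negPn/negP => si.
have [i0|i0] := posnP i.
  have := smax _ (closed_flip s i Gs i0 si); rewrite leqNgt => /negP; apply.
  rewrite /mass (bigD1 i) //= [ltnRHS](bigD1 i) //= ffunE eqxx (negbTE si) mul0n add0n.
  rewrite mul1n addSn ltnS (leq_trans _ (leq_addl _ _)) //.
  by apply: leq_sum => j ji; rewrite ffunE (negbTE ji).
have jn : (i.-1 < n)%N by rewrite (leq_ltn_trans (leq_pred _)).
pose j : 'I_n := Ordinal jn.
have ij : (i : nat) = j.+1 by rewrite /= prednK.
have sj : s j by apply: IH; rewrite -ltnS -ij.
have := smax _ (closed_jump s j i Gs ij sj si); rewrite leqNgt => /negP; apply.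
have jNi : j != i by apply/eqP => jiE; move: ij; rewrite -jiE => /n_Sn.
rewrite /mass (bigD1 j) //= (bigD1 i) //=; last by rewrite eq_sym.
rewrite [ltnRHS](bigD1 j) //= [X in (_ < _ + X)%N](bigD1 i) //=; last by rewrite eq_sym.
rewrite !ffunE tpermL tpermR sj (negbTE si) !mul0n !mul1n !add0n.
have -> : (\sum_(k0 < n | (k0 != j) && (k0 != i)) exchange_sites j i s k0 * k0.+1 =
  \sum_(k0 < n | (k0 != j) && (k0 != i)) s k0 * k0.+1)%N.
  by apply: eq_bigr => l /andP[lj li]; rewrite ffunE tpermD // eq_sym.
by rewrite ltn_add2r ltnS ij.
Qed.

(** The difference [F - c mu] is invariant with total mass 0. If it were not zero, it and its
    opposite would both take positive values, hence both be positive at [full]. *)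
Lemma stationary_proportional (mu F : config -> R) :
  \sum_s mu s = 1 ->
  (forall f, \sum_s mu s * gen f s = 0) -> (forall f, \sum_s F s * gen f s = 0) ->
  forall s, F s = (\sum_s' F s') * mu s.
Proof.
move=> mu1 muS FS s; set c := \sum_s' F s'.
pose G a (t : config) := a * (F t - c * mu t).
have GS a f : \sum_s G a s * gen f s = 0.
  rewrite (eq_bigr (fun s => a * (F s * gen f s) - a * c * (mu s * gen f s))); last first.
    by move=> t _; rewrite /G; ring.
  by rewrite sumrB -!mulr_sumr FS muS !mulr0 subrr.
have G0 a : \sum_s G a s = 0.
  by rewrite -mulr_sumr sumrB -mulr_sumr mu1 mulr1 subrr mulr0.
have pos a : G a s != 0 -> 0 < G a full.
  move=> Gs; have [t Gt] : exists t, 0 < G a t.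
    apply: contrapT => /forallNP H; move/eqP: Gs; apply.
    apply: (nonpos_sum0 _ (G0 a) isT) => t _.
    by rewrite leNgt; apply/negP; apply: H.
  exact: stationary_support (GS a) _ Gt.
apply/eqP; rewrite -subr_eq0; apply/negP => /negP Gs.
have h1 := pos 1; have h2 := pos (-1).
move: h1 h2; rewrite /G !mul1r !mulN1r oppr_eq0 => /(_ Gs) h1 /(_ Gs).
by rewrite oppr_gt0 ltNge (ltW h1).
Qed.

End Uniqueness.

(** * From the semigroup to the generator *)

Section Semigroup.
Variables (R : realType) (q alpha beta gamma delta : R) (n : nat).

Local Notation config := (asep_config n).
Local Notation gen := (@asep_generator R q alpha beta gamma delta n).
Local Notation sg := (@asep_semigroup R q alpha beta gamma delta n).

Lemma generator_bounded : exists2 L, 0 <= L &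
  forall (f : config -> R) M, (forall s, `|f s| <= M) -> forall s, `|gen f s| <= L * M.
Proof.
pose r1 (s : config) := \sum_(i < n) \sum_(j < n | (j : nat) == i.+1)
  `|if s i && ~~ s j then 1 else if ~~ s i && s j then q else 0|.
pose r2 (s : config) := \sum_(i < n | (i : nat) == 0%N) `|if s i then gamma else alpha|.
pose r3 (s : config) := \sum_(i < n | i.+1 == n) `|if s i then beta else delta|.
have rs0 s : [/\ 0 <= r1 s, 0 <= r2 s & 0 <= r3 s].
  by split; apply: sumr_ge0 => // i _; apply: sumr_ge0.
exists (\sum_s 2 * (r1 s + r2 s + r3 s)).
  apply: sumr_ge0 => s _; have [h1 h2 h3] := rs0 s.
  by rewrite mulr_ge0 // !addr_ge0.
move=> f M fM s.
have M0 : 0 <= M by apply: le_trans (fM s).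
have term c (s' : config) : `|c * (f s' - f s)| <= `|c| * (2 * M).
  rewrite normrM ler_wpM2l // (le_trans (ler_normB _ _)) //.
  by rewrite mulr_natl mulr2n lerD.
apply: (@le_trans _ _ (2 * (r1 s + r2 s + r3 s) * M)); last first.
  rewrite ler_wpM2r // [leRHS](bigD1 s) //= lerDl; apply: sumr_ge0 => t _.
  by have [h1 h2 h3] := rs0 t; rewrite mulr_ge0 // !addr_ge0.
have -> : 2 * (r1 s + r2 s + r3 s) * M = r1 s * (2 * M) + r2 s * (2 * M) + r3 s * (2 * M).
  by ring.
rewrite /asep_generator.
apply: le_trans (ler_normD _ _) _; apply: lerD; last first.
  by rewrite mulr_suml (le_trans (ler_norm_sum _ _ _)) // ler_sum.
apply: le_trans (ler_normD _ _) _; apply: lerD; last first.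
  by rewrite mulr_suml (le_trans (ler_norm_sum _ _ _)) // ler_sum.
rewrite mulr_suml (le_trans (ler_norm_sum _ _ _)) // ler_sum // => i _.
by rewrite mulr_suml (le_trans (ler_norm_sum _ _ _)) // ler_sum.
Qed.

(** For [t <= 1] every term of the exponential series past the first two carries [t ^+ 2], and what
    remains is dominated by the exponential series of the operator bound [L]. *)
Lemma semigroup_derivative (f : config -> R) : exists2 K, 0 <= K &
  forall t s, 0 <= t -> t <= 1 -> `|sg t f s - (f s + t * gen f s)| <= K * t ^+ 2.
Proof.
have [L L0 LP] := generator_bounded.
pose M := \sum_s `|f s|.
have M0 : 0 <= M by apply: sumr_ge0.
have fM s : `|f s| <= M by rewrite /M (bigD1 s) //= lerDl sumr_ge0.
have genM k s : `|iter k gen f s| <= L ^+ k * M.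
  elim: k s => [|k IH] s; first by rewrite mul1r.
  by rewrite iterS exprS -mulrA; apply: LP.
pose E := limn (series (exp_coeff L)).
have serE N : series (exp_coeff L) N <= E.
  apply: nondecreasing_cvgn_le; last exact: is_cvg_series_exp_coeff.
  by apply: nondecreasing_series => k _ _; exact: exp_coeff_ge0.
have E0 : 0 <= E by apply: le_trans (serE 0%N); rewrite /series /= big_geq.
exists (M * E); first exact: mulr_ge0.
move=> t s t0 t1.
pose u k := t ^+ k / k`!%:R * iter k gen f s.
have uM k : `|u k| <= M * exp_coeff (t * L) k.
  have c0 : 0 <= t ^+ k / k`!%:R by rewrite divr_ge0 ?exprn_ge0.
  rewrite /u /exp_coeff /= normrM (ger0_norm c0) exprMn.
  have -> : M * (t ^+ k * L ^+ k / k`!%:R) = t ^+ k / k`!%:R * (L ^+ k * M) by ring.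
  exact: ler_wpM2l.
have cvu : cvgn (series u).
  apply: normed_cvg; apply: (@series_le_cvg _ _ (fun k => M * exp_coeff (t * L) k)) => //.
    by move=> k; apply: normr_ge0.
    by move=> k; apply: mulr_ge0 => //; apply: exp_coeff_ge0; apply: mulr_ge0.
  have -> : (fun k => M * exp_coeff (t * L) k) = M *: exp_coeff (t * L) by [].
  by apply: is_cvg_seriesZ; apply: is_cvg_series_exp_coeff.
have part N : `|series u N.+2 - (f s + t * gen f s)| <= M * E * t ^+ 2.
  rewrite /series /= big_nat_recl // big_nat_recl //.
  rewrite {1}/u /= fact0 expr0 divr1 mul1r {1}/u /= divr1 expr1.
  rewrite addrA [X in `|X|]addrC addKr.
  apply: le_trans (ler_norm_sum _ _ _) _.
  apply: (@le_trans _ _ (\sum_(0 <= k < N) M * t ^+ 2 * exp_coeff L k.+2)).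
    apply: ler_sum => k _; apply: le_trans (uM _) _.
    rewrite -mulrA ler_wpM2l // /exp_coeff /= exprMn -mulrA ler_wpM2r //.
      by rewrite divr_ge0 ?exprn_ge0.
    by rewrite -[in leRHS](mulr1 (t ^+ 2)) -addn2 addnC exprD ler_wpM2l ?exprn_ge0 // exprn_ile1.
  rewrite -mulr_sumr [leRHS]mulrAC ler_wpM2l ?mulr_ge0 ?sqr_ge0 //.
  apply: (@le_trans _ _ (series (exp_coeff L) N.+2)).
    rewrite /series /= [leRHS]big_nat_recl // [X in _ <= _ + X]big_nat_recl //.
    by rewrite addrA lerDr addr_ge0 // exp_coeff_ge0.
  exact: serE.
rewrite ler_norml; apply/andP; split.
  rewrite lerBrDl; apply: limr_ge => //.
  near=> N; have [N2 NE] : exists N2, N = N2.+2.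
    exists (N - 2)%N; rewrite -addn2 subnK //; near: N; exact: nbhs_infty_ge.
  by have := part N2; rewrite -NE ler_norml => /andP[+ _]; rewrite lerBrDl.
rewrite lerBlDl; apply: limr_le => //.
near=> N; have [N2 NE] : exists N2, N = N2.+2.
  exists (N - 2)%N; rewrite -addn2 subnK //; near: N; exact: nbhs_infty_ge.
by have := part N2; rewrite -NE ler_norml => /andP[_]; rewrite lerBlDl.
Unshelve. all: by end_near.
Qed.

(** Invariance under the semigroup makes [t] times the sum of order [t ^+ 2]; letting [t] tend to 0
    kills the sum. *)
Lemma stationary_generator (mu : config -> R) :
  asep_stationary q alpha beta gamma delta mu ->
  forall f, \sum_s mu s * gen f s = 0.
Proof.
move=> [mu0 mu1 muS] f; have [K K0 KP] := semigroup_derivative f.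
set x := \sum_s _.
have b t : 0 <= t -> t <= 1 -> `|t * x| <= K * t ^+ 2.
  move=> t0 t1; have := muS t f t0 => E.
  have -> : t * x = - \sum_s mu s * (sg t f s - (f s + t * gen f s)).
    rewrite (eq_bigr (fun s => mu s * sg t f s - mu s * f s - t * (mu s * gen f s))).
      by rewrite !sumrB E -mulr_sumr subrr sub0r opprK.
    by move=> s _; ring.
  rewrite normrN (le_trans (ler_norm_sum _ _ _)) //.
  rewrite -[leRHS]mul1r -mu1 mulr_suml ler_sum // => s _.
  by rewrite normrM (ger0_norm (mu0 s)) ler_wpM2l // KP.
apply/eqP; rewrite -normr_eq0 eq_le normr_ge0 andbT.
apply/ler_addgt0Pr => e e0; rewrite add0r.
pose t := Num.min 1 (e / (K + 1)).
have K1 : 0 < K + 1 by rewrite ltr_wpDl.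
have t0 : 0 < t by rewrite lt_min ltr01 divr_gt0.
have t1 : t <= 1 by rewrite ge_min lexx.
have te : K * t <= e.
  rewrite (@le_trans _ _ ((K + 1) * t)) ?ler_wpM2r ?(ltW t0) ?lerDl //.
  by rewrite mulrC -ler_pdivlMr // ge_min lexx orbT.
apply: le_trans te; rewrite -(ler_pM2l t0) -{1}(gtr0_norm t0) -normrM.
by have := b t (ltW t0) t1; rewrite expr2 mulrCA.
Qed.

End Semigroup.

(** * Boundary rates in terms of the boundary parameters *)

Section Kappa.
Variable R : realType.
Implicit Types q x y : R.

(** [kappa_plus] and [kappa_minus] are the roots of [x X^2 - (1 - q - x + y) X - y]. Sum and product
    recover the rates from the parameters. *)
Lemma kappa_sum q x y : 0 < x ->
  kappa_plus q x y + kappa_minus q x y = (1 - q - x + y) / x.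
Proof. by move=> x0; rewrite /kappa_plus /kappa_minus; field; rewrite lt0r_neq0. Qed.

Lemma kappa_prod q x y : 0 < x -> 0 <= y ->
  kappa_plus q x y * kappa_minus q x y = - y / x.
Proof.
move=> x0 y0; rewrite /kappa_plus /kappa_minus.
set b := 1 - q - x + y; set s := Num.sqrt _.
have sE : s ^+ 2 = b ^+ 2 + 4 * x * y.
  by rewrite sqr_sqrtr // addr_ge0 ?sqr_ge0 // !mulr_ge0 // ltW.
have -> : (2 * x)^-1 * (b + s) * ((2 * x)^-1 * (b - s)) =
   (2 * x)^-1 ^+ 2 * (b ^+ 2 - s ^+ 2) by ring.
by rewrite sE; field; rewrite lt0r_neq0.
Qed.

Lemma kappa_minus_le0 q x y : 0 < x -> 0 <= y -> kappa_minus q x y <= 0.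
Proof.
move=> x0 y0; rewrite /kappa_minus mulr_ge0_le0 ?invr_ge0 ?mulr_ge0 ?(ltW x0) //.
rewrite subr_le0 (le_trans (ler_norm _)) // -sqrtr_sqr ler_wsqrtr //.
by rewrite lerDl !mulr_ge0 // ltW.
Qed.

Lemma kappa_factor q x y : 0 < x -> 0 <= y ->
  (1 + kappa_plus q x y) * (1 + kappa_minus q x y) = (1 - q) / x.
Proof.
move=> x0 y0; have h1 := kappa_sum q y x0; have h2 := kappa_prod q x0 y0.
have -> : (1 + kappa_plus q x y) * (1 + kappa_minus q x y) =
  1 + (kappa_plus q x y + kappa_minus q x y) + kappa_plus q x y * kappa_minus q x y.
  by ring.
by rewrite h1 h2; field; rewrite lt0r_neq0.
Qed.

End Kappa.

Section Generic.
Variables (R : realType) (q : R).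

(** For [q = 0] only the exponent [k = 0] constrains [z], in agreement with the set of inverse
    powers being read as 1 alone. *)
Lemma generic_denominator (z : R) : 0 <= q -> ~ inv_powers q z ->
  forall k, 1 - z * q ^+ k != 0.
Proof.
move=> q0 zq k; rewrite subr_eq0 eq_sym; apply/negP => /eqP E; apply: zq.
rewrite /inv_powers; case: eqVneq E => [-> |qN] E.
  case: k E => [|k]; first by rewrite expr0 mulr1.
  by rewrite exprS mul0r mulr0 => /eqP; rewrite eq_sym oner_eq0.
exists k => //; apply: (mulIf (expf_neq0 k qN)).
by rewrite E mulVf ?expf_neq0.
Qed.

End Generic.

(** * Convergence of finite-dimensional distributions *)

Section UniformContinuity.
Variables (R : realType) (k : nat).
Implicit Types (x y : 'rV[R]_k) (f : 'rV[R]_k -> R).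

(** Only [x] is confined to the unit cube; the compactness argument covers the cube while the radius
    tends to 0 from the right. *)
Lemma box_unif_continuous f (eps : R) : continuous f -> 0 < eps ->
  exists2 dlt, 0 < dlt & forall x y, (forall j, 0 <= x ord0 j <= 1) ->
    (forall j, `|x ord0 j - y ord0 j| < dlt) -> `|f x - f y| < eps.
Proof.
move=> fc e0.
have K : compact [set x : 'rV[R]_k | forall j, `[0, 1]%classic (x ord0 j)].
  by apply: (@rV_compact R k (fun=> `[0, 1]%classic)) => _; apply: segment_compact.
have := (compact_near_coveringP _).1 K R (0^'+)
  (fun dlt x => forall y, (forall j, `|x ord0 j - y ord0 j| < dlt) -> `|f x - f y| < eps) _.
have e2 : 0 < eps / 2 by rewrite divr_gt0.
case=> [x _|dlt0 d0 dP].
  have /cvgrPdist_lt /(_ _ e2) /nbhs_ballP [r /= r0 rP] := fc x.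
  have r2 : 0 < r / 2 by rewrite divr_gt0.
  (* Half radii: [y] is within [r / 2] of [x'] and [x'] within [r / 2] of [x], so both lie where [f]
     differs from [f x] by less than [eps / 2]. *)
  exists (ball x (r / 2), [set d | 0 < d < r / 2]).
    split; first exact: nbhsx_ballx.
    by near=> d => /=; apply/andP; split.
  move=> [x' d] /= [xx' /andP[d0 dr]] y x'y.
  have fx' : `|f x - f x'| < eps / 2.
    apply: rP; apply: le_ball xx'; lra.
  have fy : `|f x - f y| < eps / 2.
    apply: rP; split => // i j; rewrite (ord1 i) /ball /=.
    case: xx' => _ /(_ ord0 j); rewrite /ball /= => xx'.
    have -> : x ord0 j - y ord0 j = (x ord0 j - x' ord0 j) + (x' ord0 j - y ord0 j) by ring.
    by rewrite (le_lt_trans (ler_normD _ _)) //; have := x'y j; lra.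
  have -> : f x' - f y = (f x - f y) - (f x - f x') by ring.
  by rewrite (le_lt_trans (ler_normB _ _)) //; lra.
exists (dlt0 / 2); first by rewrite divr_gt0.
have dh : 0 < dlt0 / 2 by rewrite divr_gt0.
have db : `|0 - dlt0 / 2| < dlt0.
  by rewrite sub0r normrN gtr0_norm // ltr_pdivrMr // ltr_pMr // ltr1n.
by move=> x y xb xy; apply: (dP (dlt0 / 2) db dh).
Unshelve. all: by end_near.
Qed.

(* The quadratic modulus lets a variance bound control bounded continuous
   functions, without Chebyshev's inequality. *)
Lemma box_quadratic_modulus f (M eps : R) : continuous f -> (forall v, `|f v| <= M) ->
  0 < eps -> exists2 kap, 0 <= kap & forall x y, (forall j, 0 <= x ord0 j <= 1) ->
    `|f x - f y| <= eps + kap * \sum_j (x ord0 j - y ord0 j) ^+ 2.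
Proof.
move=> fc fM e0; have [dlt d0 dP] := box_unif_continuous fc e0.
have M0 : 0 <= M by apply: le_trans (fM 0).
have kap0 : 0 <= 2 * M / dlt ^+ 2.
  by apply: divr_ge0; [exact: mulr_ge0|exact: sqr_ge0].
exists (2 * M / dlt ^+ 2) => //.
move=> x y xb; set S := \sum_j _.
have S0 : 0 <= S by apply: sumr_ge0 => j _; apply: sqr_ge0.
have [H|/existsNP [j /negP jd]] := pselect (forall j, `|x ord0 j - y ord0 j| < dlt).
  by rewrite (le_trans (ltW (dP x y xb H))) // lerDl mulr_ge0.
have jS : dlt ^+ 2 <= S.
  rewrite /S (bigD1 j) //= (@le_trans _ _ ((x ord0 j - y ord0 j) ^+ 2)) //.
    rewrite -[leRHS]real_normK ?num_real // lerXn2r ?nnegrE ?(ltW d0) //.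
    by rewrite leNgt.
  by rewrite lerDl; apply: sumr_ge0 => l _; apply: sqr_ge0.
apply: (@le_trans _ _ (2 * M)).
  by rewrite (le_trans (ler_normB _ _)) // mulr_natl mulr2n lerD.
rewrite (@le_trans _ _ (2 * M / dlt ^+ 2 * S)) ?lerDr ?(ltW e0) //.
rewrite -{1}[2 * M](@divfK _ (dlt ^+ 2)) ?expf_neq0 ?lt0r_neq0 //.
exact: ler_wpM2l.
Qed.

End UniformContinuity.

Section FiniteExpectation.
Context d (T : measurableType d) (R : realType) (P : probability T R).

Lemma expectation_finite (I : finType) (E : I -> set T) (c : I -> R) (X : T -> R) :
  (forall i, measurable (E i)) -> (forall w, exists i, E i w) ->
  (forall w i j, E i w -> E j w -> i = j) ->
  (forall w i, E i w -> X w = c i) ->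
  P.-integrable setT (EFin \o X) /\
  ('E_P[X] = (\sum_i c i * fine (P (E i)))%:E)%E.
Proof.
move=> mE cE uE XE.
have XS : EFin \o X = (fun w => \sum_i ((c i)%:E * (\1_(E i) w)%:E)%E).
  apply/funext => w /=; have [i Ei] := cE w.
  rewrite (bigD1 i) //= big1 => [|j ji].
    by rewrite adde0 (XE w i Ei) indicE mem_set // mule1.
  rewrite indicE memNset ?mule0 // => Ej.
  by rewrite (uE w j i) // eqxx in ji.
have iE i : P.-integrable setT (fun w => ((c i)%:E * (\1_(E i) w)%:E)%E).
  by apply: integrableZl => //; apply: integrable_indic.
split; first by rewrite XS; apply: integrable_sum.
rewrite unlock -/(comp EFin X) XS integral_sum //.
rewrite -sumEFin; apply: eq_bigr => i _.
rewrite integralZl //; last exact: integrable_indic.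
by rewrite integral_indic // setIT EFinM fineK // fin_num_measure.
Qed.

End FiniteExpectation.

(** * Riemann sums for a uniform variable *)

Section Uniform.
Variable R : realType.

Lemma uniform_prob_itv (a b : R) : 0 <= a -> a < b -> b <= 1 ->
  uniform_prob (@ltr01 R) `[a, b[ = (b - a)%:E.
Proof.
move=> a0 ab b1; rewrite /uniform_prob (eq_integral (fun=> 1%:E)); last first.
  move=> x; rewrite inE /= in_itv /= => /andP[ax xb].
  rewrite /uniform_pdf subr0 invr1 ifT //; apply/andP; split; lra.
by rewrite integral_cst //= lebesgue_measure_itv /= lte_fin ab mul1e.
Qed.

(** The events that [U] falls in [[i / n, (i + 1) / n[] have probability [1 / n]. On each, [g] stays
    within [eps] of its left value, so step functions enclose the expectation between the Riemann
    sum minus and plus [eps]. *)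
Lemma uniform_averages d (T : measurableType d) (P : probability T R) (U : {RV P >-> R})
    (g : R -> R) (M : R) :
  (forall E : set R, measurable E -> distribution P U E = uniform_prob (@ltr01 R) E) ->
  continuous g -> (forall u, `|g u| <= M) ->
  exists2 I, ('E_P[fun w => g (U w)] = I%:E)%E &
  forall n eps, (0 < n)%N -> 0 <= eps ->
    (forall i u, (i < n)%N -> i%:R / n%:R <= u < i.+1%:R / n%:R -> `|g u - g (i%:R / n%:R)| <= eps) ->
    `|(\sum_(i < n) g (i%:R / n%:R)) / n%:R - I| <= eps.
Proof.
move=> Uu gc gM.
have M0 : 0 <= M by apply: le_trans (gM 0).
have mgU : measurable_fun setT (g \o U).
  by apply: measurableT_comp => //; apply: measurable_realfun.continuous_measurable_fun.
have ig : P.-integrable setT (EFin \o (g \o U)).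
  apply: measurable_bounded_integrable => //.
    by rewrite ltey_eq fin_num_measure.
  exists M; split; first exact: num_real.
  by move=> x Mx w _ /=; rewrite (le_trans (gM _)) // ltW.
have fin : ('E_P[g \o U])%E \is a fin_num.
  by rewrite unlock; apply: integrable_fin_num.
exists (fine ('E_P[g \o U])%E); first by rewrite fineK.
move=> n eps n0 e0 H.
have n0' : 0 < n%:R :> R by rewrite ltr0n.
pose B (i : 'I_n) : set R := `[i%:R / n%:R, i.+1%:R / n%:R[%classic.
(* [None] collects the values outside [[0, 1[], so that the events partition the whole sample space.
   It is a null event, where the crude bound [M] is enough. *)
pose E (o : option 'I_n) : set T := if o is Some i then U @^-1` (B i)
  else U @^-1` (~` `[0, 1[%classic).
have mB o : exists2 D : set R, measurable D & E o = U @^-1` D.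
  case: o => [i|]; first by exists (B i) => //; apply: measurable_itv.
  by exists (~` `[0, 1[%classic) => //; apply: measurableC; apply: measurable_itv.
have mE o : measurable (E o).
  by have [D mD ->] := mB o; apply: measurable_funPTI.
have PE (i : 'I_n) : P (E (Some i)) = (n%:R^-1)%:E.
  have := Uu (B i); rewrite /distribution /pushforward => ->; last exact: measurable_itv.
  rewrite /B uniform_prob_itv ?divr_ge0 //.
  - by rewrite -mulrBl -natr1 addrC addKr mul1r.
  - by rewrite ltr_pM2r ?invr_gt0 // ltr_nat.
  - by rewrite ler_pdivrMr // mul1r ler_nat.
have PN : P (E None) = 0.
  have -> : E None = ~` (U @^-1` `[0, 1[%classic) by [].
  rewrite probability_setC; last by apply: measurable_funPTI; apply: measurable_itv.
  have := Uu `[0, 1[%classic; rewrite /distribution /pushforward => -> //.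
  by rewrite uniform_prob_itv // subr0 subee.
have cE w : exists o, E o w.
  have [/andP[U0 U1]|] := boolP (0 <= U w < 1); last first.
    by move=> UN; exists None => /=; rewrite in_itv /=; apply/negP.
  have nU : 0 <= n%:R * U w by rewrite mulr_ge0 // ltW.
  have /andP[lo hi] := truncn_itv nU.
  have tn : (Num.truncn (n%:R * U w) < n)%N.
    by rewrite -(ltr_nat R) (le_lt_trans lo) // gtr_pMr.
  exists (Some (Ordinal tn)) => /=; rewrite /B /= in_itv /=.
  by rewrite ler_pdivrMr // ltr_pdivlMr // ![U w * _]mulrC lo hi.
have Bi (i : 'I_n) w : E (Some i) w -> i = Num.truncn (n%:R * U w) :> nat /\ 0 <= U w < 1.
  rewrite /E /B /= in_itv /= ler_pdivrMr // ltr_pdivlMr // ![U w * _]mulrC => /andP[lo hi].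
  split; first by apply/esym/truncn_def; rewrite lo.
  rewrite -(pmulr_rge0 _ n0') (le_trans _ lo) //=.
  rewrite -(ltr_pM2l n0') mulr1 (lt_le_trans hi) // ler_nat.
  exact: ltn_ord.
have NB w : E None w -> ~~ (0 <= U w < 1).
  by rewrite /E /= in_itv /= => /negP.
have uE w o o' : E o w -> E o' w -> o = o'.
  case: o o' => [i|] [j|] //.
  - by move=> /Bi[iE _] /Bi[jE _]; congr Some; apply: val_inj; rewrite /= iE jE.
  - by move=> /Bi[_ h] /NB; rewrite h.
  - by move=> /NB + /Bi[_ h]; rewrite h.
pose gi (i : 'I_n) := g (i%:R / n%:R).
pose lo o : R := if o is Some i then gi i - eps else - M.
pose hi o : R := if o is Some i then gi i + eps else M.
have [oE oEP] := choice cE.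
have [il El] := @expectation_finite _ _ _ P _ E lo (lo \o oE) mE cE uE
  (fun w o Eo => congr1 lo (uE w _ _ (oEP w) Eo)).
have [ih Eh] := @expectation_finite _ _ _ P _ E hi (hi \o oE) mE cE uE
  (fun w o Eo => congr1 hi (uE w _ _ (oEP w) Eo)).
have sumE (c : option 'I_n -> R) : \sum_o c o * fine (P (E o)) = (\sum_i c (Some i)) / n%:R.
  rewrite (bigD1 None) //= PN mulr0 add0r mulr_suml.
  rewrite (reindex_omap Some id) /=; last by case.
  by apply: eq_big => [i|i _]; rewrite ?eqxx // PE.
have bnd w : lo (oE w) <= g (U w) <= hi (oE w).
  have := oEP w; case: (oE w) => [i|] /=; last by rewrite -ler_norml.
  rewrite /B /= in_itv /= => Ui.
  have := H i (U w) (ltn_ord i) Ui; rewrite ler_norml /gi; lra.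
have fE : ('E_P[g \o U])%E = (fine ('E_P[g \o U])%E)%:E by rewrite fineK.
have le1 : ('E_P[lo \o oE] <= 'E_P[g \o U])%E.
  rewrite unlock; apply: le_integral => // w _ /=.
  by rewrite lee_fin; have /andP[] := bnd w.
have le2 : ('E_P[g \o U] <= 'E_P[hi \o oE])%E.
  rewrite unlock; apply: le_integral => // w _ /=.
  by rewrite lee_fin; have /andP[] := bnd w.
move: le1 le2; rewrite El Eh !sumE fE !lee_fin /lo /hi big_split /= big_split /=.
rewrite sumrN !sumr_const card_ord -[eps *+ n]mulr_natr !mulrDl mulNr mulfK ?lt0r_neq0 //.
by rewrite /gi ler_norml; lra.
Qed.

End Uniform.

Lemma height_word (R : realType) n (s : asep_config n) (x : R) : 0 <= x -> x <= 1 ->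
  [/\ asep_height s x = (count id (take (Num.truncn (n%:R * x)) (word s)))%:R,
      (Num.truncn (n%:R * x) <= n)%N &
      (Num.truncn (n%:R * x))%:R <= n%:R * x <= (Num.truncn (n%:R * x))%:R + 1].
Proof.
move=> x0 x1; have nx : 0 <= n%:R * x by rewrite mulr_ge0.
have /andP[lo hi] := truncn_itv nx; set N := Num.truncn _ in lo hi *.
have Nn : (N <= n)%N by rewrite -(ler_nat R) (le_trans lo) // ler_piMr.
split => //; last by rewrite lo natr1 ltW.
rewrite /asep_height (eq_bigl (fun i : 'I_n => (i < N)%N)); last first.
  by move=> i; rewrite floor_ge_int /N truncn_gt_nat.
under eq_bigr => i _ do rewrite -(nth_word s false i).
rewrite -(big_ord_widen n (fun i => (nth false (word s) i)%:R)) //.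
have -> : count id (take N (word s)) = (\sum_(i < N) nth false (word s) i)%N.
  rewrite -sum1_count (big_nth false) size_takel ?size_word // big_mkord.
  rewrite [LHS]big_mkcond /=; apply: eq_bigr => i _.
  by rewrite nth_take //; case: nth.
by rewrite natr_sum.
Qed.

(** * Matrix product formula for the stationary measure *)

Section Weights.
Variables (R : realType) (q alpha beta gamma delta A B C D : R).
Hypotheses (alphaE : alpha * ((1 + C) * (1 + D)) = 1 - q) (gammaE : gamma = - alpha * (C * D))
  (betaE : beta * ((1 + A) * (1 + B)) = 1 - q) (deltaE : delta = - beta * (A * B)).
Variables (W : (nat -> R^o) -> R) (V : nat -> R^o).
Hypotheses (Wb : lbound q C D C D W) (Vb : rbound q C D A B V).

Local Notation G := (fun w => W (act q C D w V)).
Local Notation site := (site q C D).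

Lemma weight_bulk u v :
  G (u ++ true :: false :: v) - q * G (u ++ false :: true :: v) =
  (1 - q) * (G (u ++ true :: v) + G (u ++ false :: v)).
Proof.
have [WL _] := Wb; rewrite !act_cat /=; set y := act _ _ _ v _.
have Wu := lin_act q C D u WL.
have com : site true (site false y) - q *: site false (site true y) =
    (1 - q) *: (site true y + site false y).
  rewrite !site1 !site0.
  have -> : lower (y + raise q C D y) = lower y + lower (raise q C D y).
    by rewrite -[X in lower (X + _)]scale1r lowerP scale1r.
  have -> : raise q C D (y + lower y) = raise q C D y + raise q C D (lower y).
    by rewrite -[X in raise _ _ _ (X + _)]scale1r raiseP scale1r.
  by rewrite oscillatorP; apply/funext => k; rewrite !(addfE, oppfE, scalefE); ring.
have := congr1 (fun z => W (act q C D u z)) com.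
rewrite (linD _ _ Wu) (linN _ Wu) !(linZ _ _ Wu) (linD _ _ Wu) //.
Qed.

Lemma weight_left v : alpha * G (false :: v) - gamma * G (true :: v) = (1 - q) * G v.
Proof.
have [WL WE] := Wb; rewrite /= site1 site0 !(linD _ _ WL) WE gammaE -alphaE.
by ring.
Qed.

Lemma weight_right v :
  beta * G (rcons v true) - delta * G (rcons v false) = (1 - q) * G v.
Proof.
have [WL _] := Wb; have Wv := lin_act q C D v WL.
rewrite !act_rcons site1 site0 !(linD _ _ Wv) Vb (linD _ _ Wv) (linN _ Wv) !(linZ _ _ Wv).
by rewrite deltaE -betaE; ring.
Qed.

Lemma stationary_weights n (mu : asep_config n -> R) : 0 < alpha -> 0 <= beta ->
  0 <= gamma -> 0 <= delta -> 0 <= q -> (0 < n)%N ->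
  asep_stationary q alpha beta gamma delta mu -> wsum n G != 0 ->
  forall s, mu s = G (word s) / wsum n G.
Proof.
move=> a0 b0 g0 d0 q0 n0 muS Z0 s.
have muL := stationary_generator muS.
have [_ mu1 _] := muS.
have FL f := matrix_product_stationary weight_bulk weight_left weight_right f n0.
have := stationary_proportional a0 b0 g0 d0 q0 mu1 muL FL s.
by rewrite (sum_config n G) => ->; rewrite mulrC mulKf.
Qed.

End Weights.

Section ShockProfile.
Variables (R : realType) (A : R).
Hypothesis A_gt1 : 1 < A.

Lemma shock_lipschitz u v x : `|shock_profile A u x - shock_profile A v x| <= `|u - v|.
Proof.
have A1 := A_gt1; have A0 : 0 < 1 + A by lra.
have -> : shock_profile A u x - shock_profile A v x =
    (1 - A) / (1 + A) * (Num.min x u - Num.min x v).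
  by rewrite /shock_profile; field; rewrite lt0r_neq0.
have h : `|Num.min x u - Num.min x v| <= `|u - v|.
  have := ler_norm (u - v); have := ler_norm (v - u); rewrite distrC => h1 h2.
  by rewrite /Num.min; case: ltP => h3; case: ltP => h4; rewrite ler_norml; lra.
rewrite normrM (le_trans _ h) // ler_piMl //.
rewrite ler_norml; apply/andP; split.
  by rewrite lerNl -mulNr ler_pdivrMr //; lra.
by rewrite ler_pdivrMr //; lra.
Qed.

Lemma shock_unit u x : 0 <= u -> 0 <= x <= 1 -> 0 <= shock_profile A u x <= 1.
Proof.
have A1 := A_gt1; have A0 : 0 < 1 + A by lra.
move=> u0 /andP[x0 x1]; rewrite /shock_profile ler_pdivrMr // divr_ge0 ?(ltW A0) //=.
  have : Num.min x u <= x by rewrite ge_min lexx.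
  have : 0 <= Num.min x u by rewrite le_min x0.
  set m := Num.min x u => m0 mx.
  have h : 0 <= (A - 1) * m by rewrite mulr_ge0 //; lra.
  have h2 : 0 <= A * (1 - x) by rewrite mulr_ge0 //; lra.
  by lra.
have : Num.min x u <= x by rewrite ge_min lexx.
have : 0 <= Num.min x u by rewrite le_min x0.
set m := Num.min x u => m0 mx.
have : 0 <= A * (x - m) by rewrite mulr_ge0 //; lra.
by lra.
Qed.

(* [n * shock_profile A (k / n) x] is the mean number of particles on the
   first [n * x] sites when the first [k] sites have density [1 / (1 + A)] and
   the others [A / (1 + A)], up to rounding [n * x] to an integer [N]. *)
Lemma shock_center n k N x : (0 < n)%N -> N%:R <= n%:R * x <= N%:R + 1 ->
  `|((1 + A)^-1 * (minn k N)%:R + A / (1 + A) * (N - k)%:R)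
      - n%:R * shock_profile A (k%:R / n%:R) x| <= 2.
Proof.
move=> n0 /andP[lo hi]; have A1 := A_gt1; have A0 : 0 < 1 + A by lra.
have n0' : 0 < n%:R :> R by rewrite ltr0n.
pose m : R := Num.min (n%:R * x) k%:R.
have mE : n%:R * Num.min x (k%:R / n%:R) = m.
  by rewrite minr_pMr ?ltW // [n%:R * (_ / _)]mulrC divfK // lt0r_neq0.
have -> : n%:R * shock_profile A (k%:R / n%:R) x =
    A / (1 + A) * (n%:R * x) + (1 - A) / (1 + A) * m.
  by rewrite -mE /shock_profile; field; rewrite lt0r_neq0.
pose m' : R := (minn k N)%:R.
have -> : (N - k)%:R = N%:R - m' :> R.
  rewrite /m'; case: (leqP k N) => kN; first by rewrite natrB.
  by rewrite subrr; move/ltnW: kN; rewrite -subn_eq0 => /eqP->.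
rewrite -/m'.
have -> : (1 + A)^-1 * m' + A / (1 + A) * (N%:R - m') -
   (A / (1 + A) * (n%:R * x) + (1 - A) / (1 + A) * m) =
   A / (1 + A) * (N%:R - n%:R * x) + (1 - A) / (1 + A) * (m' - m).
  by field; rewrite lt0r_neq0.
have mm : `|m' - m| <= 1.
  rewrite /m' /m; case: (leqP k N) => kN.
    have : k%:R <= N%:R :> R by rewrite ler_nat.
    by move=> kN'; rewrite min_r ?subrr ?normr0 ?ler01 // (le_trans kN').
  have : N%:R + 1 <= k%:R :> R by rewrite natr1 ler_nat.
  move=> kN'; rewrite min_l; last exact: le_trans kN'.
  by rewrite ler_norml; lra.
have a1 : `|A / (1 + A)| <= 1.
  rewrite ger0_norm; first by rewrite ler_pdivrMr //; lra.
  by rewrite divr_ge0 //; lra.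
have b1 : `|(1 - A) / (1 + A)| <= 1.
  rewrite ler_norml; apply/andP; split.
    by rewrite lerNl -mulNr ler_pdivrMr //; lra.
  by rewrite ler_pdivrMr //; lra.
have N1 : `|N%:R - n%:R * x| <= 1 by rewrite ler_norml; lra.
move: a1 b1 N1 mm; set a := A / _; set b := (1 - A) / _; set z := _ - _; set y := _ - _.
move=> a1 b1 z1 y1; apply: le_trans (ler_normD _ _) _.
have h1 : `|a * z| <= 1 by rewrite normrM mulr_ile1.
have h2 : `|b * y| <= 1 by rewrite normrM mulr_ile1.
by lra.
Qed.

End ShockProfile.

Lemma shock_row_continuous (R : realType) (A : R) k (t : 'I_k -> R) (f : 'rV[R]_k -> R) :
  1 < A -> continuous f -> continuous (fun u => f (\row_j shock_profile A u (t j))).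
Proof.
move=> A1 fc u.
apply: (@continuous_comp _ _ _ (fun u => \row_j shock_profile A u (t j)) f); last exact: fc.
apply/cvg_ballP => e e0; apply/nbhs_ballP; exists e => //= v uv.
split=> // i j; rewrite !mxE /ball /=.
exact: le_lt_trans (shock_lipschitz A1 _ _ _) uv.
Qed.

(** [(a + b) ^ 2 <= 2 a ^ 2 + 2 b ^ 2], where [b] is the rounding error of [shock_center], at most
    2; this gives the constant [8 = 2 * 2 ^ 2]. *)
Lemma height_deviation (R : realType) (A : R) n k (t : 'I_k -> R) (w : seq bool) i :
  1 < A -> (0 < n)%N -> (forall j, 0 <= t j <= 1) ->
  \sum_j (n%:R^-1 * (count id (take (Num.truncn (n%:R * t j)) w))%:R
      - shock_profile A (i%:R / n%:R) (t j)) ^+ 2 <=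
  2 / n%:R ^+ 2 * \sum_j ((count id (take (Num.truncn (n%:R * t j)) w))%:R
    - ((1 + A)^-1 * (minn i (Num.truncn (n%:R * t j)))%:R
       + A / (1 + A) * (Num.truncn (n%:R * t j) - i)%:R)) ^+ 2
  + 8 * k%:R / n%:R ^+ 2.
Proof.
move=> A1 n0 t01; have n0' : 0 < n%:R :> R by rewrite ltr0n.
have -> : 8 * k%:R / n%:R ^+ 2 = \sum_(j < k) 8 / n%:R ^+ 2 :> R.
  by rewrite sumr_const card_ord -mulr_natr; ring.
rewrite mulr_sumr -big_split /=; apply: ler_sum => j _.
have /andP[t0 t1] := t01 j.
have nx : 0 <= n%:R * t j by rewrite mulr_ge0 // ltW.
have /andP[lo hi] := truncn_itv nx.
set N := Num.truncn _ in lo hi *.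
set h := (count id _)%:R; set c := (1 + A)^-1 * _ + _.
set s := shock_profile _ _ _.
have cs : `|c - n%:R * s| <= 2.
  by apply: shock_center => //; rewrite lo natr1 ltW.
have cs2 : (c - n%:R * s) ^+ 2 <= 4.
  have -> : 4 = 2 ^+ 2 :> R by ring.
  by rewrite -real_normK ?num_real // lerXn2r ?nnegrE.
have -> : (n%:R^-1 * h - s) ^+ 2 = ((h - c) + (c - n%:R * s)) ^+ 2 / n%:R ^+ 2.
  by field; rewrite lt0r_neq0.
rewrite -[2 / _ * _]mulrAC -mulrDl ler_pM2r ?invr_gt0 ?exprn_gt0 //.
have := sqr_ge0 ((h - c) - (c - n%:R * s)).
have -> : ((h - c) - (c - n%:R * s)) ^+ 2 =
   2 * (h - c) ^+ 2 + 2 * (c - n%:R * s) ^+ 2 - ((h - c) + (c - n%:R * s)) ^+ 2 by ring.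
by lra.
Qed.

(** Both expectations are compared with the average over [i < n] of the test function at the profile
    with shock at [i / n]: the first by [shock_averages], the second as a Riemann sum. *)
Theorem theorem1p6 (R : realType) (q alpha beta gamma delta A B C D : R)
  (alpha_gt0 : 0 < alpha) (beta_gt0 : 0 < beta)
  (gamma_ge0 : 0 <= gamma) (delta_ge0 : 0 <= delta)
  (q_ge0 : 0 <= q) (q_lt1 : q < 1)
  (defA : A = kappa_plus q beta delta) (defB : B = kappa_minus q beta delta)
  (defC : C = kappa_plus q alpha gamma) (defD : D = kappa_minus q alpha gamma)
  (mu : forall n : nat, asep_config n -> R)
  (mu_stat : forall n : nat, (0 < n)%N ->
     asep_stationary q alpha beta gamma delta (mu n))
  (d_ : nat -> measure_display) (Om_ : forall n, measurableType (d_ n))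
  (P_ : forall n, probability (Om_ n) R)
  (tau : forall n : nat, 'I_n -> {RV (P_ n) >-> bool})
  (tau_law : forall n : nat, (0 < n)%N -> forall s : asep_config n,
     P_ n [set w | forall i, tau n i w = s i] = (mu n s)%:E)
  (d : measure_display) (Om : measurableType d) (P : probability Om R)
  (U : {RV P >-> R})
  (U_unif : forall E : set R, measurable E ->
     distribution P U E = uniform_prob (@ltr01 R) E)
  (eqAC : A = C) (A_gt1 : 1 < A)
  (ABCD_generic : ~ inv_powers q (A * B * C * D)) :
  fdd_convergence `[0, 1]%classic
    P_ (fun n x w => n%:R^-1 * asep_height (fun i => tau n i w) x)
    P (fun x w => shock_profile A (U w) x).
Proof.
move=> k t tD f fc [M fM].
have t01 j : 0 <= t j <= 1 by have := tD j; rewrite /= in_itv.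
have M0 : 0 <= M by apply: le_trans (fM 0).
have A0 : 0 < A by lra.
have generic := generic_denominator q_ge0 ABCD_generic.
rewrite -eqAC in defC generic.
have A1B : (1 + A) * (1 + B) = (1 - q) / beta.
  by rewrite defA defB; apply: kappa_factor.
have A1D : (1 + A) * (1 + D) = (1 - q) / alpha.
  by rewrite {1}defC defD; apply: kappa_factor.
have AB : A * B = - delta / beta by rewrite defA defB; apply: kappa_prod.
have AD : A * D = - gamma / alpha by rewrite {1}defC defD; apply: kappa_prod.
have B_le0 : B <= 0 by rewrite defB; apply: kappa_minus_le0.
have D_le0 : D <= 0 by rewrite defD; apply: kappa_minus_le0.
have gtN1 x z : 0 < z -> (1 + A) * (1 + x) = (1 - q) / z -> -1 < x.
  move=> z0 E; have : 0 < (1 + A) * (1 + x) by rewrite E divr_gt0 // subr_gt0.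
  by rewrite pmulr_rgt0; lra.
have B_gtN1 := gtN1 _ _ beta_gt0 A1B; have D_gtN1 := gtN1 _ _ alpha_gt0 A1D.
pose W (g : nat -> R^o) : R := g 0%N; pose V := bvec q A B A D.
have Wb : lbound q A D A D W := ev0_lbound q A D.
have Vb : rbound q A D A B V := bvec_rbound generic.
have WV : W V != 0 by rewrite /W /V /bvec /= oner_neq0.
have [K K0 KP] := suffix_boundsP q_ge0 q_lt1 A_gt1 B_gtN1 B_le0 D_gtN1 D_le0 generic Wb Vb WV.
have [K' K'0 [n0 avg]] := shock_averages A_gt1 D_le0 Wb K0 KP.
have aE : alpha * ((1 + A) * (1 + D)) = 1 - q by rewrite A1D mulrC divfK // lt0r_neq0.
have gE : gamma = - alpha * (A * D).
  by rewrite AD mulNr mulNr mulrN opprK mulrC divfK // lt0r_neq0.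
have bE : beta * ((1 + A) * (1 + B)) = 1 - q by rewrite A1B mulrC divfK // lt0r_neq0.
have dE : delta = - beta * (A * B).
  by rewrite AB mulNr mulNr mulrN opprK mulrC divfK // lt0r_neq0.
pose Z n := wsum n (fun w => W (act q A D w V)).
have muE n s : (0 < n)%N -> Z n != 0 -> mu n s = W (act q A D (word s) V) / Z n.
  move=> n_gt0 Zn.
  exact: (stationary_weights aE gE bE dE Wb Vb alpha_gt0 (ltW beta_gt0)
    gamma_ge0 delta_ge0 q_ge0 n_gt0 (mu_stat n n_gt0) Zn).
pose g u := f (\row_j shock_profile A u (t j)).
have gc : continuous g by apply: shock_row_continuous.
have [I IE IP] := uniform_averages U_unif gc (fun u => fM _).
pose N n j := Num.truncn (n%:R * t j).
pose Phi n (w : seq bool) := f (\row_j (n%:R^-1 * (count id (take (N n j) w))%:R)).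
pose x n := \sum_s mu n s * Phi n (word s).
rewrite [X in _ --> X]IE.
pose X n (w : Om_ n) := f (\row_j (n%:R^-1 * asep_height (fun i => tau n i w) (t j))).
(* Only the law of the occupation variables enters: the sample space splits into the events of the
   finitely many configurations. *)
have EX n : (0 < n)%N -> ('E_(P_ n)[X n] = (x n)%:E)%E.
  move=> n_gt0.
  pose E (s : asep_config n) := [set w | forall i, tau n i w = s i].
  have mE s : measurable (E s).
    have -> : E s = \bigcap_(i in [set: 'I_n]) (tau n i @^-1` [set s i]).
      by apply/seteqP; split => w /= h i; [move=> _; exact: h|exact: (h i Logic.I)].
    apply: fin_bigcap_measurable => // i _; exact: measurable_funPTI.
  have cE w : exists s, E s w by exists [ffun i => tau n i w] => i; rewrite ffunE.
  have uE w s s' : E s w -> E s' w -> s = s'.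
    by move=> ws ws'; apply/ffunP => i; rewrite -ws ws'.
  have XE w s : E s w -> X n w = Phi n (word s).
    move=> ws; rewrite /X /Phi; congr f; apply/rowP => j; rewrite !mxE.
    have -> : (fun i => tau n i w) = s by apply/funext.
    have /andP[t0 t1] := t01 j.
    by have [-> _ _] := height_word s t0 t1.
  have [_ ->] := expectation_finite (P_ n) mE cE uE XE.
  by congr (_%:E); apply: eq_bigr => s _; rewrite tau_law //= mulrC.
apply: (@cvg_trans _ ((fun n => (x n)%:E) @ \oo)).
  by apply: near_eq_cvg; exists 1%N => // n /= n_gt0; rewrite -EX.
apply: cvg_EFin; first by near=> n.
apply/cvgrPdist_le => e e0.
(* The two comparisons cost [K' (eps + Q / n)] and [eps + Q / n]; once [Q / n <= eps] they add up to
   at most [2 (K' + 1) eps]. *)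
pose eps := e / (2 * (K' + 1)).
have K1 : 0 < K' + 1 by rewrite ltr_wpDl.
have eps0 : 0 < eps by rewrite divr_gt0 // mulr_gt0.
have [kap kap0 kapP] := box_quadratic_modulus fc fM eps0.
(* [10 = 2 + 8]: the factor 2 in front of the fluctuations in [height_deviation] and the rounding
   constant 8. *)
pose Q := M + 10 * kap * k%:R.
have Q0 : 0 <= Q by rewrite addr_ge0 // !mulr_ge0.
exists (maxn n0 (Num.bound (Q / eps))) => // n /=; rewrite geq_max => /andP[nn0 nQ].
have [n_gt0 Zn avgn] := avg n nn0.
have n1 : 1 <= n%:R :> R by rewrite ler1n.
have nr0 : 0 < n%:R :> R by rewrite ltr0n.
have xE : x n = wsum n (fun w => W (act q A D w V) * Phi n w) / Z n.
  rewrite -sum_config mulr_suml; apply: eq_bigr => s _.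
  by rewrite muE // mulrAC.
have ik : k%:R / n%:R ^+ 2 <= k%:R / n%:R :> R.
  by rewrite ler_wpM2l // lef_pV2 ?posrE ?exprn_gt0 // expr2 ler_peMl.
have kk0 : 0 <= k%:R / n%:R :> R by rewrite divr_ge0.
have h1 : `|x n - (\sum_(i < n) g (i%:R / n%:R)) / n%:R| <= K' * (eps + Q / n%:R).
  rewrite xE.
  apply: le_trans (avgn (Phi n) (fun i => g (i%:R / n%:R)) M
    (eps + kap * (8 * k%:R / n%:R ^+ 2)) (kap * (2 / n%:R ^+ 2)) k (N n) M0 _ _ _ _ _ _) _.
  - by rewrite addr_ge0 ?(ltW eps0) // !mulr_ge0 // invr_ge0 exprn_ge0.
  - by rewrite !mulr_ge0 // invr_ge0 exprn_ge0.
  - by move=> i; apply: fM.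
  - by move=> w _; apply: fM.
  - move=> j; have /andP[t0 t1] := t01 j.
    by have [_ ? _] := height_word ([ffun=> true] : asep_config n) t0 t1.
  - move=> i w _ sw; pose v : 'rV[R]_k := \row_j (n%:R^-1 * (count id (take (N n j) w))%:R).
    have vb j : 0 <= v ord0 j <= 1.
      rewrite mxE; apply/andP; split; first by rewrite mulr_ge0 // invr_ge0.
      rewrite mulrC ler_pdivrMr // mul1r ler_nat (leq_trans (count_size _ _)) //.
      by rewrite size_take_min sw geq_minr.
    apply: le_trans (kapP v _ vb) _.
    rewrite -[leRHS]addrA lerD2l -[kap * (2 / _) * _]mulrA -[leRHS]mulrDr.
    apply: ler_wpM2l => //; rewrite [leRHS]addrC.
    under eq_bigr do rewrite !mxE.
    exact: height_deviation.
  - rewrite ler_wpM2l //.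
    have -> : kap * (2 / n%:R ^+ 2) * k%:R * n%:R = 2 * kap * (k%:R / n%:R).
      by field; rewrite lt0r_neq0.
    have -> : kap * (8 * k%:R / n%:R ^+ 2) = 8 * kap * (k%:R / n%:R ^+ 2) by ring.
    have -> : Q / n%:R = M / n%:R + 10 * kap * (k%:R / n%:R) by rewrite /Q; ring.
    by have := ler_wpM2l kap0 ik; lra.
(* The profile is 1-Lipschitz in the shock position, so each of the [k] squared increments over a
   cell is at most [1 / n ^ 2]. *)
have h2 : `|(\sum_(i < n) g (i%:R / n%:R)) / n%:R - I| <= eps + Q / n%:R.
  apply: (@le_trans _ _ (eps + kap * (k%:R / n%:R ^+ 2))); last first.
    have -> : Q / n%:R = M / n%:R + 10 * kap * (k%:R / n%:R) by rewrite /Q; ring.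
    have Mn : 0 <= M / n%:R by rewrite divr_ge0.
    by have := ler_wpM2l kap0 ik; have := mulr_ge0 kap0 kk0; lra.
  apply: IP => //; first by rewrite addr_ge0 ?(ltW eps0) // mulr_ge0 // divr_ge0 ?exprn_ge0.
  move=> i u ilt /andP[iu ui].
  have u0 : 0 <= u by apply: le_trans iu; rewrite divr_ge0.
  pose v : 'rV[R]_k := \row_j shock_profile A u (t j).
  have vb j : 0 <= v ord0 j <= 1 by rewrite mxE; apply: shock_unit.
  apply: le_trans (kapP v _ vb) _.
  rewrite lerD2l ler_wpM2l //.
  apply: (@le_trans _ _ (\sum_(j < k) n%:R^-1 ^+ 2)); last first.
    by rewrite sumr_const card_ord -[leLHS]mulr_natl exprVn.
  apply: ler_sum => j _; rewrite !mxE -real_normK ?num_real // lerXn2r ?nnegrE ?invr_ge0 //.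
  apply: le_trans (shock_lipschitz A_gt1 _ _ _) _.
  rewrite ger0_norm ?subr_ge0 // lerBlDl (le_trans (ltW ui)) //.
  by rewrite -[X in _ <= _ + X]mul1r -mulrDl natr1.
have Qn : Q / n%:R <= eps.
  rewrite ler_pdivrMr // -ler_pdivrMl // mulrC (le_trans _ (_ : (Num.bound (Q / eps))%:R <= _)) ?ler_nat //.
  by rewrite ltW // archi_boundP // divr_ge0 // ltW.
have -> : I - x n = - ((x n - (\sum_(i < n) g (i%:R / n%:R)) / n%:R)
   + ((\sum_(i < n) g (i%:R / n%:R)) / n%:R - I)) by ring.
rewrite normrN; apply: le_trans (ler_normD _ _) _.
apply: le_trans (lerD h1 h2) _.
have eE : e = (K' + 1) * (eps + eps) by rewrite /eps; field; rewrite lt0r_neq0.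
have := ler_wpM2l (ltW K1) Qn; lra.
Unshelve. all: by end_near.
Qed.
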